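(* Let $A$ be a conical instanton on $\mathbb{R}^8\setminus\{0\}$, on a bundle $E$, whose curvature $F_A$ takes values in $\mathrm{Lie}(\mathrm{Sp}(2))\otimes\mathfrak{g}_E$. Let $$W=\left\{\begin{pmatrix}a&\bar z\\ z&-a\end{pmatrix}\ \middle|\ a\in\mathbb{R},\ z\in\mathbb{H}\right\}$$ be the $5$-dimensional space of traceless self-adjoint $2\times2$ quaternionic matrices. Then $\ker\mathscr{L}_A$ contains the space $$\mathscr{V}_A=\{\alpha_M\mid M\in W\oplus WI_1\oplus WI_2\},\qquad \alpha_M=X_M\,\lrcorner\,F_A .$$ If $F_A(x,y)$ spans $\mathrm{Lie}(\mathrm{Sp}(2))$ as $(x,y)$ varies over $\mathbb{R}^8\setminus\{0\}$, then $\dim(\mathscr{V}_A)=15$.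
   Context: Identify the quaternions $\mathbb{H}$ with $\mathbb{R}^4$ via the oriented orthonormal basis $(e_0,e_1,e_2,e_3)=(\mathbf{1},-\mathbf{i},-\mathbf{j},-\mathbf{k})$, and let $\mathbb{R}^8=\mathbb{H}_x\oplus\mathbb{H}_y$ with coordinates $x^0,\dots,x^3,y^0,\dots,y^3$ and the Euclidean metric. Put $\omega_1^x=dx^{01}+dx^{23}$, $\omega_2^x=dx^{02}-dx^{13}$, $\omega_3^x=dx^{03}+dx^{12}$ (where $dx^{01}=dx^0\wedge dx^1$, etc.), and define $\omega_i^y$ in the same way. Let $I_1,I_2,I_3$ be the complex structures on $\mathbb{R}^8$ given by right multiplication by $e_1,e_2,e_3$ on both factors. Quaternionic $2\times 2$ matrices act on $\mathbb{R}^8=\mathbb{H}^2$ by left multiplication, hence are regarded as real $8\times8$ matrices commuting with the $I_i$; $WI_i=\{wI_i\mid w\in W\}$. Let $$\Psi_0=dx^{0123}+dy^{0123}+\omega_1^x\wedge\omega_1^y+\omega_2^x\wedge\omega_2^y-\omega_3^x\wedge\omega_3^y .$$ $\mathrm{Lie}(\mathrm{Sp}(2))\subset\mathfrak{so}(8)\cong\Lambda^2\mathbb{R}^8$ is the $10$-dimensional subalgebra of skew endomorphisms commuting with $I_1,I_2,I_3$. An instanton on $\mathbb{R}^8\setminus\{0\}$ is a $\mathrm{Spin}(7)$-instanton: $F_A+*(\Psi_0\wedge F_A)=0$ (this holds automatically when $F_A$ takes values in $\mathrm{Lie}(\mathrm{Sp}(2))\otimes\mathfrak{g}_E$). Conical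 means that $A$ is the pullback of a connection on $S^7$ under radial projection. For a real $8\times8$ matrix $M$, $X_M$ is the vector field on $\mathbb{R}^8$ whose value at the point $r$ is $M r$, and $\alpha_M=X_M\lrcorner F_A=F_A(X_M,\cdot)\in\Omega^1(\mathfrak{g}_E)$, which is restricted to the unit sphere $S^7$. Let $\vec r$ be the position vector field. $S^7$ has the round metric, orientation $\vec r\,\lrcorner\,(dx^{0123}\wedge dy^{0123})$, $\mathrm{G}_2$-structure $\phi=(\vec r\,\lrcorner\,\Psi_0)|_{S^7}$ and $\psi=*\phi=\Psi_0|_{S^7}$. For a $\mathfrak{g}_E$-valued $1$-form $\alpha$ on $S^7$, $\mathscr{L}_A(\alpha)=(D_A^*\alpha,\ *(\psi\wedge D_A\alpha))$, computed on $S^7$ with $A$ restricted to $S^7$. ''$F_A(x,y)$ spans $\mathrm{Lie}(\mathrm{Sp}(2))$ as $(x,y)$ varies'' means that the smallest linear subspace $S\subset\mathrm{Lie}(\mathrm{Sp}(2))$ with $F_A(x,y)\in S\otimes\mathfrak{g}_E$ for all $(x,y)$ is $\mathrm{Lie}(\mathrm{Sp}(2))$ itself. *)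

(* Defs.v *)
From HB Require Import structures.
From mathcomp Require Import all_boot all_order all_algebra.
From mathcomp Require Import all_classical all_reals all_analysis.
Import numFieldNormedType.Exports.
Import Order.TTheory GRing.Theory Num.Theory.
Set Implicit Arguments.
Unset Strict Implicit.
Unset Printing Implicit Defensive.
Local Open Scope classical_set_scope.
Local Open Scope ring_scope.

(* The coordinates x^0, .., x^3, y^0, .., y^3 have indices 0, .., 7. *)
Notation pt R := 'cV[R]_8.

(* An element a of Lambda^*(R^8) (x) V is the family of its coefficients:
   a = \sum_I a I dx^I, where dx^I is the product in increasing order. *)
Notation ext V := {ffun {set 'I_8} -> V}.

(* dx^I /\ dx^J = esign R I J dx^(I :|: J) for disjoint I and J. *)
Definition esign (R : realType) (I J : {set 'I_8}) : R :=
  (-1) ^+ #|[set p : 'I_8 * 'I_8 |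
               [&& p.1 \in I, p.2 \in J & (p.2 < p.1)%N]]%SET|.

Definition wedge (R : realType) (V1 V2 : Type) (V : lmodType R)
    (mul : V1 -> V2 -> V) (a : ext V1) (b : ext V2) : ext V :=
  [ffun K : {set 'I_8} => \sum_(I : {set 'I_8} | I \subset K)
     esign R I (K :\: I)%SET *: mul (a I) (b (K :\: I)%SET)].

Definition swedge (R : realType) (V : lmodType R) (a : ext R) (b : ext V) :
  ext V := wedge *:%R a b.

Definition homogeneous (R : realType) (V : lmodType R) (k : nat) (a : ext V) :=
  forall I : {set 'I_8}, #|I| != k -> a I = 0.

Definition form0 (V : nmodType) (v : V) : ext V :=
  [ffun I : {set 'I_8} => if I == finset.set0 then v else 0].

Definition dx (R : realType) (k : nat) : ext R :=
  [ffun I : {set 'I_8} => (I == [set inord k]%SET)%:R].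

Definition dxs (R : realType) (s : seq nat) : ext R :=
  foldr (fun k => wedge (V := R^o) *%R (dx R k)) (form0 1) s.

Definition flat (R : realType) (v : pt R) : ext R := \sum_k v k 0 *: dx R k.

Definition contract (R : realType) (V : lmodType R) (v : pt R) (a : ext V) :
    ext V :=
  [ffun I : {set 'I_8} => \sum_(k | k \notin I)
     (esign R [set k]%SET I * v k 0) *: a (k |: I)%SET].

(* Hodge star of R^8 with the Euclidean metric and the orientation
   dx^{0123} /\ dy^{0123}. *)
Definition star (R : realType) (V : lmodType R) (a : ext V) : ext V :=
  [ffun J : {set 'I_8} => esign R (~: J)%SET J *: a (~: J)%SET].

(* Forms on the tangent space r^perp of S^7 at a unit vector r are identified
   with the forms b on R^8 such that contract r b = 0; restricting a form on
   R^8 to r^perp is then the projection  a |-> r _| (r^flat /\ a). *)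
Definition restrictS (R : realType) (V : lmodType R) (r : pt R) (a : ext V) :
  ext V := contract r (swedge (flat r) a).

(* Hodge star of r^perp, oriented by r _| vol: since vol = r^flat /\ (r _| vol),
   the 7-dimensional star of b is star (r^flat /\ b). *)
Definition starS (R : realType) (V : lmodType R) (r : pt R) (b : ext V) :
  ext V := star (swedge (flat r) b).

Definition omega1 (R : realType) (o : nat) : ext R :=
  dxs R [:: o; o + 1]%N + dxs R [:: o + 2; o + 3]%N.
Definition omega2 (R : realType) (o : nat) : ext R :=
  dxs R [:: o; o + 2]%N - dxs R [:: o + 1; o + 3]%N.
Definition omega3 (R : realType) (o : nat) : ext R :=
  dxs R [:: o; o + 3]%N + dxs R [:: o + 1; o + 2]%N.

Definition Psi0 (R : realType) : ext R :=
  dxs R [:: 0; 1; 2; 3]%N + dxs R [:: 4; 5; 6; 7]%N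
  + wedge (V := R^o) *%R (omega1 R 0) (omega1 R 4)
  + wedge (V := R^o) *%R (omega2 R 0) (omega2 R 4)
  - wedge (V := R^o) *%R (omega3 R 0) (omega3 R 4).

(* (a, b, c, d) is the quaternion a + b i + c j + d k. *)
Notation quat R := (R * R * R * R)%type.

Definition qmul (R : realType) (p q : quat R) : quat R :=
  let: (a, b, c, d) := p in let: (a', b', c', d') := q in
  (a * a' - b * b' - c * c' - d * d',
   a * b' + b * a' + c * d' - d * c',
   a * c' - b * d' + c * a' + d * b',
   a * d' + b * c' - c * b' + d * a').

Definition qconj (R : realType) (p : quat R) : quat R :=
  let: (a, b, c, d) := p in (a, - b, - c, - d).

Definition qreal (R : realType) (a : R) : quat R := (a, 0, 0, 0).

(* The basis of H is (1, -i, -j, -k), whence the signs. *)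
Definition quat_at (R : realType) (o : nat) (v : pt R) : quat R :=
  (v (inord o) 0, - v (inord (o + 1)) 0,
   - v (inord (o + 2)) 0, - v (inord (o + 3)) 0).

Definition quatx (R : realType) (v : pt R) : quat R := quat_at 0 v.
Definition quaty (R : realType) (v : pt R) : quat R := quat_at 4 v.

Definition vec_of_quats (R : realType) (x y : quat R) : pt R :=
  let: (x0, x1, x2, x3) := x in let: (y0, y1, y2, y3) := y in
  \col_k [:: x0; - x1; - x2; - x3; y0; - y1; - y2; - y3]`_k.

Definition matrix_of (R : realType) (f : pt R -> pt R) : 'M[R]_8 :=
  \matrix_(k, l) f (delta_mx l 0) k 0.

(* Left multiplication by the quaternionic matrix ((a, b), (c, d)). *)
Definition lmul2 (R : realType) (a b c d : quat R) : 'M[R]_8 :=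
  matrix_of (fun v => vec_of_quats (qmul a (quatx v) + qmul b (quaty v))
                                   (qmul c (quatx v) + qmul d (quaty v))).

Definition rmul (R : realType) (e : quat R) : 'M[R]_8 :=
  matrix_of (fun v => vec_of_quats (qmul (quatx v) e) (qmul (quaty v) e)).

Definition I1 (R : realType) : 'M[R]_8 := rmul (0, -1, 0, 0).
Definition I2 (R : realType) : 'M[R]_8 := rmul (0, 0, -1, 0).
Definition I3 (R : realType) : 'M[R]_8 := rmul (0, 0, 0, -1).

Definition W (R : realType) : set 'M[R]_8 :=
  [set w | exists (a : R) (z : quat R),
     w = lmul2 (qreal a) (qconj z) z (qreal (- a))].
Arguments W : clear implicits.

Definition W012 (R : realType) : set 'M[R]_8 :=
  [set M | exists w0 w1 w2, [/\ W R w0, W R w1, W R w2 &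
     M = w0 + w1 *m I1 R + w2 *m I2 R]].
Arguments W012 : clear implicits.

Definition lieSp2 (R : realType) : set 'M[R]_8 :=
  [set B | [/\ B^T = - B, B *m I1 R = I1 R *m B,
               B *m I2 R = I2 R *m B & B *m I3 R = I3 R *m B]].
Arguments lieSp2 : clear implicits.

Definition pd (R : realType) (V : normedModType R) (k : 'I_8) (f : pt R -> V) :
  pt R -> V := 'D_(delta_mx k 0) f.

Fixpoint iter_pd (R : realType) (V : normedModType R) (s : seq 'I_8)
    (f : pt R -> V) : pt R -> V :=
  if s is k :: s' then pd k (iter_pd s' f) else f.

(* C^oo, for open U. *)
Definition smooth_on (R : realType) (V : normedModType R) (U : set (pt R))
    (f : pt R -> V) :=
  forall (s : seq 'I_8) (x : pt R), U x ->
    {for x, continuous (iter_pd s f)} /\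
    forall k : 'I_8, derivable (iter_pd s f) x (delta_mx k 0).

Definition smooth_form (R : realType) (V : normedModType R) (U : set (pt R))
    (a : pt R -> ext V) :=
  forall I : {set 'I_8}, smooth_on U (fun x => a x I).

Definition extd (R : realType) (V : normedModType R) (a : pt R -> ext V)
    (x : pt R) : ext V :=
  [ffun K : {set 'I_8} => \sum_(k in K)
     esign R [set k]%SET (K :\ k)%SET *: pd k (fun y => a y (K :\ k)%SET) x].

(* The norm `|x| of MathComp-Analysis on matrices is the sup norm. *)
Definition enorm (R : realType) (x : pt R) : R :=
  Num.sqrt (\sum_k x k 0 ^+ 2).

Definition S7 (R : realType) : set (pt R) := [set r | enorm r = 1].
Arguments S7 : clear implicits.

Definition radial (R : realType) (x : pt R) : pt R := (enorm x)^-1 *: x.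

(* Pullback to R^8 \ {0}, under the radial projection, of the restriction of b
   to S^7: the differential of the projection at x sends v to the part of v
   orthogonal to x, divided by the Euclidean norm of x. *)
Definition radial_pullback (R : realType) (V : lmodType R) (b : pt R -> ext V)
    (x : pt R) : ext V :=
  [ffun I : {set 'I_8} =>
     (enorm x)^-1 ^+ #|I| *: restrictS (radial x) (b (radial x)) I].

(* A Lie group, as a closed subgroup of GL_m(R), with its Lie algebra: the
   generators of its one-parameter subgroups. *)
Record lie_group (R : realType) (m : nat) := LieGroup {
  grp : set 'M[R]_m;
  lie : {vspace 'M[R]_m};
  grp_unit : forall g, grp g -> g \in unitmx;
  grp1 : grp 1%:M;
  grpM : forall g h, grp g -> grp h -> grp (g *m h);
  grpV : forall g, grp g -> grp (invmx g);
  grp_closed : forall g, closure grp g -> g \in unitmx -> grp g;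
  lieP : forall X, X \in lie <->
    exists gamma : R -> 'M[R]_m,
      [/\ gamma 0 = 1%:M,
          forall t : R, is_derive t (1 : R) gamma (gamma t *m X) &
          forall t, grp (gamma t)]
}.

(* The potential a in the gauge transformed by g: g^-1 a g + g^-1 dg. *)
Definition gauge (R : realType) (m : nat) (g : pt R -> 'M[R]_m)
    (a : pt R -> ext 'M[R]_m) (x : pt R) : ext 'M[R]_m :=
  [ffun K : {set 'I_8} => invmx (g x) *m a x K *m g x
     + invmx (g x) *m extd (fun y => form0 (g y)) x K].

(* A connection on a bundle E with structure group G over R^8 \ {0}: an open
   cover trivializing E, transition functions (a section s of E satisfies
   s_i = trans i j s_j) and local connection 1-forms (D_A = d + pot i). *)
Record connection (R : realType) (m : nat) (G : lie_group R m) := Connection {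
  idx : Type;
  chart : idx -> set (pt R);
  trans : idx -> idx -> pt R -> 'M[R]_m;
  pot : idx -> pt R -> ext 'M[R]_m;
  chart_open : forall i, open (chart i);
  chart_cover : forall x, (exists i, chart i x) <-> x != 0;
  trans_grp : forall i j x, chart i x -> chart j x -> grp G (trans i j x);
  trans_smooth : forall i j, smooth_on (chart i `&` chart j) (trans i j);
  trans_cocycle : forall i j k x, chart i x -> chart j x -> chart k x ->
    trans i j x *m trans j k x = trans i k x;
  pot_1form : forall i x, chart i x -> homogeneous 1 (pot i x);
  pot_lie : forall i x I, chart i x -> pot i x I \in lie G;
  pot_smooth : forall i, smooth_form (chart i) (pot i);
  pot_trans : forall i j x, chart i x -> chart j x ->
    pot j x = gauge (trans i j) (pot i) x
}.

(* Isomorphism of bundles with connection; h i b is the isomorphism read in the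
   trivializations i of A and b of B. *)
Definition isomorphic (R : realType) (m : nat) (G : lie_group R m)
    (A B : connection G) :=
  exists h : idx A -> idx B -> pt R -> 'M[R]_m,
    [/\ forall i b x, chart i x -> chart b x -> grp G (h i b x),
        forall i b, smooth_on (chart i `&` chart b) (h i b),
        forall i j b x, chart i x -> chart j x -> chart b x ->
          trans i j x *m h j b x = h i b x,
        forall i b c x, chart i x -> chart b x -> chart c x ->
          h i b x *m trans b c x = h i c x &
        forall i b x, chart i x -> chart b x ->
          pot b x = gauge (h i b) (pot i) x].

(* All the data are pulled back, under the radial projection, from their
   restrictions to S^7. *)
Definition radially_pulled_back (R : realType) (m : nat) (G : lie_group R m)
    (A : connection G) :=
  [/\ forall (i : idx A) x, x != 0 -> (chart i x <-> chart i (radial x)),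
      forall (i j : idx A) x, chart i x -> chart j x ->
        trans i j x = trans i j (radial x) &
      forall (i : idx A) x, chart i x ->
        pot i x = radial_pullback (pot i) x].

Definition conical (R : realType) (m : nat) (G : lie_group R m)
    (A : connection G) :=
  exists B : connection G, isomorphic A B /\ radially_pulled_back B.

Definition curvature (R : realType) (m : nat) (G : lie_group R m)
    (A : connection G) (i : idx A) (x : pt R) : ext 'M[R]_m :=
  extd (pot i) x + wedge mulmx (pot i x) (pot i x).

Definition instanton (R : realType) (m : nat) (G : lie_group R m)
    (A : connection G) :=
  forall (i : idx A) x, chart i x ->
    curvature i x + star (swedge (Psi0 R) (curvature i x)) = 0.

Definition eval2 (R : realType) (V : lmodType R) (F : ext V) (u v : pt R) : V :=
  contract v (contract u F) finset.set0.

(* F_A takes values in S (x) g_E; a 2-form F is identified with the skew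
   matrix of the F(e_k, e_l). *)
Definition curvature_in (R : realType) (m : nat) (G : lie_group R m)
    (A : connection G) (S : set 'M[R]_8) :=
  forall (i : idx A) x, chart i x ->
    exists (n : nat) (B : 'I_n -> 'M[R]_8) (X : 'I_n -> 'M[R]_m),
      [/\ forall p, S (B p), forall p, X p \in lie G &
          forall k l, eval2 (curvature i x) (delta_mx k 0) (delta_mx l 0)
                      = \sum_p B p k l *: X p].

Definition curvature_spans_lieSp2 (R : realType) (m : nat) (G : lie_group R m)
    (A : connection G) :=
  forall S : {vspace 'M[R]_8},
    [set` S] `<=` lieSp2 R -> curvature_in A [set` S] -> [set` S] = lieSp2 R.

(* A section over S^7 is given by its local expressions, extended by 0 off
   chart i `&` S7, so that equality of sections is equality of families. *)
Definition sform (R : realType) (m : nat) (G : lie_group R m)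
  (A : connection G) := idx A -> pt R -> ext 'M[R]_m.

Definition chartS (R : realType) (m : nat) (G : lie_group R m)
    (A : connection G) (i : idx A) : set (pt R) := chart i `&` S7 R.

Definition Omega (R : realType) (m : nat) (G : lie_group R m)
    (A : connection G) (k : nat) : set (sform A) :=
  [set b |
    [/\ forall i r, ~ chartS i r -> b i r = 0,
        forall i r, chartS i r ->
          [/\ homogeneous k (b i r), contract r (b i r) = 0 &
              forall I, b i r I \in lie G],
        forall i j r, chartS i r -> chartS j r ->
          forall I, b j r I = invmx (trans i j r) *m b i r I *m trans i j r &
        forall i, smooth_form [set x | x != 0 /\ chartS i (radial x)]
                              (radial_pullback (b i))]].
Arguments Omega {R m G} A k b.

Definition bracket (R : realType) (m : nat) (X Y : 'M[R]_m) : 'M[R]_m :=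
  X *m Y - Y *m X.

(* D_A b = d b + [A /\ b]. *)
Definition extD (R : realType) (m : nat) (G : lie_group R m)
    (A : connection G) (i : idx A) (b : pt R -> ext 'M[R]_m) (x : pt R) :
    ext 'M[R]_m :=
  extd b x + wedge (@bracket R m) (pot i x) (b x).

(* D_A on S^7, for b on S^7: b is the restriction to S^7 of radial_pullback b,
   and D_A commutes with restriction. *)
Definition extDS (R : realType) (m : nat) (G : lie_group R m)
    (A : connection G) (i : idx A) (b : pt R -> ext 'M[R]_m) (r : pt R) :
    ext 'M[R]_m :=
  restrictS r (extD i (radial_pullback b) r).

(* D_A^* = - * D_A *, the formal adjoint of D_A on 1-forms in dimension 7. *)
Definition coDS (R : realType) (m : nat) (G : lie_group R m)
    (A : connection G) (i : idx A) (b : pt R -> ext 'M[R]_m) (r : pt R) :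
    ext 'M[R]_m :=
  - starS r (extDS i (fun s => starS s (b s)) r).

Definition psi (R : realType) (r : pt R) : ext R := restrictS r (Psi0 R : ext R^o).

Definition LA (R : realType) (m : nat) (G : lie_group R m)
    (A : connection G) (b : sform A) (i : idx A) (r : pt R) :
    ext 'M[R]_m * ext 'M[R]_m :=
  (coDS i (b i) r, starS r (swedge (psi r) (extDS i (b i) r))).

Definition kerL (R : realType) (m : nat) (G : lie_group R m)
    (A : connection G) : set (sform A) :=
  [set b | Omega A 1 b /\ forall i r, chartS i r -> LA b i r = 0].
Arguments kerL {R m G} A b.

Definition alpha (R : realType) (m : nat) (G : lie_group R m)
    (A : connection G) (M : 'M[R]_8) : sform A :=
  fun i r => if `[< chartS i r >]
             then restrictS r (contract (M *m r) (curvature i r)) else 0.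
Arguments alpha {R m G} A M i r.

Definition VA (R : realType) (m : nat) (G : lie_group R m)
    (A : connection G) : set (sform A) :=
  [set alpha A M | M in W012 R].
Arguments VA {R m G} A b.

Definition has_dim (R : realType) (V : lmodType R) (S : set V) (n : nat) :=
  exists b : 'I_n -> V,
    (forall c : 'I_n -> R, \sum_k c k *: b k = 0 -> forall k, c k = 0) /\
    S = [set v | exists c : 'I_n -> R, v = \sum_k c k *: b k].

(* Main.v *)
Require Import Defs.
From HB Require Import structures.
From mathcomp Require Import all_boot all_order all_algebra.
From mathcomp Require Import all_classical all_reals all_analysis.
From mathcomp Require Import ring lra zify.
Import numFieldNormedType.Exports.
Import Order.TTheory GRing.Theory Num.Theory.

(** Why the theorem holds.

    Write F for the curvature and N_k for its covariant derivatives on R^8, and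
    put alpha = F(M x, -). For each matrix entry, F and all N_k are endomorphisms of
    R^8 in Lie(Sp(2)), and N satisfies the Bianchi identity. Since the connection is
    conical, x _| F = 0 ([conical_curv_comp_radial]): in a gauge pulled back from
    the sphere this is Euler's identity. Hence x _| alpha = 0, and alpha is its own
    restriction to the sphere.

    By the Leibniz rule nabla_k alpha_l is the sum over j of
    M_jk F_jl + (M x)_j N_k,jl. Three pointwise facts follow by linear algebra
    ([contraction_field_algebra]). First, the Bianchi identity gives, as matrices,
    D_A alpha = M^T F + F M + (sum over j of (M x)_j N_j). The N_j lie in
    Lie(Sp(2)), which is contained in Lambda^2_21 = Lie(Spin(7)). For
    M = w0 + w1 I_1 + w2 I_2 the remaining part is
    (w0 F + F w0) + [F, w1] I_1 + [F, w2] I_2, with first term in Lie(Sp(2)) and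
    commutators in W, and W I_1 and W I_2 lie in Lambda^2_21
    ([lambda21_W012]). So D_A alpha is in Lambda^2_21. Secondly,
    x _| D_A alpha = 0. Thirdly alpha is divergence free: the trace of M^T F
    vanishes, and the divergence of F vanishes because contracting the Bianchi
    identity with I_1 leaves only this divergence ([yang_mills]). As
    *(Psi0 /\ b) = - b on Lambda^2_21 ([psi_wedge]), the first two facts give
    psi /\ D_A alpha = 0 on the sphere, and the third gives D_A^* alpha = 0
    ([alpha_LA]). The passage between the sphere and R^8 relies on
    [extDS_radial]: a tangential form on R^8 and the radial pullback of its
    restriction have covariant derivatives that agree on the sphere up to multiples
    of r^flat.

    For the dimension, let alpha_M = 0. If F spans Lie(Sp(2)), it is nonzero at
    some point of the sphere, so on a neighbourhood of it. There F is a nonzero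
    quaternionic-linear map that kills both r and M r, so that M r is in the
    quaternionic line of r ([qlin_kernel]). This is a cubic equation in r on an open
    cone ([tri]), so it holds for every r in R^8, and the only matrix of
    W + W I_1 + W I_2 that preserves all quaternionic lines is 0
    ([tri_eq0_W012]). Hence the fifteen coordinates of M give a basis of the space of
    the forms alpha_M.

    Smoothness is given by iterated partial derivatives, so the symmetry of second
    derivatives ([pdC]), the chain rule for the radial projection ([pd_comp]) and
    the smoothness of radial extensions ([smooth_on_radial_extension]) are derived
    from the mean value theorem. *)

Set Implicit Arguments.
Unset Strict Implicit.
Unset Printing Implicit Defensive.
Local Open Scope ring_scope.

(** * Exterior algebra of R^8 *)

Section Exterior.
Variables (R : realType).
Implicit Types (I J K : {set 'I_8}) (k l : 'I_8).

(** The sign as a product over pairs: multiplicativity in each argument then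
    reduces to splitting products over disjoint unions. *)
Lemma esignE I J : esign R I J =
  \prod_(i in I) \prod_(j in J) (-1) ^+ (j < i)%N.
Proof.
rewrite pair_big_dep /= prodrXr /esign -sum1_card; congr (_ ^+ _).
rewrite [LHS]big_mkcond [RHS]big_mkcond; apply: eq_bigr => p _.
by rewrite inE; case: (p.1 \in I); case: (p.2 \in J); case: (_ < _)%N.
Qed.

Lemma esign0r I : esign R I finset.set0 = 1.
Proof. by rewrite esignE big1 // => i _; rewrite big_set0. Qed.

Lemma esignUr I J K : [disjoint J & K] ->
  esign R I (J :|: K)%SET = esign R I J * esign R I K.
Proof.
move=> dJK; rewrite !esignE -big_split; apply: eq_bigr => i _ /=.
by rewrite -bigU //; apply: eq_bigl => j; rewrite !inE.
Qed.

Lemma esignUl I J K : [disjoint J & K] ->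
  esign R (J :|: K)%SET I = esign R J I * esign R K I.
Proof.
move=> dJK; rewrite !esignE -bigU //.
by apply: eq_bigl => j; rewrite !inE.
Qed.

Lemma esignM_self I J : esign R I J * esign R I J = 1.
Proof. rewrite /esign -expr2 sqrr_sign //. Qed.

Lemma esign_swap I J : [disjoint I & J] ->
  esign R I J * esign R J I = (-1) ^+ (#|I| * #|J|).
Proof.
move=> dIJ; rewrite !esignE [X in _ * X]exchange_big -big_split /=.
rewrite mulnC exprM -prodr_const; apply: eq_bigr => i iI.
rewrite -big_split -prodr_const /=; apply: eq_bigr => j jJ.
have /negP : i != j.
  by apply: contraTN dIJ => /eqP ij; apply/pred0Pn; exists i; rewrite /= iI ij.
case: (ltngtP i j) => [|| /val_inj ->]; rewrite ?mulr1 ?mul1r ?expr1 //.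
Qed.

Lemma esign1D k K : esign R [set k]%SET (K :\ k)%SET = esign R [set k]%SET K.
Proof.
rewrite !esignE !big_set1; have [kK|kK] := boolP (k \in K).
  by rewrite [RHS](big_setD1 k) //= ltnn mul1r.
suff -> : (K :\ k)%SET = K by [].
by apply/setP => i; rewrite !inE; case: eqP => // ->; rewrite (negbTE kK).
Qed.

Lemma esign11 k l : k != l ->
  esign R [set k]%SET [set l]%SET * esign R [set l]%SET [set k]%SET = -1.
Proof.
by move=> kl; rewrite esign_swap ?cards1 ?expr1 // disjoints1 inE.
Qed.

Lemma esign11N k l : k != l ->
  esign R [set k]%SET [set l]%SET = - esign R [set l]%SET [set k]%SET.
Proof.
move=> kl; rewrite -[LHS]mulr1 -(esignM_self [set l]%SET [set k]%SET) mulrA.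
by rewrite esign11 // mulN1r.
Qed.

Lemma esign1_add k l K : l \notin K ->
  esign R [set k]%SET (l |: K)%SET =
  esign R [set k]%SET [set l]%SET * esign R [set k]%SET K.
Proof. by move=> lK; rewrite esignUr // disjoints1. Qed.

Lemma esign1_rem k l K : l \in K ->
  esign R [set k]%SET K =
  esign R [set k]%SET [set l]%SET * esign R [set k]%SET (K :\ l)%SET.
Proof.
by move=> lK; rewrite -[in LHS](finset.setD1K lK) esign1_add // !inE eqxx.
Qed.
End Exterior.

Section ExteriorOps.
Variables (R : realType) (V : lmodType R).
Implicit Types (I J K : {set 'I_8}) (k l : 'I_8) (a b : ext V) (v w : pt R).

(** Exterior multiplication dx^k /\ a. Every operator on forms below is a
    combination of dxw k and ctr k, so that identities between operators follow
    from the Clifford relation and the behaviour under the Hodge star. *)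
Definition dxw k a : ext V :=
  [ffun K : {set 'I_8} => if k \in K then esign R [set k]%SET K *: a (K :\ k)%SET else 0].

(** Interior multiplication e_k _| a. *)
Definition ctr k a : ext V :=
  [ffun K : {set 'I_8} => if k \notin K then esign R [set k]%SET K *: a (k |: K)%SET else 0].

Lemma dxw_is_linear k : linear (dxw k).
Proof.
move=> c a b; apply/ffunP => K; rewrite !ffunE /=.
case: ifP => _; rewrite ?scaler0 ?addr0 // scalerDr !scalerA.
by rewrite [_ * c]mulrC.
Qed.
HB.instance Definition _ k :=
  GRing.isLinear.Build R (ext V) (ext V) *:%R (dxw k) (dxw_is_linear k).

Lemma ctr_is_linear k : linear (ctr k).
Proof.
move=> c a b; apply/ffunP => K; rewrite !ffunE /=.
case: ifP => _; rewrite ?scaler0 ?addr0 // scalerDr !scalerA.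
by rewrite [_ * c]mulrC.
Qed.
HB.instance Definition _ k :=
  GRing.isLinear.Build R (ext V) (ext V) *:%R (ctr k) (ctr_is_linear k).

Lemma star_is_linear : linear (@star R V).
Proof.
move=> c a b; apply/ffunP => K; rewrite !ffunE /=.
by rewrite scalerDr !scalerA [_ * c]mulrC.
Qed.
HB.instance Definition _ :=
  GRing.isLinear.Build R (ext V) (ext V) *:%R (@star R V) star_is_linear.

Lemma swedge_flat v a : swedge (flat v) a = \sum_k v k 0 *: dxw k a.
Proof.
apply/ffunP => K; rewrite ffunE sum_ffunE /=.
transitivity (\sum_(I : {set 'I_8} | I \subset K) \sum_k
  (v k 0 * (I == [set k]%SET)%:R * esign R I (K :\: I)%SET) *:
     a (K :\: I)%SET).
  apply: eq_bigr => I _; rewrite sum_ffunE scaler_suml scaler_sumr.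
  apply: eq_bigr => k _; rewrite !ffunE inord_val scalerA.
  by rewrite mulrC.
rewrite exchange_big; apply: eq_bigr => k _ /=; rewrite !ffunE.
case: ifP => kK.
  rewrite (bigD1 [set k]%SET) ?finset.sub1set //= big1 ?addr0; last first.
    by move=> I /andP[_ /negPf ->]; rewrite mulr0 mul0r scale0r.
  by rewrite eqxx mulr1 scalerA esign1D.
rewrite scaler0 big1 // => I IK.
suff /negPf -> : I != [set k]%SET by rewrite mulr0 mul0r scale0r.
by apply: contraFN kK => /eqP Ik; move: IK; rewrite Ik finset.sub1set.
Qed.

Lemma contractE v a : Defs.contract v a = \sum_k v k 0 *: ctr k a.
Proof.
apply/ffunP => K; rewrite ffunE sum_ffunE [LHS]big_mkcond.
apply: eq_bigr => k _; rewrite !ffunE /=.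
by case: ifP; rewrite ?scaler0 // scalerA mulrC.
Qed.

Lemma swedge_flat_is_linear v : linear (@swedge R V (flat v)).
Proof.
move=> c a b; rewrite !swedge_flat scaler_sumr -big_split.
by apply: eq_bigr => k _; rewrite linearP /= scalerDr !scalerA mulrC.
Qed.
HB.instance Definition _ v := GRing.isLinear.Build R (ext V) (ext V) *:%R
  (@swedge R V (flat v)) (swedge_flat_is_linear v).

Lemma contract_is_linear v : linear (@Defs.contract R V v).
Proof.
move=> c a b; rewrite !contractE scaler_sumr -big_split.
by apply: eq_bigr => k _; rewrite linearP /= scalerDr !scalerA mulrC.
Qed.
HB.instance Definition _ v := GRing.isLinear.Build R (ext V) (ext V) *:%R
  (@Defs.contract R V v) (contract_is_linear v).

Lemma swedge_is_additive a :
  forall (b : ext R) (c : ext R) (s : R),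
  swedge (s *: b + c) a = s *: swedge b a + swedge c a.
Proof.
move=> b c s; apply/ffunP => K; rewrite !ffunE /= scaler_sumr -big_split.
apply: eq_bigr => I _ /=.
have -> : (s *: b + c) I = s * b I + c I by rewrite !ffunE.
rewrite scalerDl scalerDr !scalerA; congr (_ *: _ + _).
by rewrite mulrCA mulrA.
Qed.

Lemma dxw_anti k l a : dxw k (dxw l a) = - dxw l (dxw k a).
Proof.
apply/ffunP => K; rewrite !ffunE !inE.
have [->|kl] := eqVneq k l.
  by case: ifP; rewrite ?oppr0 //= scaler0 oppr0.
rewrite /=; case: ifP => kK; case: ifP => lK;
  rewrite ?scaler0 ?oppr0 //.
rewrite !scalerA -scaleNr finset.setDDl finset.setUC -finset.setDDl.
congr (_ *: _); rewrite (esign1_rem R k lK) (esign1_rem R l kK).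
by rewrite (esign11N R kl) !mulNr mulrAC.
Qed.

Lemma clifford k l a :
  ctr k (dxw l a) + dxw l (ctr k a) = (k == l)%:R *: a.
Proof.
apply/ffunP => K; rewrite !ffunE !inE.
have [<-|kl] := eqVneq k l.
  rewrite scale1r /=; case: (boolP (k \in K)) => kK /=.
    by rewrite add0r scalerA esign1D esignM_self scale1r finset.setD1K.
  rewrite addr0 scalerA -[esign R _ (k |: K)%SET]esign1D finset.setU1K //.
  by rewrite esignM_self scale1r.
rewrite scale0r /=.
case: (boolP (k \in K)) => kK /=; case: (boolP (l \in K)) => lK /=;
  rewrite ?scaler0 ?addr0 ?add0r //.
rewrite !scalerA (_ : k |: (K :\ l) = (k |: K) :\ l)%SET; last first.
  by apply/setP => i; rewrite !inE; have [->|//] := eqVneq i k; rewrite kl.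
rewrite -scalerDl (esign1_rem R k lK) (esign1_add R l kK) (esign11N R kl).
have := esignM_self R [set l]%SET [set k]%SET.
set x := esign R _ (K :\ l)%SET; set y := esign R _ K; set z := esign R _ _.
move=> zz; rewrite (_ : _ + _ = (1 - z * z) * (x * y)); last by ring.
by rewrite zz subrr mul0r scale0r.
Qed.

End ExteriorOps.

Section Star.
Variables (R : realType) (V : lmodType R).
Implicit Types (I J K : {set 'I_8}) (k l : 'I_8) (a b : ext V) (v w : pt R).

(** The Hodge star exchanges dxw k and ctr k, up to a sign that depends on the
    degree of the component. *)
Lemma dxw_star k a K :
  dxw k (star a) K = (-1) ^+ #|(~: K)%SET| *: star (ctr k a) K.
Proof.
rewrite !ffunE inE negbK; case: ifP => kK; last by rewrite !scaler0.
rewrite !scalerA finset.setCD finset.setUC; congr (_ *: _).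
rewrite esignUl ?disjoints1 ?inE ?kK // esign1D.
rewrite -[in RHS](finset.setD1K kK) esignUr ?disjoints1 ?inE ?eqxx //.
rewrite finset.setD1K //.
have := @esign_swap R [set k]%SET (~: K)%SET.
rewrite cards1 mul1n disjoints1 inE negbK => /(_ kK).
have := esignM_self R [set k]%SET (~: K)%SET.
have := esignM_self R [set k]%SET K.
have := esignM_self R (~: K)%SET [set k]%SET.
move=> + + + <-.
set x := esign _ (~: K)%SET [set k]%SET; set y := esign _ _ K.
set z := esign _ _ (~: K)%SET; set t := esign _ _ _ => xx yy zz.
transitivity ((y * y) * t); first by ring.
rewrite yy mul1r.
transitivity ((x * x) * (z * z) * t); last by ring.
by rewrite xx zz !mul1r.
Qed.

Lemma ctr_star k a K :
  ctr k (star a) K = (-1) ^+ (#|(~: K)%SET|.-1) *: star (dxw k a) K.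
Proof.
rewrite !ffunE inE; case: ifP => kK; last by rewrite !scaler0.
rewrite !scalerA finset.setCU finset.setIC -finset.setDE.
congr (_ *: _).
have kC : k \in (~: K)%SET by rewrite inE.
rewrite esignUr ?disjoints1 //.
have -> : esign R (~: K)%SET K =
    esign R [set k]%SET K * esign R (~: K :\ k)%SET K.
  by rewrite -[in LHS](finset.setD1K kC) esignUl ?disjoints1 ?inE ?eqxx.
rewrite -[esign R _ (~: K)%SET]esign1D.
have := @esign_swap R [set k]%SET (~: K :\ k)%SET.
rewrite cards1 mul1n disjoints1 !inE eqxx /= => /(_ isT).
have -> : #|(~: K :\ k)%SET| = #|(~: K)%SET|.-1 by rewrite [in RHS](cardsD1 k) kC.
have := esignM_self R [set k]%SET (~: K :\ k)%SET.
move=> + <-.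
set x := esign _ _ K; set y := esign _ _ K.
set z := esign _ _ _; set t := esign _ _ _ => zz.
transitivity (z * z * (x * (t * y))); last by ring.
by rewrite zz mul1r.
Qed.

Lemma homogeneousD n a b :
  homogeneous n a -> homogeneous n b -> homogeneous n (a + b).
Proof. by move=> ha hb K Kn; rewrite ffunE ha ?hb ?addr0. Qed.

Lemma homogeneousZ n (c : R) a : homogeneous n a -> homogeneous n (c *: a).
Proof. by move=> ha K Kn; rewrite ffunE ha ?scaler0. Qed.

Lemma homogeneous_sum n (T : finType) (f : T -> ext V) :
  (forall t, homogeneous n (f t)) -> homogeneous n (\sum_t f t).
Proof. by move=> hf K Kn; rewrite sum_ffunE big1 // => t _; rewrite hf. Qed.

Lemma homogeneous_dxw n k a : homogeneous n a -> homogeneous n.+1 (dxw k a).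
Proof.
move=> ha K Kn; rewrite ffunE; case: ifP => // kK.
by rewrite ha ?scaler0 //; move: Kn; rewrite (cardsD1 k) kK eqSS.
Qed.

Lemma homogeneous_ctr n k a : homogeneous n.+1 a -> homogeneous n (ctr k a).
Proof.
move=> ha K Kn; rewrite ffunE; case: ifP => // kK.
by rewrite ha ?scaler0 // cardsU1 kK eqSS.
Qed.

Lemma homogeneous_flat_wedge n v a :
  homogeneous n a -> homogeneous n.+1 (swedge (flat v) a).
Proof.
move=> ha; rewrite swedge_flat; apply: homogeneous_sum => k.
exact/homogeneousZ/homogeneous_dxw.
Qed.

Lemma homogeneous_contract n v a :
  homogeneous n.+1 a -> homogeneous n (Defs.contract v a).
Proof.
move=> ha; rewrite contractE; apply: homogeneous_sum => k.
exact/homogeneousZ/homogeneous_ctr.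
Qed.

Lemma cardsC8 K : #|(~: K)%SET| = (8 - #|K|)%N.
Proof. by rewrite cardsCs finset.setCK card_ord. Qed.

Lemma cards_le8 K : (#|K| <= 8)%N.
Proof. by rewrite -[X in (_ <= X)%N](card_ord 8) max_card. Qed.

Lemma dxw_star_homogeneous n k a : (n < 8)%N -> homogeneous n.+1 a ->
  dxw k (star a) = (-1) ^+ n *: star (ctr k a).
Proof.
move=> n8 ha; apply/ffunP => K; rewrite dxw_star [RHS]ffunE.
have [Kn|Kn] := eqVneq #|(~: K)%SET| n; first by rewrite Kn.
have -> : star (ctr k a) K = 0; last by rewrite !scaler0.
by rewrite ffunE (homogeneous_ctr k ha) ?scaler0.
Qed.

Lemma flat_wedge_star n v a : (n < 8)%N -> homogeneous n.+1 a ->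
  swedge (flat v) (star a) = (-1) ^+ n *: star (Defs.contract v a).
Proof.
move=> n8 ha; rewrite swedge_flat contractE linear_sum scaler_sumr.
apply: eq_bigr => k _ /=; rewrite (dxw_star_homogeneous k n8 ha) [star (_ *: _)]linearZ /=.
by rewrite !scalerA mulrC.
Qed.

Lemma contract_star n v a : (n < 8)%N -> homogeneous n a ->
  Defs.contract v (star a) = (-1) ^+ n *: star (swedge (flat v) a).
Proof.
move=> n8 ha; rewrite swedge_flat contractE linear_sum scaler_sumr.
apply: eq_bigr => k _ /=; rewrite [star (_ *: _)]linearZ /= scalerA mulrC -scalerA.
congr (_ *: _).
apply/ffunP => K; rewrite ctr_star [RHS]ffunE.
have [Kn|Kn] := eqVneq #|(~: K)%SET| n.+1; first by rewrite Kn.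
have -> : star (dxw k a) K = 0; last by rewrite !scaler0.
by rewrite ffunE (homogeneous_dxw k ha) ?scaler0.
Qed.

Lemma flat_wedgeK v a : swedge (flat v) (swedge (flat v) a) = 0.
Proof.
have E : swedge (flat v) (swedge (flat v) a) =
    \sum_k \sum_l (v k 0 * v l 0) *: dxw k (dxw l a).
  rewrite swedge_flat; apply: eq_bigr => k _.
  rewrite swedge_flat linear_sum scaler_sumr; apply: eq_bigr => l _.
  by rewrite linearZ /= scalerA.
have : swedge (flat v) (swedge (flat v) a) = - swedge (flat v) (swedge (flat v) a).
  rewrite {1}E exchange_big E -sumrN; apply: eq_bigr => k _ /=.
  rewrite -sumrN; apply: eq_bigr => l _.
  by rewrite dxw_anti scalerN mulrC.
set x := swedge _ _ => /eqP; rewrite -addr_eq0 -mulr2n -scaler_nat.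
by rewrite scaler_eq0 pnatr_eq0 => /eqP.
Qed.

Lemma contract_flat_wedge v w a :
  Defs.contract v (swedge (flat w) a) + swedge (flat w) (Defs.contract v a) =
  (\sum_k v k 0 * w k 0) *: a.
Proof.
rewrite !contractE !swedge_flat.
transitivity (\sum_k \sum_l (v k 0 * w l 0) *: ((k == l)%:R *: a)).
  rewrite [X in _ + X](eq_bigr (fun l => \sum_k (v k 0 * w l 0) *: dxw l (ctr k a))).
    rewrite [X in _ + X]exchange_big -big_split; apply: eq_bigr => k _ /=.
    rewrite linear_sum scaler_sumr -big_split; apply: eq_bigr => l _ /=.
    by rewrite linearZ /= scalerA -scalerDr clifford.
  move=> l _; rewrite linear_sum scaler_sumr; apply: eq_bigr => k _ /=.
  by rewrite linearZ /= scalerA mulrC.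
rewrite scaler_suml; apply: eq_bigr => k _; rewrite (bigD1 k) //= eqxx scale1r.
by rewrite big1 ?addr0 // => l /negPf lk; rewrite eq_sym lk scale0r scaler0.
Qed.

Lemma flat_wedge_restrictS v a : \sum_k v k 0 * v k 0 = 1 ->
  swedge (flat v) (restrictS v a) = swedge (flat v) a.
Proof.
move=> v1; have := contract_flat_wedge v v (swedge (flat v) a).
by rewrite v1 scale1r flat_wedgeK linear0 add0r.
Qed.

(** For a unit vector, a form annihilated by contraction with it is already a form
    on the orthogonal complement. *)
Lemma restrictS_id v a : \sum_k v k 0 * v k 0 = 1 -> Defs.contract v a = 0 ->
  restrictS v a = a.
Proof.
move=> v1 va; have := contract_flat_wedge v v a.
by rewrite v1 scale1r va linear0 addr0.
Qed.

End Star.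

Section Assoc.
Variables (R : realType) (V : lmodType R).
Implicit Types (I J K : {set 'I_8}) (k l : 'I_8) (b : ext V) (v w : pt R).

(** Associativity of the product with a 1-form follows from this case by linearity. *)
Lemma dxw_swedge k (a : ext R^o) b :
  swedge (dxw k a : ext R) b = dxw k (swedge (a : ext R) b).
Proof.
apply/ffunP => K; rewrite !ffunE.
under eq_bigr do rewrite ffunE.
case: (boolP (k \in K)) => kK; last first.
  rewrite big1 // => I IK; case: ifP => [kI|_]; last by rewrite scale0r scaler0.
  by move/fintype.subsetP : IK => /(_ _ kI); rewrite (negPf kK).
rewrite scaler_sumr (bigID (fun I : {set 'I_8} => k \in I)) /= [X in _ + X]big1 ?addr0; last first.
  by move=> I /andP[_ /negPf ->]; rewrite scale0r scaler0.
rewrite [RHS](reindex_onto (fun I : {set 'I_8} => I :\ k)%SET (fun I => k |: I)%SET) /=; last first.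
  move=> I IK; rewrite finset.setU1K //.
  by apply: contraTN IK => kI; apply/negP => /fintype.subsetP /(_ _ kI); rewrite !inE eqxx.
apply: eq_big => I.
  apply/idP/idP.
    move=> /andP[IK kI]; rewrite finset.setD1K // eqxx andbT.
    exact: finset.setSD.
  move=> /andP[IK /eqP kI]; rewrite -kI !inE eqxx andbT.
  by rewrite -(finset.setD1K kK) finset.setUS.
move=> /andP[IK kI]; rewrite kI finset.setDDl finset.setD1K //.
rewrite -scalerA !scalerA; congr (_ *: _).
rewrite [in LHS](_ : esign R I (K :\: I) = esign R (k |: (I :\ k))%SET (K :\: I)); last first.
  by rewrite finset.setD1K.
rewrite esignUl ?disjoints1 ?inE ?eqxx //.
have -> : esign R [set k]%SET K = esign R [set k]%SET I * esign R [set k]%SET (K :\: I)%SET.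
  rewrite -esignUr; last by rewrite finset.disjoints_subset; apply/fintype.subsetP => i; rewrite !inE => ->.
  by congr esign; apply/setP => i; rewrite !inE; case: (boolP (i \in I)) => // /(fintype.subsetP IK) ->.
rewrite /GRing.scale /=; ring.
Qed.

Lemma flat_wedge_assoc v (a : ext R^o) b :
  swedge (swedge (flat v) a : ext R) b = swedge (flat v) (swedge (a : ext R) b).
Proof.
rewrite !swedge_flat; elim/big_rec2: _ => [|k c d _ <-].
  apply/ffunP => K; rewrite !ffunE big1 // => I _.
  by rewrite ffunE scale0r scaler0.
by rewrite swedge_is_additive dxw_swedge.
Qed.

Lemma homogeneous_swedge n p (a : ext R^o) b :
  homogeneous n a -> homogeneous p b -> homogeneous (n + p) (swedge (a : ext R) b).
Proof.
move=> ha hb K Kn; rewrite ffunE big1 // => I IK.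
have [In|In] := eqVneq #|I| n; last by rewrite ha // scale0r scaler0.
rewrite hb ?scaler0 //; apply: contra Kn => /eqP <-.
by rewrite -In -[X in X == _](cardsID I) (finset.setIidPr IK).
Qed.
End Assoc.

(** * The four-form and the 2-forms of type 21 *)

Section Psi.
Variables (R : realType).
Implicit Types (s t : seq nat) (K : {set 'I_8}).

(** Index sets given by explicit lists of numbers: signs and set operations then
    become computations on lists, and coefficients of products with Psi0 are
    obtained by evaluation. *)
Definition setof s : {set 'I_8} := [set i : 'I_8 | val i \in s]%SET.

Definition inversions s t : nat :=
  sumn [seq sumn [seq nat_of_bool (j < i)%N | j <- iota 0 8 & j \in t]
       | i <- iota 0 8 & i \in s].

Lemma esign_setof s t :
  esign R (setof s) (setof t) = (-1) ^+ inversions s t.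
Proof.
rewrite esignE /inversions sumnE big_map big_filter.
have red (F : nat -> nat) u :
    \prod_(i in setof u) (-1) ^+ F i = (-1) ^+ (\sum_(i <- iota 0 8 | i \in u) F i) :> R.
  rewrite prodrXr -[iota 0 8]/(index_iota 0 8) big_mkord; congr (_ ^+ _).
  by apply: eq_bigl => i; rewrite inE.
rewrite -red; apply: eq_bigr => i _.
by rewrite (red (fun j => nat_of_bool (j < i)%N) t) sumnE big_map big_filter.
Qed.

Definition mono s : ext R^o := [ffun I : {set 'I_8} => (I == setof s)%:R].

Definition rest s t : seq nat := [seq i <- t | i \notin s].

Lemma setof_rest s t : (setof t :\: setof s)%SET = setof (rest s t).
Proof. by apply/setP => i; rewrite !inE mem_filter. Qed.

Lemma setof_subset s t : all (gtn 8) s ->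
  (setof s \subset setof t) = all (mem t) s.
Proof.
move=> /allP s8; apply/fintype.subsetP/allP => [st i si|st i].
  by have := st (Ordinal (s8 _ si)); rewrite !inE; apply.
by rewrite !inE; apply: st.
Qed.

Lemma swedge_mono (V : lmodType R) s (b : ext V) K :
  swedge (mono s : ext R) b K =
  if setof s \subset K
  then esign R (setof s) (K :\: setof s)%SET *: b (K :\: setof s)%SET else 0.
Proof.
rewrite ffunE; case: ifPn => sK.
  rewrite (bigD1 (setof s)) //= ffunE eqxx scale1r big1 ?addr0 // => I.
  by move=> /andP[_ /negPf Is]; rewrite ffunE Is scale0r scaler0.
rewrite big1 // => I IK; rewrite ffunE; case: eqP => [Is|_]; last first.
  by rewrite scale0r scaler0.
by rewrite Is (negPf sK) in IK.
Qed.

Lemma swedge_mono_setof (V : lmodType R) s t (b : ext V) :  all (gtn 8) s ->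
  swedge (mono s : ext R) b (setof t) =
  if all (mem t) s
  then (-1) ^+ inversions s (rest s t) *: b (setof (rest s t)) else 0.
Proof.
by move=> s8; rewrite swedge_mono setof_subset // setof_rest esign_setof.
Qed.

Lemma wedge_mono s t : ~~ has (mem t) s ->
  wedge (V := R^o) *%R (mono s) (mono t) =
  (-1) ^+ inversions s t *: mono (s ++ t).
Proof.
move=> st; apply/ffunP => K; rewrite [LHS]swedge_mono !ffunE.
have tE : (setof (s ++ t) :\: setof s)%SET = setof t.
  apply/setP => i; rewrite !inE mem_cat; case: (boolP (val i \in s)) => //= si.
  by symmetry; apply/negP => ti; case/hasP: st; exists (val i).
have [->|Kst] := eqVneq K (setof (s ++ t)).
  rewrite (_ : setof s \subset _) ?tE ?eqxx ?esign_setof //.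
  by apply/fintype.subsetP => i; rewrite !inE mem_cat => ->.
rewrite scaler0; case: ifP => // sK; case: eqP => [E|]; last by rewrite scaler0.
case/eqP: Kst; apply/setP => i; move/setP/(_ i): E; rewrite !inE mem_cat.
case: (boolP (val i \in s)) => //= si _.
by move/fintype.subsetP/(_ i): sK; apply; rewrite inE.
Qed.

Lemma dxs_mono s : all (gtn 8) s -> sorted ltn s -> dxs R s = mono s.
Proof.
elim: s => [|k s IH] /=.
  move=> _ _; apply/ffunP => K; rewrite !ffunE.
  have -> : setof [::] = finset.set0 by apply/setP => i; rewrite !inE.
  by case: eqP.
move=> /andP[k8 s8] ks; have s_gt : all (ltn k) s by apply: order_path_min ks; exact: ltn_trans.
rewrite IH ?(path_sorted ks) //.
have -> : dx R k = mono [:: k].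
  apply/ffunP => K; rewrite !ffunE; congr (_ == _)%:R.
  apply/setP => i; rewrite !inE -val_eqE /= inordK //.
rewrite wedge_mono /=; last first.
  by rewrite orbF; apply/negP => /(allP s_gt); rewrite /= ltnn.
have -> : inversions [:: k] s = 0%N; last by rewrite expr0 scale1r.
rewrite /inversions sumnE big_map big_filter big1_seq // => i /andP[ik _].
rewrite sumnE big_map big_filter big1_seq // => j /andP[js _].
rewrite inE in ik; rewrite (eqP ik).
by have /= := allP s_gt _ js; case: ltngtP.
Qed.

Lemma wedge2_linear (a b c d : ext R^o) (e f : R) :
  wedge (V := R^o) *%R (a + e *: b : ext R) (c + f *: d : ext R) =
  wedge (V := R^o) *%R (a : ext R) (c : ext R)
  + f *: wedge (V := R^o) *%R (a : ext R) (d : ext R)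
  + e *: wedge (V := R^o) *%R (b : ext R) (c : ext R)
  + (e * f) *: wedge (V := R^o) *%R (b : ext R) (d : ext R) :> ext R^o.
Proof.
apply/ffunP => K; rewrite !ffunE !scaler_sumr -!big_split /=.
apply: eq_bigr => I _; rewrite !ffunE /GRing.scale /=; ring.
Qed.

(** The fourteen monomials of Psi0; the boolean marks a minus sign. *)
Definition psi_terms : seq (bool * seq nat) :=
  [:: (false, [:: 0; 1; 2; 3]); (false, [:: 4; 5; 6; 7]);
      (false, [:: 0; 1; 4; 5]); (false, [:: 0; 1; 6; 7]);
      (false, [:: 2; 3; 4; 5]); (false, [:: 2; 3; 6; 7]);
      (false, [:: 0; 2; 4; 6]); (true, [:: 0; 2; 5; 7]);
      (true, [:: 1; 3; 4; 6]); (false, [:: 1; 3; 5; 7]);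
      (true, [:: 0; 3; 4; 7]); (true, [:: 0; 3; 5; 6]);
      (true, [:: 1; 2; 4; 7]); (true, [:: 1; 2; 5; 6])]%N.

Lemma Psi0E : Psi0 R =
  \sum_(t <- psi_terms) (-1) ^+ t.1 *: mono t.2.
Proof.
have o1 n : (n < 5)%N ->
    omega1 R n = mono [:: n; n.+1]%N + 1 *: mono [:: n.+2; n.+3]%N.
  by move=> n5; rewrite /omega1 !dxs_mono ?addnS ?addn0 ?scale1r //=; lia.
have o2 n : (n < 5)%N ->
    omega2 R n = mono [:: n; n.+2]%N + (-1) *: mono [:: n.+1; n.+3]%N.
  by move=> n5; rewrite /omega2 !dxs_mono ?addnS ?addn0 ?scaleN1r //=; lia.
have o3 n : (n < 5)%N ->
    omega3 R n = mono [:: n; n.+3]%N + 1 *: mono [:: n.+1; n.+2]%N.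
  by move=> n5; rewrite /omega3 !dxs_mono ?addnS ?addn0 ?scale1r //=; lia.
rewrite /Psi0 !o1 ?o2 ?o3 // !dxs_mono //.
rewrite !wedge2_linear !wedge_mono //=.
rewrite /inversions /= /psi_terms !big_cons big_nil /=.
rewrite ?expr0 ?expr1 ?scale1r ?scaleN1r ?mulr1 ?mul1r ?mulN1r ?opprK ?scale1r.
apply/ffunP => K; rewrite !ffunE; ring.
Qed.

(** The terms of the coefficient of dx^t in Psi0 /\ b, each as a sign and the
    index of the coefficient of b. *)
Definition psi_coefs t : seq (bool * seq nat) :=
  [seq (u.1 (+) odd (inversions u.2 (rest u.2 t)), rest u.2 t)
    | u <- psi_terms & all (mem t) u.2].

Lemma swedge_Psi0 (b : ext R^o) t : swedge (Psi0 R) b (setof t) =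
  \sum_(u <- psi_coefs t) (if u.1 then - b (setof u.2) else b (setof u.2)).
Proof.
rewrite Psi0E big_map big_filter [RHS]big_mkcond.
have : all (fun u : bool * seq nat => all (gtn 8) u.2) psi_terms by [].
elim: psi_terms => [_|u p IH /= /andP[u8 p8]].
  by rewrite !big_nil ffunE big1 // => I _; rewrite ffunE scale0r scaler0.
rewrite !big_cons swedge_is_additive ffunE IH //; congr (_ + _).
rewrite ffunE swedge_mono_setof //; case: ifP => _; last by rewrite scaler0.
rewrite scalerA -[X in _ * X]signr_odd -signr_addb /=.
by case: (_ (+) _); rewrite ?expr1 ?scaleN1r ?expr0 ?scale1r.
Qed.

(** The seven linear equations that cut out the eigenspace on which
    b |-> *(Psi0 /\ b) is -1, the Lie algebra of Spin(7) in Lambda^2 R^8. Only the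
    entries above the diagonal enter. *)
Definition lambda21 (T : nat -> nat -> R) : Prop :=
  [/\ T 0%N 1%N + T 2%N 3%N + T 4%N 5%N + T 6%N 7%N = 0,
      T 0%N 2%N - T 1%N 3%N + T 4%N 6%N - T 5%N 7%N = 0,
      T 0%N 3%N + T 1%N 2%N - T 4%N 7%N - T 5%N 6%N = 0 &
  [/\ T 0%N 4%N - T 1%N 5%N - T 2%N 6%N + T 3%N 7%N = 0,
      T 0%N 5%N + T 1%N 4%N + T 2%N 7%N + T 3%N 6%N = 0,
      T 0%N 6%N - T 1%N 7%N + T 2%N 4%N - T 3%N 5%N = 0 &
      T 0%N 7%N + T 1%N 6%N - T 2%N 5%N - T 3%N 4%N = 0]].

(** By evaluation, each coefficient of Psi0 /\ b + * b is a combination of the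
    seven equations. *)
Lemma psi_wedge_setof (b : ext R^o) (i j : nat) : (i < j < 8)%N ->
  lambda21 (fun i j => b (setof [:: i; j])) ->
  swedge (Psi0 R) b (setof (rest [:: i; j] (iota 0 8))) =
  - star b (setof (rest [:: i; j] (iota 0 8))).
Proof.
move=> ij8; rewrite /lambda21 /= => -[e1 e2 e3 [e4 e5 e6 e7]].
have -> : star b (setof (rest [:: i; j] (iota 0 8))) =
   (if odd (inversions [:: i; j] (rest [:: i; j] (iota 0 8)))
   then - b (setof [:: i; j]) else b (setof [:: i; j])).
  rewrite ffunE.
  have -> : (~: setof (rest [:: i; j] (iota 0 8)))%SET = setof [:: i; j].
    apply/setP => k; rewrite !inE mem_filter mem_iota /= ltn_ord andbT negbK.
    by rewrite !inE.
  rewrite esign_setof -signr_odd; case: (odd _).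
    by rewrite expr1 scaleN1r.
  by rewrite expr0 scale1r.
rewrite swedge_Psi0.
have /andP[ij j8] := ij8; have i8 := ltn_trans ij j8.
move: j j8 ij {ij8} => [|[|[|[|[|[|[|[|j]]]]]]]] // _;
  move: i i8 => [|[|[|[|[|[|[|[|i]]]]]]]] // _ // _;
  match goal with |- context [odd ?s] =>
    let c := eval vm_compute in (odd s) in change (odd s) with c end;
  match goal with |- context [psi_coefs ?s] =>
    let c := eval vm_compute in (psi_coefs s) in change (psi_coefs s) with c end;
  rewrite !big_cons big_nil /=; lra.
Qed.

Lemma homogeneous_dxs s : @homogeneous R R^o (size s) (dxs R s).
Proof.
elim: s => [|k s IH] /=.
  by move=> K K0; rewrite ffunE -cards_eq0 (negPf K0).
apply: (@homogeneous_swedge R R^o 1 _ (dx R k)) => // K K1.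
by rewrite ffunE; case: eqP => // KE; rewrite KE cards1 in K1.
Qed.

Lemma homogeneous_Psi0 : @homogeneous R R^o 4 (Psi0 R).
Proof.
have hN n (a : ext R^o) : @homogeneous R R^o n a -> @homogeneous R R^o n (- a).
  by move=> ha; rewrite -scaleN1r; apply: homogeneousZ.
have h2 a b : @homogeneous R R^o 2 (dxs R [:: a; b]).
  exact: (@homogeneous_dxs [:: a; b]).
apply: homogeneousD; last apply: hN.
  apply: homogeneousD; first apply: homogeneousD; first apply: homogeneousD.
  - exact: (@homogeneous_dxs [:: 0; 1; 2; 3]%N).
  - exact: (@homogeneous_dxs [:: 4; 5; 6; 7]%N).
  - by apply: (@homogeneous_swedge R R^o 2 2); apply: homogeneousD; apply: h2.
  - apply: (@homogeneous_swedge R R^o 2 2); apply: homogeneousD; try exact: h2;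
      exact/hN/h2.
by apply: (@homogeneous_swedge R R^o 2 2); apply: homogeneousD; apply: h2.
Qed.

(** The instanton equation holds on Lambda^2_21. *)
Lemma psi_wedge (b : ext R^o) : homogeneous 2 b ->
  lambda21 (fun i j => b (setof [:: i; j])) ->
  swedge (Psi0 R) b = - star b.
Proof.
move=> hb b21; apply/ffunP => K; rewrite [RHS]ffunE.
have [/eqP/cards2P[i [j [ij KE]]]|K2] := eqVneq #|(~: K)%SET| 2%N.
  wlog {ij} ij : i j KE / (i < j)%N => [hw|].
    case: (ltngtP i j) ij => [ij _|ij _|/val_inj ->]; last by rewrite eqxx.
      exact: hw KE ij.
    by apply: hw ij; rewrite KE finset.setUC.
  have -> : K = setof (rest [:: val i; val j] (iota 0 8)).
    apply/setP => k; rewrite !inE mem_filter mem_iota /= ltn_ord andbT.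
    by move/setP/(_ k): KE; rewrite !inE -!val_eqE => /(congr1 negb); rewrite negbK.
  by apply: psi_wedge_setof => //; rewrite ij ltn_ord.
rewrite [star b K]ffunE hb // scaler0 oppr0.
rewrite (homogeneous_swedge homogeneous_Psi0 hb) //.
by rewrite cardsC8 in K2; move: (cards_le8 K) K2; lia.
Qed.
End Psi.

(** * Complex structures, Lie(Sp(2)) and W *)

Ltac cases8 k k8 := move: k k8 => [|[|[|[|[|[|[|[|k]]]]]]]] // _.

Lemma forall_ord8 (P : 'I_8 -> Prop) :
  (forall k : nat, (k < 8)%N -> P (inord k)) -> forall k, P k.
Proof. by move=> h k; have := h k (ltn_ord k); rewrite inord_val. Qed.

Lemma sum_ord8 (V : nmodType) (F : 'I_8 -> V) :
  \sum_k F k = F (inord 0) + F (inord 1) + F (inord 2) + F (inord 3)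
             + F (inord 4) + F (inord 5) + F (inord 6) + F (inord 7).
Proof.
rewrite (eq_bigr (fun k : 'I_8 => F (inord k))); last first.
  by move=> k _; rewrite inord_val.
by rewrite -(big_mkord xpredT (fun k => F (inord k))) unlock /= addr0 !addrA.
Qed.

Section Structures.
Variable R : realType.
Implicit Types (v : pt R) (B S w M : 'M[R]_8) (i j k l : nat).

(** Right multiplications by e_1 and e_2 permute the coordinates up to sign:
    (I_a v)_i is I_a_sign i times the coordinate of v with number I_a_index i. *)
Definition I1_index i := nth 0%N [:: 1; 0; 3; 2; 5; 4; 7; 6]%N i.
Definition I2_index i := nth 0%N [:: 2; 3; 0; 1; 6; 7; 4; 5]%N i.
Definition I1_sign i : R := nth 0 [:: -1; 1; -1; 1; -1; 1; -1; 1] i.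
Definition I2_sign i : R := nth 0 [:: -1; 1; 1; -1; -1; 1; 1; -1] i.

Lemma eq_inord i j : (i < 8)%N -> (j < 8)%N ->
  (inord i == inord j :> 'I_8) = (i == j).
Proof. by move=> i8 j8; rewrite -val_eqE /= !inordK. Qed.

Lemma I1E i j : (i < 8)%N -> (j < 8)%N ->
  I1 R (inord i) (inord j) = I1_sign i * (j == I1_index i)%:R.
Proof.
rewrite mxE /vec_of_quats /qmul /quatx /quaty /quat_at !mxE.
move=> i8 j8; rewrite !(eq_sym _ (inord j)) !eq_inord ?inordK //.
move: i j i8 j8 => [|[|[|[|[|[|[|[|i]]]]]]]] [|[|[|[|[|[|[|[|j]]]]]]]] // _ _;
 rewrite /= ?inordK //=; rewrite /I1_sign /=; ring.
Qed.

Lemma I2E i j : (i < 8)%N -> (j < 8)%N ->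
  I2 R (inord i) (inord j) = I2_sign i * (j == I2_index i)%:R.
Proof.
rewrite mxE /vec_of_quats /qmul /quatx /quaty /quat_at !mxE.
move=> i8 j8; rewrite !(eq_sym _ (inord j)) !eq_inord ?inordK //.
move: i j i8 j8 => [|[|[|[|[|[|[|[|i]]]]]]]] [|[|[|[|[|[|[|[|j]]]]]]]] // _ _;
 rewrite /= ?inordK //=; rewrite /I2_sign /=; ring.
Qed.

Lemma I1_mul n (A : 'M[R]_(8, n)) i (j : 'I_n) : (i < 8)%N ->
  (I1 R *m A) (inord i) j = I1_sign i * A (inord (I1_index i)) j.
Proof.
move=> i8; rewrite mxE sum_ord8 !I1E //.
by cases8 i i8; rewrite /I1_sign /= ?mulr0 ?mul0r ?mulr1 ?addr0 ?add0r.
Qed.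

Lemma I2_mul n (A : 'M[R]_(8, n)) i (j : 'I_n) : (i < 8)%N ->
  (I2 R *m A) (inord i) j = I2_sign i * A (inord (I2_index i)) j.
Proof.
move=> i8; rewrite mxE sum_ord8 !I2E //.
by cases8 i i8; rewrite /I2_sign /= ?mulr0 ?mul0r ?mulr1 ?addr0 ?add0r.
Qed.

Lemma tr_I1 : (I1 R)^T = - I1 R.
Proof.
apply/matrixP => i j; move: i j; apply: forall_ord8 => i i8.
apply: forall_ord8 => j j8; rewrite mxE [RHS]mxE !I1E //.
by cases8 i i8; cases8 j j8; rewrite /I1_sign /= ?mulr0 ?oppr0 ?mulr1 ?opprK.
Qed.

Lemma tr_I2 : (I2 R)^T = - I2 R.
Proof.
apply/matrixP => i j; move: i j; apply: forall_ord8 => i i8.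
apply: forall_ord8 => j j8; rewrite mxE [RHS]mxE !I2E //.
by cases8 i i8; cases8 j j8; rewrite /I2_sign /= ?mulr0 ?oppr0 ?mulr1 ?opprK.
Qed.

Lemma I1_sqr n (A : 'M[R]_(8, n)) : I1 R *m (I1 R *m A) = - A.
Proof.
apply/matrixP => i j; move: i; apply: forall_ord8 => i i8.
by rewrite I1_mul //; cases8 i i8; rewrite I1_mul // mxE
  /I1_sign /= ?mulN1r ?mul1r ?opprK.
Qed.

Lemma I2_sqr n (A : 'M[R]_(8, n)) : I2 R *m (I2 R *m A) = - A.
Proof.
apply/matrixP => i j; move: i; apply: forall_ord8 => i i8.
by rewrite I2_mul //; cases8 i i8; rewrite I2_mul // mxE
  /I2_sign /= ?mulN1r ?mul1r ?opprK.
Qed.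

Lemma I1I2 n (A : 'M[R]_(8, n)) : I1 R *m (I2 R *m A) = - (I2 R *m (I1 R *m A)).
Proof.
apply/matrixP => i j; move: i; apply: forall_ord8 => i i8.
by cases8 i i8; rewrite I1_mul // I2_mul // [RHS]mxE I2_mul // I1_mul //
  /I1_sign /I2_sign /= ?mulN1r ?mul1r ?opprK.
Qed.

Lemma mul_I1 n (A : 'M[R]_(n, 8)) (i : 'I_n) j : (j < 8)%N ->
  (A *m I1 R) i (inord j) = - I1_sign j * A i (inord (I1_index j)).
Proof.
move=> j8; have -> : A *m I1 R = - (I1 R *m A^T)^T.
  by rewrite trmx_mul tr_I1 trmxK mulmxN opprK.
by rewrite 2!mxE I1_mul // mxE mulNr.
Qed.

Lemma mul_I2 n (A : 'M[R]_(n, 8)) (i : 'I_n) j : (j < 8)%N ->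
  (A *m I2 R) i (inord j) = - I2_sign j * A i (inord (I2_index j)).
Proof.
move=> j8; have -> : A *m I2 R = - (I2 R *m A^T)^T.
  by rewrite trmx_mul tr_I2 trmxK mulmxN opprK.
by rewrite 2!mxE I2_mul // mxE mulNr.
Qed.

(** Quaternionic linearity. Commuting with I_1 and I_2 suffices since
    I_3 = I_1 I_2. *)
Definition qlin (B : 'M[R]_8) : Prop :=
  B *m I1 R = I1 R *m B /\ B *m I2 R = I2 R *m B.

Lemma lieSp2P B : lieSp2 R B <-> B^T = - B /\ qlin B.
Proof.
have I3E : I3 R = I1 R *m I2 R.
  apply/matrixP => i j; move: i j; apply: forall_ord8 => i i8.
  apply: forall_ord8 => j j8; rewrite I1_mul // I2E //; last by cases8 i i8.
  rewrite mxE /vec_of_quats /qmul /quatx /quaty /quat_at !mxE.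
  rewrite !(eq_sym _ (inord j)) !eq_inord ?inordK //.
  by cases8 i i8; cases8 j j8; rewrite /I1_sign /I2_sign /=; ring.
split=> [[-> B1 B2 _]|[BT [B1 B2]]]; first by [].
by split=> //; rewrite I3E mulmxA B1 -!mulmxA B2.
Qed.

Lemma qlin1 B i j : qlin B -> (i < 8)%N -> (j < 8)%N ->
  - I1_sign j * B (inord i) (inord (I1_index j)) = I1_sign i * B (inord (I1_index i)) (inord j).
Proof. by move=> [B1 _] i8 j8; rewrite -mul_I1 // B1 I1_mul. Qed.

Lemma qlin2 B i j : qlin B -> (i < 8)%N -> (j < 8)%N ->
  - I2_sign j * B (inord i) (inord (I2_index j)) = I2_sign i * B (inord (I2_index i)) (inord j).
Proof. by move=> [_ B2] i8 j8; rewrite -mul_I2 // B2 I2_mul. Qed.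
End Structures.

(** * The type of the algebraic terms of D_A alpha *)

Section LinAlg.
Variable R : realType.
Implicit Types (v r : pt R) (B S w M P N : 'M[R]_8) (i j k l : nat).

Definition lambda21_mx B := lambda21 (fun i j => B (inord i) (inord j)).

Lemma lambda21_mxD B S : lambda21_mx B -> lambda21_mx S -> lambda21_mx (B + S).
Proof.
rewrite /lambda21_mx /lambda21 !mxE => -[e1 e2 e3 [e4 e5 e6 e7]].
by move=> -[f1 f2 f3 [f4 f5 f6 f7]]; do !split; lra.
Qed.

Lemma lambda21_mxZ (c : R) B : lambda21_mx B -> lambda21_mx (c *: B).
Proof.
rewrite /lambda21_mx /lambda21 !mxE => -[e1 e2 e3 [e4 e5 e6 e7]].
do !split.
- by rewrite -!mulrDr e1 mulr0.
- by rewrite -mulrBr -mulrDr -mulrBr e2 mulr0.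
- by rewrite -mulrDr -!mulrBr e3 mulr0.
- by rewrite -!mulrBr -mulrDr e4 mulr0.
- by rewrite -!mulrDr e5 mulr0.
- by rewrite -mulrBr -mulrDr -mulrBr e6 mulr0.
- by rewrite -mulrDr -!mulrBr e7 mulr0.
Qed.

Lemma skewP B : B^T = - B -> forall i j : 'I_8, B i j = - B j i.
Proof. by move=> BT i j; move/matrixP/(_ j i): BT; rewrite !mxE. Qed.

(** Lie(Sp(2)) is contained in Lie(Spin(7)). *)
Lemma lambda21_lieSp2 B : lieSp2 R B -> lambda21_mx B.
Proof.
move=> /lieSp2P[/skewP BT qB]; rewrite /lambda21_mx /lambda21.
have e1 := @qlin2 _ _ 0%N 3%N qB isT isT.
have e1' := @qlin2 _ _ 4%N 7%N qB isT isT.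
have e2 := @qlin1 _ _ 0%N 3%N qB isT isT.
have e2' := @qlin1 _ _ 4%N 7%N qB isT isT.
have e3 := @qlin1 _ _ 0%N 2%N qB isT isT.
have e3' := @qlin1 _ _ 4%N 6%N qB isT isT.
have e4 := @qlin1 _ _ 0%N 5%N qB isT isT.
have e4' := @qlin1 _ _ 2%N 7%N qB isT isT.
have e5 := @qlin1 _ _ 0%N 4%N qB isT isT.
have e5' := @qlin1 _ _ 2%N 6%N qB isT isT.
have e6 := @qlin1 _ _ 0%N 7%N qB isT isT.
have e6' := @qlin1 _ _ 2%N 5%N qB isT isT.
have e7 := @qlin1 _ _ 0%N 6%N qB isT isT.
have e7' := @qlin1 _ _ 2%N 4%N qB isT isT.
rewrite /I1_sign /I2_sign /= in e1 e2 e3 e4 e5 e6 e7 e1' e2' e3' e4' e5' e6' e7'.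
by do !split; lra.
Qed.

Lemma sum_diag S : \tr S = S (inord 0) (inord 0) + S (inord 1) (inord 1)
  + S (inord 2) (inord 2) + S (inord 3) (inord 3) + S (inord 4) (inord 4)
  + S (inord 5) (inord 5) + S (inord 6) (inord 6) + S (inord 7) (inord 7).
Proof. exact: sum_ord8. Qed.

(** Under Sp(2), Lambda^2 R^8 is the sum of Lie(Sp(2)), of the span of I_1, I_2,
    I_3, and of W I_1, W I_2, W I_3. Of the last six pieces, Psi0 has
    Lambda^2_21 contain I_3, W I_1 and W I_2, while I_1, I_2 and W I_3 span
    Lambda^2_7; this is why W I_3 is absent from the space of deformations. *)
Lemma lambda21_mul_I1 S : qlin S -> \tr S = 0 ->
  lambda21_mx (S *m I1 R).
Proof.
move=> qS; rewrite sum_diag => tS; rewrite /lambda21_mx /lambda21 !mul_I1 //.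
do !split.
- have := @qlin1 _ _ 0%N 1%N qS isT isT; have := @qlin1 _ _ 2%N 3%N qS isT isT; have := @qlin1 _ _ 4%N 5%N qS isT isT; have := @qlin1 _ _ 6%N 7%N qS isT isT;
  rewrite /I1_sign /I2_sign /=; lra.
- have := @qlin1 _ _ 0%N 2%N qS isT isT; have := @qlin1 _ _ 4%N 6%N qS isT isT;
  rewrite /I1_sign /I2_sign /=; lra.
- have := @qlin1 _ _ 0%N 3%N qS isT isT; have := @qlin1 _ _ 4%N 7%N qS isT isT;
  rewrite /I1_sign /I2_sign /=; lra.
- have := @qlin1 _ _ 0%N 4%N qS isT isT; have := @qlin1 _ _ 2%N 6%N qS isT isT;
  rewrite /I1_sign /I2_sign /=; lra.
- have := @qlin1 _ _ 0%N 5%N qS isT isT; have := @qlin1 _ _ 2%N 7%N qS isT isT;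
  rewrite /I1_sign /I2_sign /=; lra.
- have := @qlin1 _ _ 0%N 6%N qS isT isT; have := @qlin1 _ _ 2%N 4%N qS isT isT;
  rewrite /I1_sign /I2_sign /=; lra.
- have := @qlin1 _ _ 0%N 7%N qS isT isT; have := @qlin1 _ _ 2%N 5%N qS isT isT;
  rewrite /I1_sign /I2_sign /=; lra.
Qed.

Lemma lambda21_mul_I2 S : S^T = S -> qlin S -> \tr S = 0 ->
  lambda21_mx (S *m I2 R).
Proof.
move=> ST qS; rewrite sum_diag => tS; rewrite /lambda21_mx /lambda21 !mul_I2 //.
have sS (i j : 'I_8) : S i j = S j i by rewrite -[in LHS]ST mxE.
do !split.
- have := @qlin2 _ _ 0%N 1%N qS isT isT; have := @qlin2 _ _ 4%N 5%N qS isT isT;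
  rewrite /I1_sign /I2_sign /=; lra.
- have := @qlin2 _ _ 0%N 2%N qS isT isT; have := @qlin2 _ _ 1%N 3%N qS isT isT; have := @qlin2 _ _ 4%N 6%N qS isT isT; have := @qlin2 _ _ 5%N 7%N qS isT isT;
  rewrite /I1_sign /I2_sign /=; lra.
- have := sS (inord 0) (inord 1); have := sS (inord 4) (inord 5);
  have := sS (inord 2) (inord 3); have := sS (inord 6) (inord 7);
  have := @qlin1 _ _ 0%N 0%N qS isT isT; have := @qlin1 _ _ 2%N 2%N qS isT isT; have := @qlin1 _ _ 4%N 4%N qS isT isT; have := @qlin1 _ _ 6%N 6%N qS isT isT;
  rewrite /I1_sign /I2_sign /=; lra.
- have := @qlin2 _ _ 0%N 4%N qS isT isT; have := @qlin2 _ _ 1%N 5%N qS isT isT;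
  rewrite /I1_sign /I2_sign /=; lra.
- have := @qlin2 _ _ 0%N 5%N qS isT isT; have := @qlin2 _ _ 1%N 4%N qS isT isT;
  rewrite /I1_sign /I2_sign /=; lra.
- have := @qlin2 _ _ 0%N 6%N qS isT isT; have := @qlin2 _ _ 1%N 7%N qS isT isT;
  rewrite /I1_sign /I2_sign /=; lra.
- have := @qlin2 _ _ 0%N 7%N qS isT isT; have := @qlin2 _ _ 1%N 6%N qS isT isT;
  rewrite /I1_sign /I2_sign /=; lra.
Qed.
End LinAlg.

Section WSpace.
Variable R : realType.
Implicit Types (v r : pt R) (B S w M N : 'M[R]_8) (i j k l : nat).

(** The matrix of a general element of W in the basis (1, -i, -j, -k) of both
    quaternionic coordinates. *)
Definition wtab (a z0 z1 z2 z3 : R) : seq (seq R) :=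
  [:: [:: a; 0; 0; 0; z0; - z1; - z2; - z3];
      [:: 0; a; 0; 0; z1; z0; z3; - z2];
      [:: 0; 0; a; 0; z2; - z3; z0; z1];
      [:: 0; 0; 0; a; z3; z2; - z1; z0];
      [:: z0; z1; z2; z3; - a; 0; 0; 0];
      [:: - z1; z0; - z3; z2; 0; - a; 0; 0];
      [:: - z2; z3; z0; - z1; 0; 0; - a; 0];
      [:: - z3; - z2; z1; z0; 0; 0; 0; - a]].

Definition wmx (a z0 z1 z2 z3 : R) : 'M[R]_8 :=
  lmul2 (qreal a) (qconj (z0, z1, z2, z3)) (z0, z1, z2, z3) (qreal (- a)).

Lemma wmxE a z0 z1 z2 z3 i j : (i < 8)%N -> (j < 8)%N ->
  wmx a z0 z1 z2 z3 (inord i) (inord j) = nth 0 (nth [::] (wtab a z0 z1 z2 z3) i) j.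
Proof.
move=> i8 j8; rewrite mxE /vec_of_quats /qmul /quatx /quaty /quat_at !mxE.
rewrite !(eq_sym _ (inord j)) !eq_inord ?inordK //.
by cases8 i i8; cases8 j j8; rewrite /=; ring.
Qed.

Lemma wmx_tr a z0 z1 z2 z3 : (wmx a z0 z1 z2 z3)^T = wmx a z0 z1 z2 z3.
Proof.
apply/matrixP => i j; move: i j; apply: forall_ord8 => i i8.
apply: forall_ord8 => j j8; rewrite mxE !wmxE //.
by cases8 i i8; cases8 j j8.
Qed.

Lemma wmx_qlin a z0 z1 z2 z3 : qlin (wmx a z0 z1 z2 z3).
Proof.
split; apply/matrixP => i j; move: i j; apply: forall_ord8 => i i8;
    apply: forall_ord8 => j j8.
  rewrite mul_I1 // I1_mul //.
  by cases8 i i8; cases8 j j8; rewrite !wmxE // /I1_sign /=; ring.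
rewrite mul_I2 // I2_mul //.
by cases8 i i8; cases8 j j8; rewrite !wmxE // /I2_sign /=; ring.
Qed.

Lemma WP w : W R w -> w^T = w /\ qlin w.
Proof.
by move=> [a [[[[z0 z1] z2] z3] ->]]; split; [exact: wmx_tr|exact: wmx_qlin].
Qed.

Lemma qlinM B S : qlin B -> qlin S -> qlin (B *m S).
Proof.
move=> [b1 b2] [s1 s2]; split.
  by rewrite -mulmxA s1 !mulmxA b1.
by rewrite -mulmxA s2 !mulmxA b2.
Qed.

Lemma qlinD B S : qlin B -> qlin S -> qlin (B + S).
Proof. by move=> [b1 b2] [s1 s2]; split; rewrite mulmxDl mulmxDr ?b1 ?s1 ?b2 ?s2. Qed.

Lemma qlinB B S : qlin B -> qlin S -> qlin (B - S).
Proof. by move=> [b1 b2] [s1 s2]; split; rewrite mulmxBl mulmxBr ?b1 ?s1 ?b2 ?s2. Qed.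

(** Conjugation by I_2 fixes N and changes the sign of I_1. *)
Lemma trace_mul_I1 N : qlin N -> \tr (N *m I1 R) = 0.
Proof.
move=> [n1 n2].
set X := I2 R *m (I2 R *m (N *m I1 R)).
have I12 : I1 R *m I2 R = - (I2 R *m I1 R).
  by have := I1I2 (1%:M : 'M[R]_8); rewrite !mulmx1.
have XN : \tr X = - \tr X.
  rewrite -raddfN {1}/X mxtrace_mulC; congr (\tr _).
  by rewrite -!mulmxA I12 !mulmxN (mulmxA N) n2 -!mulmxA.
have : \tr X = 0 by lra.
by rewrite /X I2_sqr raddfN /= => /eqP; rewrite oppr_eq0 => /eqP.
Qed.

Lemma qlin_W012 M : W012 R M -> exists w0 w1 w2,
  [/\ w0^T = w0 /\ qlin w0, w1^T = w1 /\ qlin w1, w2^T = w2 /\ qlin w2 &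
  M = w0 + w1 *m I1 R + w2 *m I2 R].
Proof.
move=> [w0 [w1 [w2 [/WP h0 /WP h1 /WP h2 ->]]]].
by exists w0, w1, w2.
Qed.

(** For w in W and B in Lie(Sp(2)), w B + B w is in Lie(Sp(2)). The transpose of
    w I_a is - w I_a, so that w I_a contributes (B w - w B) I_a, where the
    commutator is self-adjoint and traceless, hence in W. *)
Lemma lambda21_W012 M B : W012 R M -> lieSp2 R B ->
  lambda21_mx (M^T *m B + B *m M).
Proof.
move=> /qlin_W012[w0 [w1 [w2 [[t0 q0] [t1 q1] [t2 q2] ->]]]].
move=> /lieSp2P[BT qB].
have tA w : w^T = w -> qlin w -> (B *m w - w *m B)^T = B *m w - w *m B.
  by move=> tw _; rewrite raddfB /= !trmx_mul tw BT mulmxN mulNmx opprK addrC.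
have -> : (w0 + w1 *m I1 R + w2 *m I2 R)^T *m B
    + B *m (w0 + w1 *m I1 R + w2 *m I2 R) =
    (w0 *m B + B *m w0) + (B *m w1 - w1 *m B) *m I1 R
    + (B *m w2 - w2 *m B) *m I2 R.
  rewrite !raddfD /= !trmx_mul t0 t1 t2 tr_I1 tr_I2 !mulmxDl ?mulmxDr !mulNmx.
  have [B1 B2] := qB; have [w11 _] := q1; have [_ w22] := q2.
  rewrite -w11 -w22 -!mulmxA -B1 -B2 !mulmxA.
  by apply/matrixP => i j; rewrite !mxE; ring.
apply: lambda21_mxD; first apply: lambda21_mxD.
- apply/lambda21_lieSp2/lieSp2P; split; last by apply: qlinD; exact: qlinM.
  by rewrite raddfD /= !trmx_mul t0 BT mulmxN mulNmx opprD addrC.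
- apply: lambda21_mul_I1; first by apply: qlinB; exact: qlinM.
  by rewrite raddfB /= mxtrace_mulC subrr.
- apply: lambda21_mul_I2; first exact: tA.
    by apply: qlinB; exact: qlinM.
  by rewrite raddfB /= mxtrace_mulC subrr.
Qed.
End WSpace.

(** * Pointwise consequences of the Bianchi identity *)

Section YangMills.
Variable R : realType.
Implicit Types (v r : pt R) (B S w M : 'M[R]_8).

Lemma trace_mul_I2 (N : 'M[R]_8) : qlin N -> \tr (N *m I2 R) = 0.
Proof.
move=> [n1 n2].
set X := I1 R *m (I1 R *m (N *m I2 R)).
have I12 : I2 R *m I1 R = - (I1 R *m I2 R).
  by have := I1I2 (1%:M : 'M[R]_8); rewrite !mulmx1 => ->; rewrite opprK.
have XN : \tr X = - \tr X.
  rewrite -raddfN {1}/X mxtrace_mulC; congr (\tr _).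
  by rewrite -!mulmxA I12 !mulmxN (mulmxA N) n1 -!mulmxA.
have : \tr X = 0 by lra.
by rewrite /X I1_sqr raddfN /= => /eqP; rewrite oppr_eq0 => /eqP.
Qed.

Lemma trace_sym_skew w B : w^T = w -> B^T = - B -> \tr (w *m B) = 0.
Proof.
move=> tw tB; have : \tr (w *m B) = - \tr (w *m B).
  by rewrite -{1}mxtrace_tr trmx_mul tw tB mulNmx raddfN /= mxtrace_mulC.
by move=> h; lra.
Qed.

(** M is a sum of a symmetric matrix w0, orthogonal to the skew B, and of terms
    w I_a, where the trace of w B I_a vanishes by quaternionic linearity. *)
Lemma trace_W012 M B : W012 R M -> lieSp2 R B -> \tr (M^T *m B) = 0.
Proof.
move=> /qlin_W012[w0 [w1 [w2 [[t0 q0] [t1 q1] [t2 q2] ->]]]].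
move=> /lieSp2P[BT qB].
have -> : (w0 + w1 *m I1 R + w2 *m I2 R)^T *m B =
    w0 *m B - (w1 *m B) *m I1 R - (w2 *m B) *m I2 R.
  rewrite !raddfD /= !trmx_mul t0 t1 t2 tr_I1 tr_I2 !mulmxDl !mulNmx.
  have [B1 B2] := qB; have [w11 _] := q1; have [_ w22] := q2.
  by rewrite -w11 -w22 -!mulmxA -B1 -B2 !mulmxA.
by rewrite !raddfB /= trace_mul_I1 ?trace_mul_I2 ?trace_sym_skew ?subr0 //;
  exact: qlinM.
Qed.

(** Here N k is the covariant derivative of the curvature in the direction e_k.
    Contract the Bianchi identity with the 2-form I_1: as N v is
    quaternionic-linear its contraction vanishes, and the two other terms are both the divergence of
    N composed with I_1. *)
Lemma yang_mills (N : 'I_8 -> 'M[R]_8) :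
  (forall k, lieSp2 R (N k)) ->
  (forall i j k, N k i j + N i j k + N j k i = 0) ->
  forall m, \sum_k N k k m = 0.
Proof.
move=> Nsp bianchi.
pose d := \row_j \sum_k N k k j.
have skI i j : I1 R i j = - I1 R j i by apply: skewP; exact: tr_I1.
have skN k i j : N k i j = - N k j i.
  by apply: skewP; have [] := (lieSp2P _).1 (Nsp k).
have qN k : N k *m I1 R = I1 R *m N k by have [_ [? _]] := (lieSp2P _).1 (Nsp k).
have dI (v : 'I_8) : (d *m I1 R) 0 v = 0.
  have T1 : \sum_k \sum_l I1 R l k * N k l v = - (d *m I1 R) 0 v.
    transitivity (- \sum_k (I1 R *m N k) k v).
      rewrite -sumrN; apply: eq_bigr => k _; rewrite mxE -sumrN.
      by apply: eq_bigr => l _; rewrite skI mulNr.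
    congr (- _); under eq_bigr do rewrite -qN mxE.
    rewrite exchange_big mxE; apply: eq_bigr => j _ /=.
    by rewrite [d 0 j]mxE mulr_suml.
  have T2 : \sum_l \sum_k I1 R l k * N l v k = - (d *m I1 R) 0 v.
    transitivity (- \sum_l (N l *m I1 R) v l).
      rewrite -sumrN; apply: eq_bigr => l _; rewrite mxE -sumrN.
      by apply: eq_bigr => k _; rewrite skI mulNr mulrC.
    congr (- _); under eq_bigr do rewrite qN mxE.
    rewrite exchange_big mxE; apply: eq_bigr => j _ /=.
    rewrite [d 0 j]mxE mulr_suml; apply: eq_bigr => l _.
    by rewrite skI skN mulrNN mulrC.
  have T3 : \sum_k \sum_l I1 R l k * N v k l = 0.
    have [_ qv] := (lieSp2P _).1 (Nsp v); rewrite -[RHS](trace_mul_I1 qv).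
    by apply: eq_bigr => k _; rewrite mxE; apply: eq_bigr => l _; rewrite mulrC.
  have : \sum_k \sum_l I1 R l k * N k l v + \sum_l \sum_k I1 R l k * N l v k
     + \sum_k \sum_l I1 R l k * N v k l = 0.
    rewrite [X in _ + X + _]exchange_big -!big_split big1 // => k _.
    rewrite -!big_split big1 // => l _ /=.
    by rewrite -!mulrDr bianchi mulr0.
  by rewrite T1 T2 T3 => h; lra.
apply: forall_ord8 => m m8.
have := dI (inord (I1_index m)); rewrite mul_I1; last by move: m m8; do 8!case=> //.
move: m m8 => [|[|[|[|[|[|[|[|m]]]]]]]] // _; rewrite mxE /I1_sign /= => ?; lra.
Qed.

(** The three equations on D_A alpha at one point r. F and N k stand for a matrix
    entry of the curvature and of its covariant derivatives at r, and Da k l is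
    then nabla_k alpha_l, by the Leibniz rule for alpha = F(M r, -). By the Bianchi
    identity D_A alpha is the matrix D below: its first two terms are of type 21
    because M is in W + W I_1 + W I_2, the others because N takes values in
    Lie(Sp(2)). The hypotheses on r say that r _| F = 0, and the derivative of this
    equation. *)
Lemma contraction_field_algebra (r : pt R) M (F : 'M[R]_8) (N : 'I_8 -> 'M[R]_8)
    (Da := fun k l => \sum_m M m k * F m l + \sum_m (M *m r) m 0 * N k m l) :
  W012 R M -> lieSp2 R F -> (forall k, lieSp2 R (N k)) ->
  (forall i j k, N k i j + N i j k + N j k i = 0) ->
  (forall j, \sum_i r i 0 * F i j = 0) ->
  (forall k j, \sum_i r i 0 * N k i j = - F k j) ->
  [/\ lambda21 (fun i j => Da (inord i) (inord j) - Da (inord j) (inord i)),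
      forall l, \sum_k r k 0 * (Da k l - Da l k) = 0 &
      \sum_k Da k k = 0].
Proof.
move=> MW Fsp Nsp bianchi rF rN.
have skF i j : F i j = - F j i by apply: skewP; have [] := (lieSp2P _).1 Fsp.
have skN k i j : N k i j = - N k j i.
  by apply: skewP; have [] := (lieSp2P _).1 (Nsp k).
pose D := M^T *m F + F *m M + \sum_m (M *m r) m 0 *: N m.
have DE k l : Da k l - Da l k = D k l.
  rewrite /Da /D !mxE summxE.
  have -> : \sum_m M^T k m * F m l = \sum_m M m k * F m l.
    by apply: eq_bigr => m _; rewrite mxE.
  have -> : \sum_m F k m * M m l = - \sum_m M m l * F m k.
    by rewrite -sumrN; apply: eq_bigr => m _; rewrite skF mulNr mulrC.
  have -> : \sum_m ((M *m r) m 0 *: N m) k l =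
    \sum_m (M *m r) m 0 * N k m l - \sum_m (M *m r) m 0 * N l m k.
    rewrite -sumrB; apply: eq_bigr => m _; rewrite mxE -mulrBr; congr (_ * _).
    by have := bianchi k l m; rewrite (skN k l m) => ?; lra.
  lra.
split.
- rewrite /lambda21 !DE; have : lambda21_mx D; last by [].
  have [lam0 lamD] : lambda21_mx (0 : 'M[R]_8) /\
      forall m c, lambda21_mx (c *: N m).
    split=> [|m c]; last exact/lambda21_mxZ/lambda21_lieSp2.
    by rewrite -(scale0r (N 0)); exact/lambda21_mxZ/lambda21_lieSp2.
  apply: lambda21_mxD; first exact: lambda21_W012.
  by elim/big_ind: _ => [|B S|m _] //; exact: lambda21_mxD.
- move=> l; under eq_bigr do rewrite DE /D mxE mxE !mulrDr.
  rewrite !big_split /=.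
  have -> : \sum_k r k 0 * (M^T *m F) k l = \sum_m (M *m r) m 0 * F m l.
    under eq_bigr do rewrite mxE mulr_sumr.
    rewrite exchange_big; apply: eq_bigr => m _ /=; rewrite mxE mulr_suml.
    by apply: eq_bigr => k _; rewrite mxE; ring.
  have -> : \sum_k r k 0 * (F *m M) k l = 0.
    under eq_bigr do rewrite mxE mulr_sumr.
    rewrite exchange_big big1 // => m _ /=.
    under eq_bigr do rewrite mulrA.
    by rewrite -mulr_suml rF mul0r.
  rewrite addr0 -[RHS](subrr (\sum_m (M *m r) m 0 * F m l)); congr (_ + _).
  under eq_bigr do rewrite summxE mulr_sumr.
  rewrite exchange_big -sumrN; apply: eq_bigr => m _ /=.
  under eq_bigr do rewrite mxE mulrCA.
  by rewrite -mulr_sumr rN mulrN.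
- rewrite /Da big_split /=.
  have -> : \sum_k \sum_m M m k * F m k = \tr (M^T *m F).
    by apply: eq_bigr => k _; rewrite mxE; apply: eq_bigr => m _; rewrite mxE.
  rewrite trace_W012 // add0r exchange_big big1 // => m _ /=.
  rewrite -mulr_sumr; under eq_bigr do rewrite skN.
  by rewrite sumrN yang_mills // oppr0 mulr0.
Qed.
End YangMills.

(** * Quaternionic lines *)

Section QuaternionicLines.
Variable R : realType.
Implicit Types (u v n r x y : pt R) (B M F : 'M[R]_8).

Definition dot x y : R := \sum_k x k 0 * y k 0.

Lemma dotE x y : dot x y =
  x (inord 0) 0 * y (inord 0) 0 + x (inord 1) 0 * y (inord 1) 0
  + x (inord 2) 0 * y (inord 2) 0 + x (inord 3) 0 * y (inord 3) 0
  + x (inord 4) 0 * y (inord 4) 0 + x (inord 5) 0 * y (inord 5) 0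
  + x (inord 6) 0 * y (inord 6) 0 + x (inord 7) 0 * y (inord 7) 0.
Proof. exact: sum_ord8. Qed.

Lemma dotDl x y z : dot (x + y) z = dot x z + dot y z.
Proof. by rewrite /dot -big_split; apply: eq_bigr => k _; rewrite mxE mulrDl. Qed.
Lemma dotDr x y z : dot z (x + y) = dot z x + dot z y.
Proof. by rewrite /dot -big_split; apply: eq_bigr => k _; rewrite mxE mulrDr. Qed.
Lemma dotZl (c : R) x z : dot (c *: x) z = c * dot x z.
Proof. by rewrite /dot mulr_sumr; apply: eq_bigr => k _; rewrite mxE mulrA. Qed.
Lemma dotZr (c : R) x z : dot z (c *: x) = c * dot z x.
Proof. by rewrite /dot mulr_sumr; apply: eq_bigr => k _; rewrite mxE mulrCA. Qed.

Lemma dot_eq0 x : dot x x = 0 -> x = 0.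
Proof.
move/eqP; rewrite psumr_eq0 => [/allP h|k _]; last by rewrite -expr2 sqr_ge0.
apply/matrixP => k j; rewrite ord1 mxE; have := h k (mem_index_enum k).
by rewrite -expr2 sqrf_eq0 => /eqP.
Qed.

(** The structures 1, I_1, I_2 and I_3 = I_1 I_2, numbered from 0 to 3. *)
Definition qunit (a : nat) v : pt R :=
  nth v [:: v; I1 R *m v; I2 R *m v; I1 R *m (I2 R *m v)] a.

Lemma qunitD a u v : qunit a (u + v) = qunit a u + qunit a v.
Proof. by rewrite /qunit; move: a => [|[|[|[|a]]]] /=; rewrite ?nth_nil ?mulmxDr. Qed.
Lemma qunitZ a (c : R) v : qunit a (c *: v) = c *: qunit a v.
Proof. by rewrite /qunit; move: a => [|[|[|[|a]]]] /=; rewrite ?nth_nil -?scalemxAr. Qed.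

Lemma qunit_entry v (i : nat) : (i < 8)%N ->
  ((I1 R *m v) (inord i) 0 = I1_sign R i * v (inord (I1_index i)) 0) *
  ((I2 R *m v) (inord i) 0 = I2_sign R i * v (inord (I2_index i)) 0) *
  ((I1 R *m (I2 R *m v)) (inord i) 0 =
     I1_sign R i * (I2_sign R (I1_index i) * v (inord (I2_index (I1_index i))) 0)).
Proof.
move=> i8; rewrite !I1_mul // !I2_mul //.
by move: i i8; do 8!case=> //.
Qed.

Lemma dot_qunit_same (a : nat) u n : dot (qunit a u) (qunit a n) = dot u n.
Proof.
rewrite /qunit; move: a => [|[|[|[|a]]]] /=; rewrite ?nth_nil //;
  rewrite !dotE !qunit_entry // /I1_sign /I2_sign /=; ring.
Qed.

Lemma dot_qunit_self (a : nat) u : (0 < a < 4)%N -> dot u (qunit a u) = 0.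
Proof.
rewrite /qunit; move: a => [|[|[|[|a]]]] // _ /=;
  rewrite !dotE !qunit_entry // /I1_sign /I2_sign /=; ring.
Qed.

(** The product of two distinct units is, up to sign, one of the imaginary units. *)
Lemma dot_qunit_diff (a b : nat) : (a < 4)%N -> (b < 4)%N -> a != b ->
  exists c (s : R), (0 < c < 4)%N /\
    forall u n, dot (qunit a u) (qunit b n) = s * dot n (qunit c u).
Proof.
move=> a4 b4 ab; exists (nth 0%N (nth [::] [:: [:: 0; 1; 2; 3]; [:: 1; 0; 3; 2];
  [:: 2; 3; 0; 1]; [:: 3; 2; 1; 0]]%N a) b).
move: a b a4 b4 ab => [|[|[|[|a]]]] [|[|[|[|b]]]] // _ _ _ /=;
  (exists 1; split=> // u n; rewrite /qunit /= !dotE ?qunit_entry // /I1_sign /I2_sign /=; ring) ||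
  (exists (-1); split=> // u n; rewrite /qunit /= !dotE ?qunit_entry // /I1_sign /I2_sign /=; ring).
Qed.

Lemma qlin_qunit (a : nat) F u : qlin F -> F *m qunit a u = qunit a (F *m u).
Proof.
move=> [F1 F2]; rewrite /qunit; move: a => [|[|[|[|a]]]] /=; rewrite ?nth_nil //.
- by rewrite !mulmxA F1.
- by rewrite !mulmxA F2.
- by rewrite mulmxA F1 -mulmxA (mulmxA F) F2 -mulmxA.
Qed.

Lemma qunit0 (a : nat) : qunit a (0 : pt R) = 0.
Proof. by rewrite -{1}(scale0r 0) qunitZ scale0r. Qed.

(** The kernel of a quaternionic-linear map is a quaternionic subspace. With two
    nonzero orthogonal quaternionic lines u H and n H it contains an orthogonal
    basis of R^8, namely the multiples of u and n by the units. *)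
Lemma qlin_kernel F u n : qlin F -> u != 0 -> n != 0 ->
  F *m u = 0 -> F *m n = 0 ->
  (forall a, (a < 4)%N -> dot n (qunit a u) = 0) -> F = 0.
Proof.
move=> qF u0 n0 Fu Fn un.
pose k (j : 'I_8) := if (j < 4)%N then qunit j u else qunit (j - 4) n.
pose d (j : 'I_8) := if (j < 4)%N then dot u u else dot n n.
have d0 j : d j != 0.
  by rewrite /d; case: ifP => _; [apply: contra u0|apply: contra n0] => /eqP/dot_eq0 ->.
have dotC x y : dot x y = dot y x by apply: eq_bigr => m _; rewrite mulrC.
have self v (a b : nat) : (a < 4)%N -> (b < 4)%N ->
    dot (qunit a v) (qunit b v) = (a == b)%:R * dot v v.
  move=> a4 b4; have [->|ab] := eqVneq a b; first by rewrite dot_qunit_same mul1r.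
  by have [c [s [c4 ->]]] := dot_qunit_diff a4 b4 ab; rewrite dot_qunit_self // mulr0 mul0r.
have cross (a b : nat) : (a < 4)%N -> (b < 4)%N -> dot (qunit a u) (qunit b n) = 0.
  move=> a4 b4; have [->|ab] := eqVneq a b.
    by rewrite dot_qunit_same dotC (un 0%N).
  have [c [s [/andP[_ c4] ->]]] := dot_qunit_diff a4 b4 ab.
  by rewrite un // mulr0.
have sub4 (j : 'I_8) : (j - 4 < 4)%N by have := ltn_ord j; lia.
have kk i j : dot (k i) (k j) = (i == j)%:R * d i.
  rewrite /k /d -val_eqE /=; case: ifPn => i4; case: ifPn => j4.
  - by rewrite self.
  - by rewrite cross // (_ : (nat_of_ord i == nat_of_ord j) = false) ?mul0r //; lia.
  - rewrite dotC cross // (_ : (nat_of_ord i == nat_of_ord j) = false) ?mul0r //.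
    lia.
  - rewrite self // (_ : (i - 4 == j - 4)%N = (nat_of_ord i == nat_of_ord j)) //.
    lia.
pose K := \matrix_(i, j) k j i 0; pose L := \matrix_(i, j) ((d i)^-1 * k i j 0).
have LK : L *m K = 1%:M.
  apply/matrixP => i j; transitivity ((d i)^-1 * dot (k i) (k j)); last first.
    by rewrite kk mulrCA mulVf ?mulr1 // mxE.
  by rewrite mxE /dot mulr_sumr; apply: eq_bigr => m _; rewrite !mxE mulrA.
rewrite -[F]mulmx1 -(mulmx1C LK) mulmxA.
suff -> : F *m K = 0 by rewrite mul0mx.
apply/matrixP => i j; rewrite !mxE.
have : (F *m k j) i 0 = 0.
  by rewrite /k; case: ifP => _; rewrite qlin_qunit // ?Fu ?Fn qunit0 mxE.
by rewrite mxE => h; rewrite -[RHS]h; apply: eq_bigr => m _; rewrite mxE.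
Qed.

(** The diagonal value tri M r r r is |r|^2 times the component of M r orthogonal
    to the quaternionic line of r. It is polarized to a trilinear map, so that it is
    a cubic polynomial along each line. *)
Definition tri M x y z : pt R :=
  dot x y *: (M *m z) - \sum_(a < 4) dot (M *m x) (qunit a y) *: qunit a z.

Lemma tri_orth M r (a : nat) : (a < 4)%N -> dot (tri M r r r) (qunit a r) = 0.
Proof.
move=> a4; rewrite /tri -scaleN1r dotDl !dotZl.
have -> : dot (\sum_(b < 4) dot (M *m r) (qunit b r) *: qunit b r) (qunit a r) =
    \sum_(b < 4) dot (M *m r) (qunit b r) * dot (qunit b r) (qunit a r).
  by elim/big_rec2: _ => [|b x y _ <-]; [rewrite -(scale0r 0) dotZl mul0r|rewrite dotDl dotZl].
rewrite (bigD1 (Ordinal a4)) //= dot_qunit_same big1 ?addr0; first by ring.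
move=> b ba; have [c [s [c4 ->]]] := dot_qunit_diff (ltn_ord b) a4 ba.
by rewrite dot_qunit_self ?mulr0.
Qed.

Lemma triZ M (c : R) r : tri M (c *: r) (c *: r) (c *: r) = c ^+ 3 *: tri M r r r.
Proof.
rewrite /tri scalerBr scaler_sumr -!scalemxAr !dotZl !dotZr !scalerA.
congr (_ *: _ - _); first by ring.
by apply: eq_bigr => a _; rewrite !qunitZ dotZl dotZr !scalerA; congr (_ *: _); ring.
Qed.

Lemma tri_line M r v : exists x0 x1 x2 : pt R, forall t : R,
  tri M (r + t *: v) (r + t *: v) (r + t *: v) =
  x0 + t *: x1 + t ^+ 2 *: x2 + t ^+ 3 *: tri M v v v.
Proof.
exists (tri M r r r), (tri M r r v + tri M r v r + tri M v r r),
  (tri M r v v + tri M v r v + tri M v v r) => t.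
have triDl x x' y z : tri M (x + x') y z = tri M x y z + tri M x' y z.
  rewrite /tri dotDl scalerDl addrACA -opprD -big_split; congr (_ - _).
  by apply: eq_bigr => a _; rewrite mulmxDr dotDl scalerDl.
have triDm x y y' z : tri M x (y + y') z = tri M x y z + tri M x y' z.
  rewrite /tri dotDr scalerDl addrACA -opprD -big_split; congr (_ - _).
  by apply: eq_bigr => a _; rewrite qunitD dotDr scalerDl.
have triDr x y z z' : tri M x y (z + z') = tri M x y z + tri M x y z'.
  rewrite /tri mulmxDr scalerDr addrACA -opprD -big_split; congr (_ - _).
  by apply: eq_bigr => a _; rewrite qunitD scalerDr.
have triZl c x y z : tri M (c *: x) y z = c *: tri M x y z.
  rewrite /tri dotZl -scalerA scalerBr scaler_sumr; congr (_ - _).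
  by apply: eq_bigr => a _; rewrite -scalemxAr dotZl scalerA.
have triZm c x y z : tri M x (c *: y) z = c *: tri M x y z.
  rewrite /tri dotZr -scalerA scalerBr scaler_sumr; congr (_ - _).
  by apply: eq_bigr => a _; rewrite qunitZ dotZr scalerA.
have triZr c x y z : tri M x y (c *: z) = c *: tri M x y z.
  rewrite /tri -scalemxAr scalerBr scaler_sumr !scalerA mulrC; congr (_ - _).
  by apply: eq_bigr => a _; rewrite qunitZ !scalerA mulrC.
rewrite !(triDl, triDm, triDr) !(triZl, triZm, triZr).
by apply/matrixP => i j; rewrite !mxE; ring.
Qed.

(** A cubic polynomial that vanishes near 0 has zero leading coefficient; on the
    line r + t v this coefficient is tri M v v v. *)
Lemma tri_eq0_near M r v (e : R) : 0 < e ->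
  (forall t, `|t| < e -> tri M (r + t *: v) (r + t *: v) (r + t *: v) = 0) ->
  tri M v v v = 0.
Proof.
move=> e0 h; have [x0 [x1 [x2 hx]]] := tri_line M r v.
apply/matrixP => i j; rewrite ord1 [RHS]mxE.
have E t : `|t| < e -> x0 i 0 + t * x1 i 0 + t ^+ 2 * x2 i 0
    + t ^+ 3 * tri M v v v i 0 = 0.
  by move=> /h; rewrite hx => /matrixP/(_ i 0); rewrite !mxE.
(* The values at s, - s, s / 2 and - s / 2 determine the cubic coefficient. *)
pose s := e / 2.
have s0 : 0 < s by rewrite divr_gt0.
have es : s < e by rewrite /s; lra.
have e1 : `|s| < e by rewrite gtr0_norm.
have e2 : `|- s| < e by rewrite normrN.
have e3 : `|s / 2| < e by rewrite gtr0_norm; lra.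
have e4 : `|- (s / 2)| < e by rewrite normrN.
have E1 := E _ e1; have E2 := E _ e2; have E3 := E _ e3; have E4 := E _ e4.
have : s ^+ 3 * tri M v v v i 0 = 0 by nra.
by move/eqP; rewrite mulf_eq0 expf_eq0 /= gt_eqF //= => /eqP.
Qed.

End QuaternionicLines.

Section Coordinates.
Variable R : realType.
Implicit Types (u v n r x y : pt R) (B M F : 'M[R]_8) (c : nat -> R).

(** Coordinates on W + W I_1 + W I_2. They are numbered from 0 to 14. *)
Definition W012_mx c : 'M[R]_8 :=
  wmx (c 0%N) (c 1%N) (c 2%N) (c 3%N) (c 4%N)
  + wmx (c 5%N) (c 6%N) (c 7%N) (c 8%N) (c 9%N) *m I1 R
  + wmx (c 10%N) (c 11%N) (c 12%N) (c 13%N) (c 14%N) *m I2 R.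

Lemma wmx_linear (a z0 z1 z2 z3 a' z0' z1' z2' z3' s : R) :
  wmx (s * a + a') (s * z0 + z0') (s * z1 + z1') (s * z2 + z2') (s * z3 + z3') =
  s *: wmx a z0 z1 z2 z3 + wmx a' z0' z1' z2' z3'.
Proof.
apply/matrixP => i j; move: i j; apply: forall_ord8 => i i8.
apply: forall_ord8 => j j8; have lin (A B : 'M[R]_8) p q : (s *: A + B) p q = s * A p q + B p q.
  by rewrite !mxE.
rewrite lin !wmxE //.
move: i i8 => [|[|[|[|[|[|[|[|i]]]]]]]] // _;
  by move: j j8 => [|[|[|[|[|[|[|[|j]]]]]]]] // _; rewrite /=; ring.
Qed.

Lemma W012_mx_linear (s : R) c c' :
  W012_mx (fun k => s * c k + c' k) = s *: W012_mx c + W012_mx c'.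
Proof.
rewrite /W012_mx !wmx_linear !mulmxDl -!scalemxAl.
by rewrite [X in X + _ = _]addrACA [LHS]addrACA !scalerDr.
Qed.

Lemma W012P M : W012 R M <-> exists c, M = W012_mx c.
Proof.
split=> [[w0 [w1 [w2 [[a [[[[z0 z1] z2] z3] ->]]]]]]|[c ->]].
  move=> [b [[[[y0 y1] y2] y3] ->]] [d [[[[x0 x1] x2] x3] ->]] ->.
  by exists (nth 0 [:: a; z0; z1; z2; z3; b; y0; y1; y2; y3; d; x0; x1; x2; x3]).
do 3 eexists; split; last reflexivity.
- by exists (c 0%N), (c 1%N, c 2%N, c 3%N, c 4%N).
- by exists (c 5%N), (c 6%N, c 7%N, c 8%N, c 9%N).
- by exists (c 10%N), (c 11%N, c 12%N, c 13%N, c 14%N).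
Qed.

Lemma W012_mxE c i j : (i < 8)%N -> (j < 8)%N -> W012_mx c (inord i) (inord j) =
  nth 0 (nth [::] (wtab (c 0%N) (c 1%N) (c 2%N) (c 3%N) (c 4%N)) i) j
  - I1_sign R j * nth 0 (nth [::] (wtab (c 5%N) (c 6%N) (c 7%N) (c 8%N) (c 9%N)) i) (I1_index j)
  - I2_sign R j * nth 0 (nth [::] (wtab (c 10%N) (c 11%N) (c 12%N) (c 13%N) (c 14%N)) i) (I2_index j).
Proof.
move=> i8 j8.
have add3 (A B D : 'M[R]_8) p q : (A + B + D) p q = A p q + B p q + D p q.
  by rewrite !mxE.
rewrite /W012_mx add3 mul_I1 // mul_I2 // !mulNr.
by rewrite !wmxE //; move: j j8; do 8!case=> //.
Qed.

Definition vec (s : seq R) : pt R := \col_k s`_k.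

Lemma vecE s i : (i < 8)%N -> vec s (inord i) 0 = s`_i.
Proof. by move=> i8; rewrite mxE inordK. Qed.

(** A matrix of W + W I_1 + W I_2 that preserves every quaternionic line is zero.
    Lines through basis vectors of the first factor show that the block from the
    first to the second factor vanishes, and the line through (1, 1) then equates the
    two components of its image; in coordinates these are enough linear equations. *)
Lemma tri_eq0_W012 c : (forall v, tri (W012_mx c) v v v = 0) ->
  forall k, (k < 15)%N -> c k = 0.
Proof.
move=> h.
have hE s k : (k < 8)%N ->
   dot (vec s) (vec s) * (W012_mx c *m vec s) (inord k) 0
   - (dot (W012_mx c *m vec s) (vec s) * vec s (inord k) 0
   + dot (W012_mx c *m vec s) (I1 R *m vec s) * (I1 R *m vec s) (inord k) 0
   + dot (W012_mx c *m vec s) (I2 R *m vec s) * (I2 R *m vec s) (inord k) 0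
   + dot (W012_mx c *m vec s) (I1 R *m (I2 R *m vec s)) * (I1 R *m (I2 R *m vec s)) (inord k) 0) = 0.
  move=> k8; have /matrixP/(_ (inord k) 0) := h (vec s).
  have lin (a : R) (X S : pt R) p : (a *: X - S) p 0 = a * X p 0 - S p 0.
    by rewrite !mxE.
  have sc (a : R) (X : pt R) p : (a *: X) p 0 = a * X p 0 by rewrite mxE.
  have z0 p : (0 : pt R) p 0 = 0 by rewrite mxE.
  by rewrite /tri lin summxE z0 !big_ord_recr big_ord0 /= add0r !sc.
have mE s k : (W012_mx c *m vec s) (inord k) 0 =
  W012_mx c (inord k) (inord 0) * s`_0 + W012_mx c (inord k) (inord 1) * s`_1
  + W012_mx c (inord k) (inord 2) * s`_2 + W012_mx c (inord k) (inord 3) * s`_3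
  + W012_mx c (inord k) (inord 4) * s`_4 + W012_mx c (inord k) (inord 5) * s`_5
  + W012_mx c (inord k) (inord 6) * s`_6 + W012_mx c (inord k) (inord 7) * s`_7.
  by rewrite mxE sum_ord8 !vecE.
have low j k : (j < 4)%N -> (3 < k < 8)%N -> (W012_mx c *m vec (ncons j 0 [:: 1])) (inord k) 0 = 0.
  move=> j4 /andP[k3 k8]; have := hE (ncons j 0 [:: 1]) k k8.
  move: (W012_mx c *m _) => m.
  move: k k3 k8 => [|[|[|[|[|[|[|[|k]]]]]]]] // _ _;
  move: j j4 => [|[|[|[|j]]]] // _;
  by rewrite !dotE !qunit_entry // !vecE // /I1_sign /I2_sign /=; lra.
have diag k : (k < 4)%N ->
    (W012_mx c *m vec [:: 1; 0; 0; 0; 1]) (inord k) 0 =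
    (W012_mx c *m vec [:: 1; 0; 0; 0; 1]) (inord (k + 4)) 0.
  move=> k4; have := hE [:: 1; 0; 0; 0; 1] k (ltn_trans k4 (isT : (4 < 8)%N)).
  move: (W012_mx c *m _) => m.
  move: k k4 => [|[|[|[|k]]]] // _;
  by rewrite !dotE !qunit_entry // !vecE // /I1_sign /I2_sign /=; lra.
have q1 j k : (j < 4)%N -> (3 < k < 8)%N -> W012_mx c (inord k) (inord j) = 0.
  move=> j4 k8; have := low j k j4 k8; rewrite mE.
  by move: j j4 => [|[|[|[|j]]]] // _; rewrite /= !mulr0 ?add0r ?addr0 mulr1.
have q2 k : (k < 4)%N ->
    W012_mx c (inord k) (inord 0) + W012_mx c (inord k) (inord 4) =
    W012_mx c (inord (k + 4)) (inord 0) + W012_mx c (inord (k + 4)) (inord 4).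
  by move=> k4; have := diag k k4; rewrite !mE /= !mulr0 !addr0 !mulr1.
clear low diag h hE mE.
have e0 := q2 0%N isT; have e1 := q2 1%N isT.
have e2 := q2 2%N isT; have e3 := q2 3%N isT.
have f0 := q1 0%N 4%N isT isT; have f1 := q1 0%N 5%N isT isT.
have f2 := q1 0%N 6%N isT isT; have f3 := q1 0%N 7%N isT isT.
have g0 := q1 1%N 4%N isT isT; have g1 := q1 1%N 5%N isT isT.
have g2 := q1 1%N 6%N isT isT; have g3 := q1 1%N 7%N isT isT.
have h0 := q1 2%N 4%N isT isT; have h1 := q1 2%N 5%N isT isT.
have h2 := q1 2%N 6%N isT isT; have h3 := q1 2%N 7%N isT isT.
rewrite !W012_mxE // /I1_sign /I2_sign /= in e0 e1 e2 e3.
rewrite !W012_mxE // /I1_sign /I2_sign /= in f0 f1 f2 f3 g0 g1 g2 g3 h0 h1 h2 h3.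
clear q1 q2.
case=> [|[|[|[|[|[|[|[|[|[|[|[|[|[|[|k]]]]]]]]]]]]]]] // _; lra.
Qed.
End Coordinates.

(** * Smooth functions on R^8 *)

Local Open Scope classical_set_scope.
Local Open Scope ring_scope.

Section MeanValue.
Variable R : realType.
Implicit Types (f : pt R -> R^o) (x y : pt R) (k i j : 'I_8).

Local Notation e_ k := (delta_mx k 0 : pt R).

Lemma is_derive_line f y k (s : R) : derivable f (y + s *: e_ k) (e_ k) ->
  is_derive s (1 : R) (fun s : R => f (y + s *: e_ k)) (pd k f (y + s *: e_ k)).
Proof.
move=> df.
have E : (fun h : R => h^-1 *: (((fun s : R => f (y + s *: e_ k)) \o shift s) (h *: 1) -
             f (y + s *: e_ k))) =
         (fun h : R => h^-1 *: ((f \o shift (y + s *: e_ k)) (h *: e_ k) - f (y + s *: e_ k))).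
  apply/funext => h /=; congr (_ *: (f _ - _)).
  by rewrite [h *: 1]mulr1 scalerDl addrCA.
split; first by rewrite /derivable E.
by rewrite /derive E.
Qed.

Lemma MVT_pd f y k (t : R) :
  (forall s : R, `|s| <= `|t| -> derivable f (y + s *: e_ k) (e_ k)) ->
  exists2 s : R, `|s| <= `|t| &
    f (y + t *: e_ k) - f y = t * pd k f (y + s *: e_ k).
Proof.
move=> df; have id s (hs : `|s| <= `|t|) := is_derive_line (df s hs).
have cont a b : (forall s : R, s \in `[a, b]%R -> `|s| <= `|t|) ->
    {within `[a, b], continuous (fun s : R => f (y + s *: e_ k))}.
  move=> h; apply: derivable_within_continuous => s /h /id ds.
  exact: ex_derive.
have [t0|t0|->] := ltgtP t 0; last first.
- by exists 0; rewrite ?normr0 // scale0r !addr0 subrr mul0r.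
- have h s : s \in `[0, t]%R -> `|s| <= `|t|.
    by rewrite in_itv /= => /andP[s0 st]; rewrite !ger0_norm // ltW.
  have [c ct] := @MVT R _ (fun s => pd k f (y + s *: e_ k)) _ _ t0
    (fun s hs => id s (h s (subset_itv_oo_cc hs))) (cont _ _ h).
  rewrite scale0r addr0 subr0 mulrC => ->; exists c => //.
  exact/h/subset_itv_oo_cc.
- have h s : s \in `[t, 0]%R -> `|s| <= `|t|.
    by rewrite in_itv /= => /andP[s0 st]; rewrite !ler0_norm ?lerN2 // ltW.
  have [c ct] := @MVT R _ (fun s => pd k f (y + s *: e_ k)) _ _ t0
    (fun s hs => id s (h s (subset_itv_oo_cc hs))) (cont _ _ h).
  rewrite scale0r addr0 sub0r => E; exists c; first exact/h/subset_itv_oo_cc.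
  by rewrite -opprB E; rewrite mulrN opprK mulrC.
Qed.

Lemma ball_coord x y (e : R) :
  0 < e -> ball x e y <-> forall k, `|x k 0 - y k 0| < e.
Proof.
move=> e0; split=> [[_ h] k|h]; first exact: h.
by split=> // k j; rewrite ord1; exact: h.
Qed.

Lemma half_close (e a b c : R) :
  `|a - c| < e / 2 -> `|b - c| < e / 2 -> `|a - b| <= e.
Proof.
move=> ac bc; rewrite (_ : a - b = (a - c) - (b - c)); last first.
  by rewrite opprB addrA subrK.
by rewrite (le_trans (ler_normB _ _)) // [leRHS](splitr e) lerD // ltW.
Qed.

(** Schwarz: by two applications of the mean value theorem, the second difference
    quotient of f in the directions i and j is a value of either mixed derivative at
    a nearby point. The Bianchi identity rests on this. *)
Lemma pdC f x i j :
  (\forall y \near x, (forall k, derivable f y (e_ k)) /\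
     forall k l, derivable (pd k f) y (e_ l)) ->
  (forall k l, {for x, continuous (pd k (pd l f))}) ->
  pd i (pd j f) x = pd j (pd i f) x.
Proof.
move=> /nbhs_ballP[r /= r0 hr] cf.
have [->//|ij] := eqVneq i j.
(* Both derivatives are e / 2 close to the same second difference quotient. *)
apply/eqP; rewrite -subr_eq0 -normr_le0; apply/ler_addgt0Pr => e e0; rewrite add0r.
have e20 : 0 < e / 2 by rewrite divr_gt0.
have near1 k l : exists2 d : R, 0 < d & forall y, ball x d y ->
    `|pd k (pd l f) x - pd k (pd l f) y| < e / 2.
  have /cvgrPdist_lt /(_ _ e20) /nbhs_ballP[d /= d0 hd] := cf k l.
  by exists d.
have [d1 d10 hd1] := near1 i j; have [d2 d20 hd2] := near1 j i.
pose t := Num.min r (Num.min d1 d2) / 2.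
have m0 : 0 < Num.min r (Num.min d1 d2) by rewrite !lt_min r0 d10 d20.
have t0 : 0 < t by rewrite divr_gt0.
have tm : t < Num.min r (Num.min d1 d2) by rewrite /t; lra.
have [tr td1 td2] : [/\ t < r, t < d1 & t < d2].
  by move: tm; rewrite !lt_min => /and3P[].
have pt_ball (k l : 'I_8) d (a b : R) : k != l -> t < d -> `|a| <= t -> `|b| <= t ->
    ball x d (x + a *: e_ k + b *: e_ l).
  move=> kl td at_ bt; apply/ball_coord => [|p]; first exact: lt_trans td.
   rewrite !mxE eqxx andbT.
  apply: le_lt_trans td; rewrite addrAC !opprD addrA [in X in `|X|]addrA.
  have [->|pk] := eqVneq p k.
    rewrite (negPf kl) mulr1 mulr0 subr0.
    by rewrite (_ : _ - _ = - a) ?normrN //; lra.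
  rewrite mulr0; have [pl|_] := eqVneq p l.
    by rewrite mulr1 (_ : _ - _ = - b) ?normrN //; lra.
  by rewrite mulr0 (_ : _ - _ = 0) ?normr0 ?ltW //; lra.
have second (k l : 'I_8) : k != l -> exists2 z, (forall d, t < d -> ball x d z) &
    f (x + t *: e_ k + t *: e_ l) - f (x + t *: e_ k) - f (x + t *: e_ l) + f x
    = t * (t * pd l (pd k f) z).
  move=> kl.
  pose g y := f (y + t *: e_ l) - f y.
  have tt : `|t| = t by rewrite gtr0_norm.
  have tle : `|t| <= t by rewrite tt.
  have dshift y v : derivable f (y + t *: e_ l) v ->
      is_derive y v (fun y => f (y + t *: e_ l)) ('D_v f (y + t *: e_ l)).
    move=> dfy.
    have E : (fun h : R => h^-1 *: (((fun y => f (y + t *: e_ l)) \o shift y) (h *: v) -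
             f (y + t *: e_ l))) =
         (fun h : R => h^-1 *: ((f \o shift (y + t *: e_ l)) (h *: v) - f (y + t *: e_ l))).
      by apply/funext => h /=; rewrite addrA.
    by split; [rewrite /derivable E|rewrite /derive E].
  have dg (s : R) : `|s| <= `|t| -> is_derive (x + s *: e_ k) (e_ k) g
      (pd k f (x + s *: e_ k + t *: e_ l) - pd k f (x + s *: e_ k)).
    rewrite tt => st.
    have [h1 _] := hr _ (pt_ball _ _ _ s t kl tr st tle).
    have := pt_ball _ _ _ s 0 kl tr st; rewrite normr0 => /(_ (ltW t0)).
    rewrite scale0r addr0 => /hr[h2 _].
    apply: is_deriveB; first exact: dshift.
    exact: derivableP.
  have [s st E] := @MVT_pd g x k t (fun s hs => @ex_derive _ _ _ _ _ _ _ (dg s hs)).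
  have {E} : f (x + t *: e_ k + t *: e_ l) - f (x + t *: e_ k) -
      (f (x + t *: e_ l) - f x) =
      t * (pd k f (x + s *: e_ k + t *: e_ l) - pd k f (x + s *: e_ k)).
    rewrite -[pd k f _ - _](@derive_val _ _ _ _ _ _ _ (dg s st)); exact: E.
  have dkl (s' : R) : `|s'| <= `|t| ->
      derivable (pd k f) (x + s *: e_ k + s' *: e_ l) (e_ l).
    rewrite tt => st'; rewrite tt in st.
    by have [_ h2] := hr _ (pt_ball _ _ _ s s' kl tr st st'); exact: h2.
  have [s' st' ->] := MVT_pd dkl => E.
  rewrite tt in st st'; exists (x + s *: e_ k + s' *: e_ l).
    by move=> d td; exact: pt_ball.
  by rewrite -E opprB addrA addrAC.
have [z1 hz1 E1] := second _ _ ij.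
have ji : j != i by rewrite eq_sym.
have [z2 hz2 E2] := second _ _ ji.
have zE : pd j (pd i f) z1 = pd i (pd j f) z2.
  have : t * (t * pd j (pd i f) z1) = t * (t * pd i (pd j f) z2).
    have C : x + t *: e_ i + t *: e_ j = x + t *: e_ j + t *: e_ i.
      exact: addrAC.
    apply: (etrans (esym E1)); apply: (etrans _ E2).
    by rewrite C; congr (_ + f x); exact: addrAC.
  have tn0 : t != 0 by rewrite gt_eqF.
  by move=> /(mulfI tn0)/(mulfI tn0).
have b1 := hd1 _ (hz2 _ td1); have b2 := hd2 _ (hz1 _ td2).
rewrite zE in b2.
exact: half_close b1 b2.
Qed.
End MeanValue.

Lemma differentiable_criterion (R : realType) (V W : normedModType R)
    (f : V -> W) (L : {linear V -> W}) (x : V) :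
  continuous L ->
  (forall e : R, 0 < e ->
     \forall h \near (0 : V), `|f (h + x) - f x - L h| <= e * `|h|) ->
  differentiable f x /\ 'd f x = L :> (V -> W).
Proof.
move=> cL h.
have E : f \o shift x = cst (f x) + L +o_ 0 id.
  apply/eqaddoP => e e0; near=> z.
  rewrite /= -![(_ + _ : _ -> _) _]/(_ + _) -![(- _ : _ -> _) _]/(- _) /=.
  rewrite -![(_ + _ : _ -> _) _]/(_ + _) [cst _ z]/= opprD addrA.
  near: z; exact: h.
have dE := diff_unique cL E.
by split=> //; apply/diff_locallyP; rewrite dE.
Unshelve. all: by end_near. Qed.

Section Differentiable.
Variable R : realType.
Implicit Types (f : pt R -> R^o) (x y : pt R) (k i j : 'I_8).

Local Notation e_ k := (delta_mx k 0 : pt R).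

Definition grad_at f x (v : pt R) : R^o := \sum_k v k 0 * pd k f x.

Lemma grad_at_linear f x : linear (grad_at f x).
Proof.
move=> c u v; rewrite /grad_at scaler_sumr -big_split; apply: eq_bigr => k _.
by rewrite !mxE mulrDl /GRing.scale /= mulrA.
Qed.
HB.instance Definition _ f x :=
  GRing.isLinear.Build R (pt R) R^o *:%R (grad_at f x) (grad_at_linear f x).

Lemma norm_coord (v : pt R) k : `|v k 0| <= `|v|.
Proof.
by rewrite [leRHS]/Num.Def.normr /= mx_normrE; exact: (le_bigmax _ _ (k, 0)).
Qed.

Lemma grad_at_continuous f x : continuous (grad_at f x).
Proof.
apply: (@continuous_big R^o _ +%R 0 xpredT add_continuous) => k _ v.
exact: (@cvgMr_tmp R _ (nbhs v) (nbhs_filter v) _ _ (pd k f x) (@coord_continuous R 8 1 k 0 v)).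
Qed.

(** The first n coordinates of h: the points x + below h n go from x to x + h
    parallel to the axes. *)
Definition below (h : pt R) (n : nat) : pt R :=
  \col_k (if (k < n)%N then h k 0 else 0).

Lemma below0 h : below h 0 = 0.
Proof. by apply/matrixP => k j; rewrite !mxE. Qed.

Lemma below8 h : below h 8 = h.
Proof. by apply/matrixP => k j; rewrite !mxE ltn_ord ord1. Qed.

Lemma belowS h k : below h k.+1 = below h k + h k 0 *: e_ k.
Proof.
apply/matrixP => l j; rewrite ord1 !mxE eqxx andbT ltnS leq_eqVlt.
have [->|lk] := eqVneq l k; first by rewrite eqxx ltnn mulr1 add0r.
by rewrite (negPf (_ : val l != val k)) //= mulr0 addr0.
Qed.

(** Going from x to x + h along the axes, the mean value theorem applies to each
    step. The chain rule needs differentiability, whereas smoothness is expressed by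
    partial derivatives only. *)
Lemma continuous_pd_differentiable f x :
  (\forall y \near x, forall k, derivable f y (e_ k)) ->
  (forall k, {for x, continuous (pd k f)}) ->
  differentiable f x /\ forall v, 'D_v f x = grad_at f x v.
Proof.
move=> /nbhs_ballP[r /= r0 hr] cf.
have [//||df dE] := @differentiable_criterion R (pt R) R^o f (grad_at f x) x.
- exact: grad_at_continuous.
- move=> e e0.
  have e80 : 0 < e / 8 by rewrite divr_gt0.
  have near_d : \forall y \near x, forall k, `|pd k f x - pd k f y| <= e / 8.
    apply: (@filter_forall _ _ _ _ (nbhs_filter x)) => k.
    by have /cvgrPdist_le /(_ _ e80) := cf k.
  have /nbhs_ballP[d /= d0 hd] := near_d.
  have m0 : 0 < Num.min r d by rewrite lt_min r0 d0.
  have nh : \forall h \near (0 : pt R), `|h| < Num.min r d by exact: nbhs0_lt.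
  near=> h.
  have hN : `|h| < Num.min r d.
    by near: h; exact: nh.
  have [hr' hd'] : `|h| < r /\ `|h| < d by move: hN; rewrite lt_min => /andP[].
  have in_ball b (k : 'I_8) (s : R) : `|h| < b -> `|s| <= `|h k 0| ->
      ball x b (x + below h k + s *: e_ k).
    move=> hb sk; have b0 : 0 < b by apply: le_lt_trans hb.
    apply/ball_coord => // l; rewrite !mxE eqxx andbT.
    apply: le_lt_trans hb; rewrite -addrA opprD addNKr normrN.
    have [->|lk] := eqVneq l k.
      by rewrite ltnn add0r mulr1 (le_trans sk) // norm_coord.
    by rewrite mulr0 addr0; case: ifP; rewrite ?normr0 // norm_coord.
  have step k : exists2 z, ball x d z &
      f (x + below h k.+1) - f (x + below h k) = h k 0 * pd k f z.
    have dk (s : R) : `|s| <= `|h k 0| -> derivable f (x + below h k + s *: e_ k) (e_ k).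
      by move=> sk; apply: hr; exact: in_ball.
    have [s sk Es] := MVT_pd dk.
    by exists (x + below h k + s *: e_ k); [exact: in_ball|rewrite belowS addrA].
  have tel : f (h + x) - f x = \sum_(k < 8) (f (x + below h k.+1) - f (x + below h k)).
    rewrite -(big_mkord xpredT (fun k : nat => f (x + below h k.+1) - f (x + below h k))).
    by rewrite (telescope_sumr (fun k : nat => f (x + below h k)) (leq0n 8)) below0 below8 addr0 [h + x]addrC.
  rewrite tel /grad_at -sumrB.
  apply: le_trans (ler_norm_sum _ _ _) _.
  have -> : e * `|h| = \sum_(k < 8) (e / 8 * `|h|).
    by rewrite sumr_const card_ord -mulr_natr /=; field.
  apply: ler_sum => k _; have [z zd ->] := step k.
  rewrite -mulrBr normrM mulrC ler_pM // ?norm_coord // distrC.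
  exact: hd.
by split=> // v; rewrite deriveE // dE.
Unshelve. all: by end_near. Qed.
End Differentiable.

Section Smooth.
Variable R : realType.
Implicit Types (x y : pt R) (k i j : 'I_8) (U : set (pt R)).

Local Notation e_ k := (delta_mx k 0 : pt R).

Definition c1_at (V : normedModType R) (f : pt R -> V) x : Prop :=
  {for x, continuous f} /\ forall k, derivable f x (e_ k).

(** The iterated partial derivatives of order at most n are continuous and have
    partial derivatives. The recursion takes the innermost derivative first, which
    suits induction on sums, products and compositions better than lists of
    derivatives. *)
Fixpoint smooth_upto (V : normedModType R) (n : nat) U (f : pt R -> V) : Prop :=
  (forall x, U x -> c1_at f x) /\
  if n is p.+1 then forall k, smooth_upto p U (pd k f) else True.

Lemma iter_pd_rcons (V : normedModType R) s k (f : pt R -> V) :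
  iter_pd (rcons s k) f = iter_pd s (pd k f).
Proof. by elim: s => //= l s ->. Qed.

Lemma smooth_onP (V : normedModType R) U (f : pt R -> V) :
  smooth_on U f <-> forall n, smooth_upto n U f.
Proof.
split=> [sf n|sf s x Ux].
  have : forall s x, U x -> c1_at (iter_pd s f) x by move=> s x /(sf s).
  elim: n f {sf} => [|n IH] f sf /=; first by split=> // x; exact: (sf [::]).
  split=> [x|k]; first exact: (sf [::]).
  by apply: IH => s x Ux; rewrite -iter_pd_rcons; exact: sf.
elim/last_ind: s f sf => [|s k IH] f sf.
  by have [h _] := sf 0%N; exact: h.
rewrite iter_pd_rcons; apply: IH => n.
by have [_] := sf n.+1; exact.
Qed.

Lemma smooth_on_pd (V : normedModType R) U (f : pt R -> V) k :
  smooth_on U f -> smooth_on U (pd k f).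
Proof.
by move=> /smooth_onP sf; apply/smooth_onP => n; have [_] := sf n.+1; exact.
Qed.

Lemma smooth_uptoW (V : normedModType R) n U (f : pt R -> V) :
  smooth_upto n.+1 U f -> smooth_upto n U f.
Proof.
elim: n f => [|n IH] f [h hk]; first by [].
by split=> // k; apply: IH; exact: hk.
Qed.

Lemma smooth_uptoS (V : normedModType R) n U U' (f : pt R -> V) :
  U' `<=` U -> smooth_upto n U f -> smooth_upto n U' f.
Proof.
move=> UU; elim: n f => [|n IH] f [h hk]; first by split=> // x /UU /h.
by split=> [x /UU /h //|k]; apply: IH; exact: hk.
Qed.

Lemma near_open U x : open U -> U x -> \forall y \near x, U y.
Proof. by move=> oU Ux; exact: open_nbhs_nbhs. Qed.

Lemma pd_ext (V : normedModType R) U (f g : pt R -> V) k x : open U -> U x ->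
  (forall y, U y -> f y = g y) -> pd k f x = pd k g x.
Proof.
move=> oU Ux fg; apply: near_eq_derive.
by apply: filterS (near_open oU Ux) => y /fg.
Qed.

Lemma derivable_ext (V : normedModType R) U (f g : pt R -> V) x v : open U -> U x ->
  (forall y, U y -> f y = g y) -> derivable f x v -> derivable g x v.
Proof.
move=> oU Ux fg; apply: near_eq_derivable.
by apply: filterS (near_open oU Ux) => y /fg.
Qed.

Lemma c1_at_ext (V : normedModType R) U (f g : pt R -> V) x : open U -> U x ->
  (forall y, U y -> f y = g y) -> c1_at f x -> c1_at g x.
Proof.
move=> oU Ux fg [cf df]; split=> [|k]; last exact: derivable_ext fg (df k).
suff h : g @ x --> f x by move: h; rewrite (fg x Ux).
have e : {near nbhs x, f =1 g} by apply: filterS (near_open oU Ux) => y /fg.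
exact: (cvg_trans (near_eq_cvg e) cf).
Qed.

Lemma smooth_upto_ext (V : normedModType R) n U (f g : pt R -> V) : open U ->
  (forall y, U y -> f y = g y) -> smooth_upto n U f -> smooth_upto n U g.
Proof.
move=> oU; elim: n f g => [|n IH] f g fg [h hk].
  by split=> // x Ux; exact: (c1_at_ext oU Ux fg (h x Ux)).
split=> [x Ux|k]; first exact: (c1_at_ext oU Ux fg (h x Ux)).
by apply: IH (hk k) => y Uy; exact: (pd_ext k oU Uy fg).
Qed.

Lemma smooth_upto_cst (V : normedModType R) n U (a : V) :
  smooth_upto n U (fun _ : pt R => a).
Proof.
elim: n a => [|n IH] a.
  by split=> // x _; split=> [|k]; [exact: cst_continuous|exact: derivable_cst].
split=> [x _|k].
- by split=> [|k]; [exact: cst_continuous|exact: derivable_cst].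
- suff -> : pd k (fun _ : pt R => a) = (fun _ => 0) by exact: IH.
  by apply/funext => x; rewrite /pd derive_cst.
Qed.

Lemma smooth_uptoD (V : normedModType R) n U (f g : pt R -> V) : open U ->
  smooth_upto n U f -> smooth_upto n U g -> smooth_upto n U (fun x => f x + g x).
Proof.
move=> oU; elim: n f g => [|n IH] f g [hf kf] [hg kg].
  split=> // x Ux; have [cf df] := hf x Ux; have [cg dg] := hg x Ux.
  by split=> [|k]; [exact: (continuousD cf cg)|exact: derivableD].
split=> [x Ux|k].
  have [cf df] := hf x Ux; have [cg dg] := hg x Ux.
  by split=> [|k]; [exact: (continuousD cf cg)|exact: derivableD].
apply: (smooth_upto_ext (f := fun x => pd k f x + pd k g x)) => // [y Uy|].
  have [cf df] := hf y Uy; have [cg dg] := hg y Uy.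
  by rewrite /pd deriveD.
by apply: IH; [exact: kf|exact: kg].
Qed.

Lemma smooth_upto_sum (V : normedModType R) n U (I : Type) (s : seq I)
    (f : I -> pt R -> V) : open U ->
  (forall t, smooth_upto n U (f t)) -> smooth_upto n U (fun x => \sum_(t <- s) f t x).
Proof.
move=> oU hf; elim: s => [|a s IH].
  apply: (smooth_upto_ext (f := fun _ => 0)) => // [y _|]; first by rewrite big_nil.
  exact: smooth_upto_cst.
apply: (smooth_upto_ext (f := fun x => f a x + \sum_(t <- s) f t x)) => // [y _|].
  by rewrite big_cons.
exact: smooth_uptoD.
Qed.

Lemma pdM (f g : pt R -> R^o) x k : derivable f x (e_ k) -> derivable g x (e_ k) ->
  pd k (fun x => f x * g x : R^o) x = f x * pd k g x + pd k f x * g x.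
Proof.
move=> df dg; have := deriveM df dg; rewrite /GRing.scale /= => E.
by rewrite [pd k f x * _]mulrC; exact: E.
Qed.

Lemma smooth_uptoM n U (f g : pt R -> R^o) : open U ->
  smooth_upto n U f -> smooth_upto n U g -> smooth_upto n U (fun x => f x * g x : R^o).
Proof.
move=> oU; elim: n f g => [|n IH] f g sf sg.
  have [hf _] := sf; have [hg _] := sg.
  split; [move=> x Ux|by []]; have [cf df] := hf x Ux; have [cg dg] := hg x Ux.
  by split=> [|k]; [exact: (continuousM cf cg)|exact: derivableM].
have [hf kf] := sf; have [hg kg] := sg.
split=> [x Ux|k].
  have [cf df] := hf x Ux; have [cg dg] := hg x Ux.
  by split=> [|k]; [exact: (continuousM cf cg)|exact: derivableM].
apply: (smooth_upto_ext (f := fun x => f x * pd k g x + pd k f x * g x)) => // [y Uy|].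
  have [cf df] := hf y Uy; have [cg dg] := hg y Uy.
  by rewrite pdM.
exact: (smooth_uptoD oU (IH _ _ (smooth_uptoW sf) (kg k))
  (IH _ _ (kf k) (smooth_uptoW sg))).
Qed.

Lemma smooth_upto_differentiable n U (f : pt R -> R^o) x : open U -> U x ->
  smooth_upto n.+1 U f ->
  differentiable f x /\ forall v, 'D_v f x = grad_at f x v.
Proof.
move=> oU Ux [h hk]; apply: continuous_pd_differentiable.
  by apply: filterS (near_open oU Ux) => y /h[].
by move=> k; have := hk k; case: n hk => [|n] _ [/(_ x Ux)[]].
Qed.
End Smooth.

(** * The radial projection *)

Section ChainRule.
Variable R : realType.
Implicit Types (x y : pt R) (k i j : 'I_8) (U : set (pt R)).

Local Notation e_ k := (delta_mx k 0 : pt R).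

Lemma pd_comp (f : pt R -> R^o) (g : pt R -> pt R) x k :
  differentiable f (g x) -> (forall v, 'D_v f (g x) = grad_at f (g x) v) ->
  (forall j, differentiable (fun y => g y j 0 : R^o) x) ->
  differentiable (f \o g) x /\
  pd k (f \o g) x = \sum_j pd k (fun y => g y j 0 : R^o) x * pd j f (g x).
Proof.
move=> df gf dg.
have gE : g = \sum_(j < 8) (fun y => g y j 0 *: e_ j).
  apply/funext => y; rewrite fct_sumE [LHS]matrix_sum_delta.
  by apply: eq_bigr => j _; rewrite big_ord1.
have dgx : differentiable g x.
  by rewrite gE; apply: differentiable_sum => j; apply: differentiableZl; exact: dg.
split; first exact: differentiable_comp.
rewrite /pd deriveE; last exact: differentiable_comp.
rewrite diff_comp //= -[X in 'd f _ X]deriveE // -deriveE // gf /grad_at.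
apply: eq_bigr => j _; congr (_ * _).
rewrite derive_mx; last exact: diff_derivable.
by rewrite mxE.
Qed.

Lemma pd_comp_real (h : R -> R) (q : pt R -> R^o) x k (dh : R) :
  differentiable q x -> is_derive (q x : R) (1 : R) h dh ->
  differentiable (h \o q : pt R -> R^o) x /\
  pd k (h \o q : pt R -> R^o) x = pd k q x * dh.
Proof.
move=> dq [dh1 dhE].
have dhd : differentiable (h : R^o -> R^o) (q x) by apply/derivable1_diffP.
split; first exact: differentiable_comp.
rewrite /pd deriveE; last exact: differentiable_comp.
rewrite diff_comp //= -[X in 'd h _ X]deriveE //.
by rewrite (@deriv1E R R^o h (q x) dh1) derive1E dhE.
Qed.

Definition sqnorm (x : pt R) : R^o := \sum_k x k 0 ^+ 2.

Lemma pd_coord (k j : 'I_8) x : is_derive x (e_ k) (fun y : pt R => y j 0 : R^o) (j == k)%:R.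
Proof.
have L : linear (fun y : pt R => y j 0 : R^o).
  by move=> c u v; rewrite !mxE.
pose f : {linear pt R -> R^o} := HB.pack (fun y : pt R => y j 0 : R^o)
  (GRing.isLinear.Build R (pt R) R^o *:%R (fun y : pt R => y j 0 : R^o) L).
have df : differentiable f x by apply: linear_differentiable; exact: coord_continuous.
split; first exact: (diff_derivable (f := f)).
rewrite (deriveE _ df) diff_lin; last exact: coord_continuous.
by rewrite /f /= mxE eqxx andbT.
Qed.

Lemma smooth_upto_coord n U j : open U -> smooth_upto n U (fun y : pt R => y j 0 : R^o).
Proof.
move=> oU; have h U' : forall x, U' x -> c1_at (fun y : pt R => y j 0 : R^o) x.
  by move=> x _; split=> [|k]; [exact: coord_continuous|have [] := pd_coord k j x].
case: n => [|n]; first by split; [exact: h|].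
split; first exact: h.
move=> k; apply: (smooth_upto_ext (V := R^o) (f := fun _ => (j == k)%:R)) => //.
  by move=> y _; rewrite /pd (@derive_val _ _ _ _ _ _ _ (pd_coord k j y)).
exact: smooth_upto_cst.
Qed.

Lemma smooth_upto_sqnorm n U : open U -> smooth_upto n U sqnorm.
Proof.
move=> oU; apply: smooth_upto_sum => // j; rewrite /=.
apply: (smooth_upto_ext (V := R^o) (f := fun y : pt R => y j 0 * y j 0 : R^o)) => //.
by apply: smooth_uptoM => //; exact: smooth_upto_coord.
Qed.

Lemma sqnorm_gt0 x : (0 < sqnorm x) = (x != 0).
Proof.
have ge0 : 0 <= sqnorm x by apply: sumr_ge0 => k _; exact: sqr_ge0.
rewrite lt_def ge0 andbT; congr (~~ _); apply/eqP/eqP => [|->]; last first.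
  by rewrite /sqnorm big1 // => k _; rewrite mxE expr0n.
move/eqP; rewrite psumr_eq0 => [/allP h|k _]; last exact: sqr_ge0.
apply/matrixP => k j; rewrite ord1 mxE; have := h k (mem_index_enum k).
by rewrite sqrf_eq0 => /eqP.
Qed.

Lemma pd_sqnorm x k : pd k sqnorm x = 2 * x k 0.
Proof.
have d j : is_derive x (e_ k) (fun y : pt R => y j 0 * y j 0 : R^o) (2 * x j 0 * (j == k)%:R).
  have [dj ej] := pd_coord k j x.
  split; first exact: derivableM.
  have := pdM dj dj; rewrite /pd ej => ->; ring.
have sE : sqnorm = \sum_(j < 8) (fun y : pt R => y j 0 * y j 0 : R^o).
  by apply/funext => y; rewrite fct_sumE.
have [_ E] := @is_derive_sum _ _ _ 8 (fun j y => y j 0 * y j 0 : R^o) x (e_ k) _ d.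
rewrite /pd sE; apply: (etrans E).
rewrite (bigD1 k) //= eqxx mulr1 big1 ?addr0 // => j /negPf ->.
by rewrite mulr0.
Qed.

Lemma open_neq0 : open [set x : pt R | x != 0].
Proof.
suff -> : [set x : pt R | x != 0] = sqnorm @^-1` [set t | 0 < t].
  apply: open_comp; last exact: open_gt.
  move=> x _; have [d _] := smooth_upto_differentiable openT I (smooth_upto_sqnorm 1 openT) (x := x).
  exact: differentiable_continuous.
by apply/seteqP; split=> x /=; rewrite sqnorm_gt0.
Qed.

(** The inverse norm is a smooth function whose derivatives are polynomials in
    itself and the coordinates, which makes smoothness of the radial projection an
    induction. *)
Definition invnorm (x : pt R) : R^o := (enorm x)^-1.

Lemma pd_invnorm x k : x != 0 ->
  differentiable invnorm x /\ pd k invnorm x = - (x k 0) * (invnorm x * invnorm x * invnorm x).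
Proof.
rewrite -sqnorm_gt0 => q0.
have s0 : Num.sqrt (sqnorm x) != 0 by rewrite gt_eqF // sqrtr_gt0.
have dq : differentiable sqnorm x.
  by have [d _] := smooth_upto_differentiable openT I (smooth_upto_sqnorm 1 openT) (x := x).
have dh : is_derive (sqnorm x : R) (1 : R) (fun t : R => (Num.sqrt t)^-1)
   (- (Num.sqrt (sqnorm x)) ^- 2 * (2 * Num.sqrt (sqnorm x))^-1).
  have [d1 e1] := is_derive1_sqrt q0.
  by split; [exact: derivableV|rewrite deriveV // e1].
have [d ->] := pd_comp_real k dq dh.
split=> //; rewrite pd_sqnorm /invnorm /enorm -/(sqnorm x).
by field.
Qed.

Lemma smooth_upto_invnorm n : smooth_upto n [set x : pt R | x != 0] invnorm.
Proof.
have base x : x != 0 -> c1_at invnorm x.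
  move=> x0; have [d _] := pd_invnorm ord0 x0.
  by split=> [|k]; [exact: differentiable_continuous|exact: diff_derivable].
elim: n => [|n IH]; first by split; [exact: base|].
split=> [|k]; first exact: base.
apply: (smooth_upto_ext (V := R^o) (f := fun x : pt R => (-1 * x k 0) * (invnorm x * invnorm x * invnorm x) : R^o)).
- exact: open_neq0.
- by move=> y y0; have [_ ->] := pd_invnorm k y0; rewrite mulN1r.
have o := open_neq0.
apply: (smooth_uptoM o); first by apply: (smooth_uptoM o); [exact: smooth_upto_cst|exact: smooth_upto_coord].
by do ?apply: (smooth_uptoM o).
Qed.

Lemma radialE x j : radial x j 0 = invnorm x * x j 0.
Proof. by rewrite mxE. Qed.

Lemma smooth_upto_radial n j :
  smooth_upto n [set x : pt R | x != 0] (fun x => radial x j 0 : R^o).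
Proof.
have o := open_neq0.
apply: (smooth_upto_ext (V := R^o) (f := fun x => invnorm x * x j 0 : R^o)) => // [y _|].
  by rewrite radialE.
by apply: (smooth_uptoM o); [exact: smooth_upto_invnorm|exact: smooth_upto_coord].
Qed.

Lemma smooth_upto_comp_radial n U V (f : pt R -> R^o) :
  open U -> open V -> U `<=` [set x | x != 0] -> (forall x, U x -> V (radial x)) ->
  smooth_upto n.+1 V f -> smooth_upto n U (f \o @radial R).
Proof.
move=> oU oV U0 UV; elim: n f => [|n IH] f sf.
  split=> // x Ux.
  have [df gf] := smooth_upto_differentiable oV (UV _ Ux) sf.
  have dr j : differentiable (fun y => radial y j 0 : R^o) x.
    by have [] := smooth_upto_differentiable open_neq0 (U0 _ Ux) (smooth_upto_radial 1 j).
  have d k : differentiable (f \o @radial R) x by have [] := pd_comp k df gf dr.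
  by split=> [|k]; [exact: (differentiable_continuous (d ord0))|exact/diff_derivable/d].
have H x k : U x -> differentiable (f \o @radial R) x /\ pd k (f \o @radial R) x =
    \sum_j pd k (fun y => radial y j 0 : R^o) x * pd j f (radial x).
  move=> Ux; have [df gf] := smooth_upto_differentiable oV (UV _ Ux) sf.
  apply: pd_comp => // j.
  by have [] := smooth_upto_differentiable open_neq0 (U0 _ Ux) (smooth_upto_radial 1 j).
split=> [x Ux|k].
  have d := (H x ord0 Ux).1.
  by split=> [|k]; [exact: (differentiable_continuous d)|exact: diff_derivable].
apply: (smooth_upto_ext (V := R^o) (f := fun x => \sum_j
   pd k (fun y => radial y j 0 : R^o) x * (pd j f \o @radial R) x : R^o)) => //.
  by move=> y Uy; rewrite (H y k Uy).2.
apply: smooth_upto_sum => // j; apply: smooth_uptoM => //.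
  have [_ h] := smooth_upto_radial n.+1 j; exact: (smooth_uptoS U0 (h k)).
by apply: IH; have [_ h] := sf; exact: h.
Qed.
End ChainRule.

Section MatrixValued.
Variable R : realType.
Implicit Types (x y : pt R) (k : 'I_8) (U V : set (pt R)).

Local Notation e_ k := (delta_mx k 0 : pt R).

Section AnySize.
Variables p q : nat.
Implicit Type f : pt R -> 'M[R]_(p, q).

Lemma continuous_mxP f x : {for x, continuous f} <->
  forall i j, {for x, continuous (fun y => f y i j : R^o)}.
Proof.
split=> [cf i j|cf].
  exact: (continuous_comp cf (@coord_continuous R p q i j (f x))).
move=> A /nbhs_ballP[e /= e0 eA].
have h : \forall y \near x, forall i j, `|f x i j - f y i j| < e.
  apply: (@filter_forall _ _ _ _ (nbhs_filter x)) => i.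
  apply: (@filter_forall _ _ _ _ (nbhs_filter x)) => j.
  by have /cvgrPdist_lt /(_ _ e0) := cf i j.
by apply: (@filterS _ _ (nbhs_filter x) _ _ _ h) => y hy; apply: eA; split=> // i j; exact: hy.
Qed.

Lemma pd_mx f x k i j : derivable f x (e_ k) ->
  pd k f x i j = pd k (fun y => f y i j : R^o) x.
Proof. by move=> df; rewrite /pd derive_mx // mxE. Qed.

Lemma c1_at_mxP f x : c1_at f x <-> forall i j, c1_at (fun y => f y i j : R^o) x.
Proof.
split=> [[/continuous_mxP cf df] i j|h].
  by split=> [|k]; [exact: cf|have /derivable_mxP := df k; exact].
split; first by apply/continuous_mxP => i j; have [] := h i j.
by move=> k; apply/derivable_mxP => i j; have [_] := h i j; exact.
Qed.

Lemma smooth_upto_mxP n U f : open U -> smooth_upto n U f <->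
  forall i j, smooth_upto n U (fun y => f y i j : R^o).
Proof.
move=> oU; elim: n f => [|n IH] f.
  split=> [[h _] i j|h]; first by split=> // x /h /c1_at_mxP; exact.
  by split=> // x Ux; apply/c1_at_mxP => i j; have [h' _] := h i j; exact: h'.
split=> [[h hk] i j|h].
  split=> [x /h /c1_at_mxP|k]; first exact.
  have /IH /(_ i j) := hk k; apply: smooth_upto_ext => // y Uy.
  by rewrite pd_mx //; have [_] := h y Uy; exact.
have hU x : U x -> c1_at f x.
  by move=> Ux; apply/c1_at_mxP => i j; have [h' _] := h i j; exact: h'.
split=> // k; apply/IH => i j; have [_ /(_ k)] := h i j.
apply: smooth_upto_ext => // y Uy.
by rewrite pd_mx //; have [_] := hU y Uy; exact.
Qed.

Lemma smooth_on_mxP U f : open U -> smooth_on U f <->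
  forall i j, smooth_on U (fun y => f y i j : R^o).
Proof.
move=> oU; split=> [/smooth_onP h i j|h].
  by apply/smooth_onP => n; move: i j; apply/smooth_upto_mxP.
by apply/smooth_onP => n; apply/smooth_upto_mxP => // i j; move: n; exact/smooth_onP.
Qed.

Lemma smooth_on_c1 U f x : smooth_on U f -> U x -> c1_at f x.
Proof. by move=> sf Ux; have := sf [::] x Ux. Qed.

Lemma smooth_on_pdC U f x i j : open U -> smooth_on U f -> U x ->
  pd i (pd j f) x = pd j (pd i f) x.
Proof.
move=> oU sf Ux; apply/matrixP => a b.
have c1 k : forall y, U y -> derivable (pd k f) y (e_ i) /\ derivable (pd k f) y (e_ j).
  by move=> y Uy; have [_ h] := smooth_on_c1 (smooth_on_pd k sf) Uy; split; exact: h.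
have s : smooth_on U (fun y => f y a b : R^o) by move: a b; apply/smooth_on_mxP.
have E k l : pd k (fun y => pd l f y a b : R^o) x = pd k (pd l (fun y => f y a b : R^o)) x.
  apply: (pd_ext k oU Ux) => y Uy; rewrite pd_mx //.
  by have [_] := smooth_on_c1 sf Uy; exact.
apply: (etrans (pd_mx a b (c1 j x Ux).1)); apply: (etrans (E i j)).
apply: (etrans _ (esym (etrans (pd_mx a b (c1 i x Ux).2) (E j i)))).
apply: pdC => [|k l]; last by have [] := s [:: k; l] x Ux.
apply: filterS (near_open oU Ux) => y Uy; split.
  by have [_] := s [::] y Uy; exact.
by move=> k l; have [_] := s [:: k] y Uy; exact.
Qed.

End AnySize.

Lemma is_derive_mulmx (p q s : nat) (f : pt R -> 'M[R]_(p, q)) (g : pt R -> 'M[R]_(q, s)) x k :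
  derivable f x (e_ k) -> derivable g x (e_ k) ->
  is_derive x (e_ k) (fun y => f y *m g y) (pd k f x *m g x + f x *m pd k g x).
Proof.
move=> df dg.
have D i j : is_derive x (e_ k) (fun y => (f y *m g y) i j : R^o)
    ((pd k f x *m g x + f x *m pd k g x) i j).
  have -> : (fun y => (f y *m g y) i j : R^o) = \sum_(l < q) (fun y => f y i l * g y l j : R^o).
    by apply/funext => y; rewrite fct_sumE mxE.
  have -> : (pd k f x *m g x + f x *m pd k g x) i j =
      \sum_l (pd k f x i l * g x l j + f x i l * pd k g x l j).
    by rewrite !mxE -big_split.
  apply: is_derive_sum => l.
  have dfl : derivable (fun y => f y i l : R^o) x (e_ k) by move/derivable_mxP: df.
  have dgl : derivable (fun y => g y l j : R^o) x (e_ k) by move/derivable_mxP: dg.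
  split; first exact: (derivableM dfl dgl).
  by have := pdM dfl dgl; rewrite !pd_mx // addrC.
have d : derivable (fun y => f y *m g y) x (e_ k).
  by apply/derivable_mxP => i j; have [] := D i j.
split=> //; apply/matrixP => i j.
by have [_ <-] := D i j; rewrite derive_mx // mxE.
Qed.

Lemma pd_invnorm_pow r k n : sqnorm r = 1 ->
  is_derive r (e_ k) (fun y => invnorm y ^+ n : R^o) (- (n%:R * r k 0)).
Proof.
move=> r1; have r0 : r != 0 by rewrite -sqnorm_gt0 r1.
have N1 : invnorm r = 1 by rewrite /invnorm /enorm -/(sqnorm r) r1 sqrtr1 invr1.
have [dN pN] := pd_invnorm k r0; rewrite N1 !mulr1 in pN.
have dN' : derivable (@invnorm R) r (e_ k) by exact: diff_derivable.
elim: n => [|n [dn en]].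
  have -> : (fun y => invnorm y ^+ 0 : R^o) = cst 1 by apply/funext => y; rewrite expr0.
  by split; [exact: derivable_cst|rewrite derive_cst mul0r oppr0].
have -> : (fun y => invnorm y ^+ n.+1 : R^o) = (fun y => invnorm y * invnorm y ^+ n : R^o).
  by apply/funext => y; rewrite exprS.
split; first exact: (derivableM dN' dn).
have := pdM dN' dn; rewrite /pd en => ->; rewrite -/(pd k _ _) pN N1 expr1n -natr1; ring.
Qed.

Lemma pd_radial r j k : sqnorm r = 1 ->
  is_derive r (e_ k) (fun y => radial y j 0 : R^o) ((j == k)%:R - r k 0 * r j 0).
Proof.
move=> r1; have -> : (fun y => radial y j 0 : R^o) = (fun y => invnorm y ^+ 1 * y j 0 : R^o).
  by apply/funext => y; rewrite radialE expr1.
have N1 : invnorm r = 1 by rewrite /invnorm /enorm -/(sqnorm r) r1 sqrtr1 invr1.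
have [d1 e1] := pd_invnorm_pow k 1 r1; have [d2 e2] := pd_coord k j r.
split; first exact: (derivableM d1 d2).
by have := pdM d1 d2; rewrite /pd e1 e2 => ->; rewrite N1; ring.
Qed.

Lemma radial_id (r : pt R) : sqnorm r = 1 -> radial r = r.
Proof.
move=> r1; have E : enorm r = 1 by rewrite /enorm -/(sqnorm r) r1 sqrtr1.
by rewrite /radial E invr1 scale1r.
Qed.

(** The function with the values of f on S^7 that is homogeneous of degree - n has
    the same tangential derivatives as f. Its gradient differs from that of f by a
    multiple of r, and this difference disappears on restriction to the sphere. *)
Lemma pd_radial_extension p q V (f : pt R -> 'M[R]_(p, q)) r k n :
  open V -> smooth_on V f -> V r -> sqnorm r = 1 ->
  is_derive r (e_ k) (fun y => (enorm y)^-1 ^+ n *: f (radial y))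
    (pd k f r - r k 0 *: (\sum_j r j 0 *: pd j f r + n%:R *: f r)).
Proof.
move=> oV sf Vr r1; have rr := radial_id r1.
have r0 : r != 0 by rewrite -sqnorm_gt0 r1.
have df k' : derivable f r (e_ k') by have [_] := smooth_on_c1 sf Vr; exact.
have D a b : is_derive r (e_ k) (fun y => ((enorm y)^-1 ^+ n *: f (radial y)) a b : R^o)
   ((pd k f r - r k 0 *: (\sum_j r j 0 *: pd j f r + n%:R *: f r)) a b).
  have -> : (fun y => ((enorm y)^-1 ^+ n *: f (radial y)) a b : R^o) =
      (fun y => invnorm y ^+ n * ((fun y => f y a b : R^o) \o @radial R) y : R^o).
    by apply/funext => y; rewrite mxE.
  have sab : smooth_on V (fun y => f y a b : R^o) by move: a b; apply/smooth_on_mxP.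
  have [d g] := smooth_upto_differentiable oV Vr ((smooth_onP _ _).1 sab 1%N).
  have dr j : differentiable (fun y => radial y j 0 : R^o) r.
    by have [dj _] := smooth_upto_differentiable (@open_neq0 R) r0 (@smooth_upto_radial R 1 j).
  have [|||dc pc] := @pd_comp R (fun y => f y a b : R^o) (@radial R) r k.
  - by rewrite rr; exact: d.
  - by rewrite rr; exact: g.
  - exact: dr.
  have [dN eN] := pd_invnorm_pow k n r1.
  have N1 : invnorm r = 1 by rewrite /invnorm /enorm -/(sqnorm r) r1 sqrtr1 invr1.
  have dc' : derivable ((fun y => f y a b : R^o) \o @radial R) r (e_ k) by exact: diff_derivable.
  split; first exact: (derivableM dN dc').
  have E := pdM dN dc'; have eN' : pd k (fun y => invnorm y ^+ n : R^o) r = _ := eN.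
  rewrite eN' pc N1 expr1n mul1r /= rr in E; apply: (etrans E).
  have pE j : pd k (fun y => radial y j 0 : R^o) r * pd j (fun y => f y a b : R^o) r =
      ((j == k)%:R - r k 0 * r j 0) * pd j f r a b.
    by congr (_ * _); [have [] := pd_radial j k r1|rewrite pd_mx].
  rewrite (eq_bigr _ (fun j _ => pE j)) {pE E eN eN' pc}.
  rewrite !mxE summxE.
  under eq_bigr do rewrite mulrBl.
  rewrite sumrB (bigD1 k) //= eqxx mul1r big1 ?addr0; last first.
    by move=> j /negPf ->; rewrite mul0r.
  have -> : \sum_j r k 0 * r j 0 * pd j f r a b = r k 0 * \sum_j (r j 0 *: pd j f r) a b.
    by rewrite mulr_sumr; apply: eq_bigr => j _; rewrite mxE mulrA.
  ring.
have d : derivable (fun y => (enorm y)^-1 ^+ n *: f (radial y)) r (e_ k).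
  by apply/derivable_mxP => a b; have [] := D a b.
split=> //; apply/matrixP => a b.
by have [_ <-] := D a b; rewrite derive_mx // mxE.
Qed.

Lemma smooth_on_radial_extension p q U V (f : pt R -> 'M[R]_(p, q)) n :
  open U -> open V -> U `<=` [set x | x != 0] -> (forall x, U x -> V (radial x)) ->
  smooth_on V f -> smooth_on U (fun y => (enorm y)^-1 ^+ n *: f (radial y)).
Proof.
move=> oU oV U0 UV sf; apply/smooth_on_mxP => // a b; apply/smooth_onP => s.
have sab : smooth_on V (fun y => f y a b : R^o) by move: a b; apply/smooth_on_mxP.
have sc := smooth_upto_comp_radial oU oV U0 UV ((smooth_onP _ _).1 sab s.+1).
have sN : smooth_upto s U (fun y => invnorm y ^+ n : R^o).
  apply: (smooth_uptoS U0); have o := @open_neq0 R.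
  elim: n => [|n IH]; first exact: smooth_upto_cst.
  apply: (smooth_upto_ext (f := fun y => invnorm y * invnorm y ^+ n : R^o)) => // [y _|].
    by rewrite exprS.
  by apply: (smooth_uptoM o) => //; exact: smooth_upto_invnorm.
apply: (smooth_upto_ext (f := fun y => invnorm y ^+ n * ((fun y => f y a b : R^o) \o @radial R) y : R^o)) => //.
  by move=> y _; rewrite mxE.
exact: smooth_uptoM.
Qed.
End MatrixValued.

(** * Connections and curvature in components *)

Section FormComponents.
Variables (R : realType) (V : lmodType R).
Implicit Types (I J K : {set 'I_8}) (k l j : 'I_8) (a b : ext V).

Lemma wedge_1form (V1 : lmodType R) (V2 : Type) (mul : V1 -> V2 -> V) (a : ext V1) (b : ext V2) :
  (forall y, mul 0 y = 0) -> homogeneous 1 a ->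
  wedge mul a b = \sum_k dxw k [ffun K : {set 'I_8} => mul (a [set k]%SET) (b K)].
Proof.
move=> mul0 ha; apply/ffunP => K; rewrite ffunE sum_ffunE.
transitivity (\sum_(I : {set 'I_8} | I \subset K) \sum_k
  (I == [set k]%SET)%:R *: (esign R I (K :\: I)%SET *: mul (a I) (b (K :\: I)%SET))).
  apply: eq_bigr => I _; have [/eqP/cards1P[k ->]|I1] := eqVneq #|I| 1%N.
    rewrite (bigD1 k) //= eqxx scale1r big1 ?addr0 // => l lk.
    by rewrite (inj_eq finset.set1_inj) eq_sym (negPf lk) scale0r.
  rewrite ha // mul0 scaler0 big1 // => k _; rewrite scaler0 //.
rewrite exchange_big; apply: eq_bigr => k _ /=; rewrite !ffunE.
case: ifP => kK.
  rewrite (bigD1 [set k]%SET) ?finset.sub1set //= big1 ?addr0; last first.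
    by move=> I /andP[_ /negPf ->]; rewrite scale0r.
  by rewrite eqxx scale1r esign1D.
rewrite big1 // => I IK.
suff /negPf -> : I != [set k]%SET by rewrite scale0r.
by apply: contraFN kK => /eqP Ik; move: IK; rewrite Ik finset.sub1set.
Qed.

Lemma esign_self1 k : esign R [set k]%SET [set k]%SET = 1.
Proof. by rewrite -esign1D finset.setDv esign0r. Qed.

Lemma contract_delta k a : Defs.contract (delta_mx k 0) a = ctr k a.
Proof.
rewrite contractE (bigD1 k) //= mxE !eqxx scale1r big1 ?addr0 // => j /negPf jk.
by rewrite mxE jk scale0r.
Qed.

Lemma ctr_set0 k a : ctr k a finset.set0 = a [set k]%SET.
Proof.
rewrite ffunE inE /= esign0r scale1r; congr (a _).
by apply/setP => i; rewrite !inE orbF.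
Qed.

Lemma ctr_sum_dxw (c : 'I_8 -> ext V) j l :
  ctr j (\sum_k dxw k (c k)) [set l]%SET = c j [set l]%SET - c l [set j]%SET.
Proof.
have E k : ctr j (dxw k (c k)) [set l]%SET =
    (j == k)%:R *: c k [set l]%SET - (l == k)%:R *: c k [set j]%SET.
  have /ffunP/(_ [set l]%SET) := clifford j k (c k).
  rewrite ffunE => /(canRL (addrK _)) ->; rewrite ffunE; congr (_ - _).
  rewrite ffunE inE eq_sym; have [->|_] := eqVneq l k; last by rewrite scale0r.
  by rewrite esign_self1 !scale1r finset.setDv ctr_set0.
rewrite linear_sum sum_ffunE (eq_bigr _ (fun k _ => E k)) sumrB; congr (_ - _).
  rewrite (bigD1 j) //= eqxx scale1r big1 ?addr0 // => k /negPf.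
  by rewrite eq_sym => ->; rewrite scale0r.
rewrite (bigD1 l) //= eqxx scale1r big1 ?addr0 // => k /negPf.
by rewrite eq_sym => ->; rewrite scale0r.
Qed.

Lemma eval2_delta a k l : eval2 a (delta_mx k 0) (delta_mx l 0) = ctr k a [set l]%SET.
Proof. by rewrite /eval2 !contract_delta ctr_set0. Qed.

Lemma ctr_ctr k l a : ctr k a [set l]%SET = - ctr l a [set k]%SET.
Proof.
have [->|kl] := eqVneq k l.
  by rewrite ffunE inE eqxx /= oppr0.
rewrite !ffunE !inE kl eq_sym kl /= (esign11N R kl) scaleNr finset.setUC //.
Qed.

Lemma ext1P a b : homogeneous 1 a -> homogeneous 1 b ->
  (forall l, a [set l]%SET = b [set l]%SET) -> a = b.
Proof.
move=> ha hb ab; apply/ffunP => K.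
have [/eqP/cards1P[l ->]//|K1] := eqVneq #|K| 1%N.
by rewrite ha ?hb.
Qed.

Lemma contract1 v a l : Defs.contract v a [set l]%SET = \sum_k v k 0 *: ctr k a [set l]%SET.
Proof. by rewrite contractE sum_ffunE; apply: eq_bigr => k _; rewrite ffunE. Qed.

Lemma setof2 k l a : (k < l)%N -> a (setof [:: val k; val l]) = ctr k a [set l]%SET.
Proof.
move=> kl; rewrite ffunE inE -val_eqE /= neq_ltn kl /=.
have -> : esign R [set k]%SET [set l]%SET = 1.
  by rewrite esignE !big_set1 ltnNge ltnW.
rewrite scale1r; congr (a _); apply/setP => i; rewrite !inE -!val_eqE //.
Qed.

End FormComponents.

Section SmoothAlgebra.
Variable R : realType.
Implicit Types (x y : pt R) (k i j : 'I_8) (U : set (pt R)).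
Local Notation e_ k := (delta_mx k 0 : pt R).

Lemma smooth_onD (V : normedModType R) U (f g : pt R -> V) : open U ->
  smooth_on U f -> smooth_on U g -> smooth_on U (fun x => f x + g x).
Proof.
move=> oU /smooth_onP hf /smooth_onP hg; apply/smooth_onP => n.
exact: smooth_uptoD.
Qed.

Lemma smooth_on_sum (V : normedModType R) U (I : Type) (s : seq I) (f : I -> pt R -> V) : open U ->
  (forall t, smooth_on U (f t)) -> smooth_on U (fun x => \sum_(t <- s) f t x).
Proof.
move=> oU hf; apply/smooth_onP => n.
by apply: smooth_upto_sum => // t; exact: ((smooth_onP _ _).1 (hf t) n).
Qed.

Lemma smooth_on_ext (V : normedModType R) U (f g : pt R -> V) : open U ->
  (forall y, U y -> f y = g y) -> smooth_on U f -> smooth_on U g.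
Proof.
move=> oU fg /smooth_onP hf; apply/smooth_onP => n.
exact: (smooth_upto_ext oU fg (hf n)).
Qed.

Lemma smooth_on_cst (V : normedModType R) U (a : V) : smooth_on U (fun _ : pt R => a).
Proof. by apply/smooth_onP => n; exact: smooth_upto_cst. Qed.

Lemma smooth_on_coord U j : open U -> smooth_on U (fun y : pt R => y j 0 : R^o).
Proof. by move=> oU; apply/smooth_onP => n; exact: smooth_upto_coord. Qed.

Lemma smooth_onM U (f g : pt R -> R^o) : open U ->
  smooth_on U f -> smooth_on U g -> smooth_on U (fun x => f x * g x : R^o).
Proof.
move=> oU /smooth_onP hf /smooth_onP hg; apply/smooth_onP => n.
exact: smooth_uptoM.
Qed.

Lemma smooth_onZ p q U (c : pt R -> R^o) (f : pt R -> 'M[R]_(p, q)) : open U ->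
  smooth_on U c -> smooth_on U f -> smooth_on U (fun x => c x *: f x).
Proof.
move=> oU hc hf; apply: ((smooth_on_mxP _ oU).2) => i j.
have hfij := (smooth_on_mxP _ oU).1 hf i j.
apply: (smooth_on_ext oU _ (smooth_onM oU hc hfij)) => y _.
by rewrite mxE.
Qed.

Lemma smooth_onN p q U (f : pt R -> 'M[R]_(p, q)) : open U ->
  smooth_on U f -> smooth_on U (fun x => - f x).
Proof.
move=> oU hf.
have h : smooth_on U (fun x => (-1 : R) *: f x).
  exact: (smooth_onZ oU (@smooth_on_cst R^o U (-1)) hf).
by apply: (smooth_on_ext oU _ h) => y _; rewrite scaleN1r.
Qed.

Lemma smooth_on_mulmx p q s U (f : pt R -> 'M[R]_(p, q)) (g : pt R -> 'M[R]_(q, s)) : open U ->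
  smooth_on U f -> smooth_on U g -> smooth_on U (fun x => f x *m g x).
Proof.
move=> oU hf hg; apply: ((smooth_on_mxP _ oU).2) => i j.
have hl l := smooth_onM oU ((smooth_on_mxP _ oU).1 hf i l) ((smooth_on_mxP _ oU).1 hg l j).
apply: (smooth_on_ext oU _ (smooth_on_sum (index_enum _) oU hl)) => y _.
by rewrite mxE.
Qed.

Lemma smooth_on_sub (V : normedModType R) U U' (f : pt R -> V) :
  U' `<=` U -> smooth_on U f -> smooth_on U' f.
Proof. by move=> UU hf s x /UU; exact: hf. Qed.

Lemma derivable_smooth (V : normedModType R) U (f : pt R -> V) x k :
  smooth_on U f -> U x -> derivable f x (e_ k).
Proof. by move=> sf Ux; have [_] := sf [::] x Ux; exact. Qed.

Lemma pdD (V : normedModType R) (f g : pt R -> V) x k :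
  derivable f x (e_ k) -> derivable g x (e_ k) ->
  pd k (fun y => f y + g y) x = pd k f x + pd k g x.
Proof. exact: deriveD. Qed.

Lemma pdB (V : normedModType R) (f g : pt R -> V) x k :
  derivable f x (e_ k) -> derivable g x (e_ k) ->
  pd k (fun y => f y - g y) x = pd k f x - pd k g x.
Proof. exact: deriveB. Qed.

Lemma pd_mulmx p q s (f : pt R -> 'M[R]_(p, q)) (g : pt R -> 'M[R]_(q, s)) x k :
  derivable f x (e_ k) -> derivable g x (e_ k) ->
  pd k (fun y => f y *m g y) x = pd k f x *m g x + f x *m pd k g x.
Proof. by move=> df dg; have [_] := is_derive_mulmx df dg. Qed.

Lemma pdZ (V : normedModType R) (c : R) (f : pt R -> V) x k :
  derivable f x (e_ k) -> pd k (fun y => c *: f y) x = c *: pd k f x.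
Proof. exact: deriveZ. Qed.

Lemma pd_sum (V : normedModType R) (I : Type) (s : seq I) (f : I -> pt R -> V) x k :
  (forall t, derivable (f t) x (e_ k)) ->
  derivable (fun y => \sum_(t <- s) f t y) x (e_ k) /\
  pd k (fun y => \sum_(t <- s) f t y) x = \sum_(t <- s) pd k (f t) x.
Proof.
move=> df; elim: s => [|a s [d IH]].
  have -> : (fun y => \sum_(t <- [::]) f t y) = cst 0 by apply/funext => y; rewrite big_nil.
  by split; [exact: derivable_cst|rewrite big_nil /pd derive_cst].
have -> : (fun y => \sum_(t <- a :: s) f t y) = (fun y => f a y + \sum_(t <- s) f t y).
  by apply/funext => y; rewrite big_cons.
by split; [exact: (derivableD (df a) d)|rewrite (pdD (df a) d) IH big_cons].
Qed.

Lemma is_derive_coordZ p q (f : pt R -> 'M[R]_(p, q)) x k j :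
  derivable f x (e_ k) ->
  is_derive x (e_ k) (fun y => y j 0 *: f y) ((j == k)%:R *: f x + x j 0 *: pd k f x).
Proof.
move=> df.
have E : (fun y : pt R => y j 0 *: f y) = (fun y : pt R => (y j 0)%:M *m f y).
  by apply/funext => y; rewrite mul_scalar_mx.
have D : is_derive x (e_ k) (fun y : pt R => (y j 0)%:M : 'M[R]_p) ((j == k)%:R%:M).
  have Dab a b : is_derive x (e_ k) (fun y : pt R => ((y j 0)%:M : 'M[R]_p) a b : R^o)
      (((j == k)%:R%:M : 'M[R]_p) a b).
    rewrite mxE; have [->|ab] := eqVneq a b.
      rewrite mulr1n; have -> : (fun y : pt R => ((y j 0)%:M : 'M[R]_p) b b : R^o) = (fun y => y j 0 : R^o).
        by apply/funext => y; rewrite mxE eqxx mulr1n.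
      exact: pd_coord.
    rewrite mulr0n; have -> : (fun y : pt R => ((y j 0)%:M : 'M[R]_p) a b : R^o) = cst 0.
      by apply/funext => y; rewrite mxE (negPf ab) mulr0n.
    exact: is_derive_cst.
  have d : derivable (fun y : pt R => (y j 0)%:M : 'M[R]_p) x (e_ k).
    by apply/derivable_mxP => a b; have [] := Dab a b.
  split=> //; apply/matrixP => a b; have [_ <-] := Dab a b.
  by rewrite derive_mx // mxE.
rewrite E; have [d e] := D; have [d' e'] := is_derive_mulmx d df.
split=> //; rewrite e' /pd e !mul_scalar_mx //.
Qed.
End SmoothAlgebra.

Section MatrixIdentities.
Variables (R : realType) (m : nat).
Implicit Types (a b c g x : 'M[R]_m).

Lemma mx_addE a b p q : (a + b) p q = a p q + b p q.
Proof. by rewrite mxE. Qed.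

Lemma mx_oppE a p q : (- a) p q = - a p q.
Proof. by rewrite mxE. Qed.

Lemma mx_add3E a b c p q : (a + b + c) p q = a p q + b p q + c p q.
Proof. by rewrite !mxE. Qed.

Lemma mx_scaleE (s : R) a p q : (s *: a) p q = s * a p q.
Proof. by rewrite mxE. Qed.

Ltac mxring := apply/matrixP => p q;
  rewrite !(mulmxDl, mulmxDr, mulNmx, mulmxN, mulmxA, mx_addE, mx_oppE).

(** The cancellation behind the Bianchi identity: a, b, c are components of the
    potential, d_ and x_ stand for their first derivatives and for the second ones,
    the latter already identified by symmetry. *)
Lemma bianchi_identity a b c dkj dkl djk djl dlk dlj xkj xkl xjl :
  let Fjl := djl - dlj + b *m c - c *m b in
  let Flk := dlk - dkl + c *m a - a *m c in
  let Fkj := dkj - djk + a *m b - b *m a in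
  (xkj - xkl + (dkj *m c + b *m dkl) - (dkl *m b + c *m dkj) + bracket a Fjl)
  + (xjl - xkj + (djl *m a + c *m djk) - (djk *m c + a *m djl) + bracket b Flk)
  + (xkl - xjl + (dlk *m b + a *m dlj) - (dlj *m a + b *m dlk) + bracket c Fkj) = 0.
Proof.
rewrite /bracket /=; apply/matrixP => p q; rewrite [RHS]mxE.
rewrite !(mulmxDl, mulmxDr, mulNmx, mulmxN, mulmxA, mx_addE, mx_oppE); ring.
Qed.

(** The cancellation behind the gauge covariance of the curvature, with the
    transformation law and its derivative as hypotheses; x is the mixed second
    derivative of g. *)
Lemma gauge_identity g ai aj ai' aj' dij dji dij' dji' gi gj x :
  g *m ai' = ai *m g + gi -> g *m aj' = aj *m g + gj ->
  gi *m aj' + g *m dij' = dij *m g + aj *m gi + x ->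
  gj *m ai' + g *m dji' = dji *m g + ai *m gj + x ->
  g *m (dij' - dji' + ai' *m aj' - aj' *m ai') =
  (dij - dji + ai *m aj - aj *m ai) *m g.
Proof.
move=> /esym/(canRL (addKr _)) giE /esym/(canRL (addKr _)) gjE.
move=> /(canRL (addKr _)) eij /(canRL (addKr _)) eji.
rewrite !(mulmxDr, mulmxN) eij eji giE gjE.
by mxring; ring.
Qed.
End MatrixIdentities.

Section LocalPotential.
Variables (R : realType) (m : nat).
Implicit Types (x : pt R) (k j l : 'I_8) (U : set (pt R)) (P b : pt R -> ext 'M[R]_m).
Local Notation e_ k := (delta_mx k 0 : pt R).

(** Coefficientwise partial derivative: with the flat metric and constant frame,
    the exterior derivative is the sum of the dx^k /\ of these. *)
Definition pdext k b x : ext 'M[R]_m :=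
  [ffun K : {set 'I_8} => pd k (fun y => b y K) x].

Lemma extdE b x : extd b x = \sum_k dxw k (pdext k b x).
Proof.
apply/ffunP => K; rewrite ffunE sum_ffunE big_mkcond; apply: eq_bigr => k _.
by rewrite !ffunE esign1D.
Qed.

Definition brext k P x (c : ext 'M[R]_m) : ext 'M[R]_m :=
  [ffun K : {set 'I_8} => bracket (P x [set k]%SET) (c K)].

(** The covariant derivative of a form in the direction e_k, for the flat
    connection on forms and the potential P on values. *)
Definition cov k P b x := pdext k b x + brext k P x (b x).

Lemma extD_cov P b x : homogeneous 1 (P x) ->
  extd b x + wedge (@bracket R m) (P x) (b x) = \sum_k dxw k (cov k P b x).
Proof.
move=> h1; rewrite extdE wedge_1form //; last first.
  by move=> y; rewrite /bracket mul0mx mulmx0 subrr.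
by rewrite -big_split; apply: eq_bigr => k _; rewrite /= -linearD.
Qed.

Definition curv P x : ext 'M[R]_m := extd P x + wedge mulmx (P x) (P x).

(** The value F(e_j, e_l) of the curvature of the potential P. Components, rather
    than coefficients of a form, are what the matrix algebra of Lie(Sp(2)) uses. *)
Definition curv_comp P j l x : 'M[R]_m :=
  pd j (fun y => P y [set l]%SET) x - pd l (fun y => P y [set j]%SET) x
  + P x [set j]%SET *m P x [set l]%SET - P x [set l]%SET *m P x [set j]%SET.

Lemma curvE P x : homogeneous 1 (P x) ->
  curv P x = \sum_k dxw k (pdext k P x + [ffun K : {set 'I_8} => P x [set k]%SET *m P x K]).
Proof.
move=> h1; rewrite /curv extdE wedge_1form //; last by move=> y; rewrite mul0mx.
by rewrite -big_split; apply: eq_bigr => k _; rewrite /= -linearD.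
Qed.

Lemma curv_curv_compE P x j l : homogeneous 1 (P x) ->
  ctr j (curv P x) [set l]%SET = curv_comp P j l x.
Proof.
move=> h1; rewrite curvE // ctr_sum_dxw !ffunE /curv_comp opprD addrACA !addrA.
by [].
Qed.

Lemma pd_zero U (f : pt R -> 'M[R]_m) k x : open U -> U x ->
  (forall y, U y -> f y = 0) -> pd k f x = 0.
Proof.
move=> oU Ux f0; rewrite (pd_ext (g := cst 0) k oU Ux) //.
by rewrite /pd derive_cst.
Qed.

Lemma homogeneous_pdext n U b k x : open U -> U x ->
  (forall y, U y -> homogeneous n (b y)) -> homogeneous n (pdext k b x).
Proof.
move=> oU Ux hb K Kn; rewrite ffunE; apply: (pd_zero _ oU Ux) => y Uy.
exact: hb.
Qed.

Lemma homogeneous_brext n P k x (c : ext 'M[R]_m) :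
  homogeneous n c -> homogeneous n (brext k P x c).
Proof. by move=> hc K Kn; rewrite ffunE hc // /bracket mulmx0 mul0mx subrr. Qed.

Lemma homogeneous_cov n U P b k x : open U -> U x ->
  (forall y, U y -> homogeneous n (b y)) -> homogeneous n (cov k P b x).
Proof.
move=> oU Ux hb; apply: homogeneousD; first exact: homogeneous_pdext hb.
exact/homogeneous_brext/hb.
Qed.

Lemma homogeneous_curv U P x : open U -> U x ->
  (forall y, U y -> homogeneous 1 (P y)) -> homogeneous 2 (curv P x).
Proof.
move=> oU Ux hP; rewrite curvE; last exact: hP.
apply: homogeneous_sum => k; apply: homogeneous_dxw; apply: homogeneousD.
  exact: homogeneous_pdext hP.
by move=> K K1; rewrite ffunE (hP x Ux K K1) mulmx0.
Qed.

Lemma smooth_curv_comp U P j l : open U -> smooth_form U P -> smooth_on U (curv_comp P j l).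
Proof.
move=> oU sP; rewrite /curv_comp.
have s1 := smooth_on_pd j (sP [set l]%SET); have s2 := smooth_on_pd l (sP [set j]%SET).
have s3 := smooth_on_mulmx oU (sP [set j]%SET) (sP [set l]%SET).
have s4 := smooth_on_mulmx oU (sP [set l]%SET) (sP [set j]%SET).
exact: (smooth_onD oU (smooth_onD oU (smooth_onD oU s1 (smooth_onN oU s2)) s3) (smooth_onN oU s4)).
Qed.

Lemma pd_curv_comp U P k j l x : open U -> U x -> smooth_form U P ->
  let p j := P x [set j]%SET in let d k j := pd k (fun y => P y [set j]%SET) x in
  pd k (curv_comp P j l) x = pd k (pd j (fun y => P y [set l]%SET)) x
    - pd k (pd l (fun y => P y [set j]%SET)) x
    + (d k j *m p l + p j *m d k l) - (d k l *m p j + p l *m d k j).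
Proof.
move=> oU Ux sP /=.
have d0 j' := derivable_smooth (k := k) (sP [set j']%SET) Ux.
have d1 i j' := derivable_smooth (k := k) (smooth_on_pd i (sP [set j']%SET)) Ux.
have [d2 e2] := is_derive_mulmx (d0 j) (d0 l).
have [d3 e3] := is_derive_mulmx (d0 l) (d0 j).
have d4 := derivableB (d1 j l) (d1 l j).
rewrite -[X in _ = _ + X - _]e2 -[X in _ = _ - X]e3.
apply: (etrans (pdB (derivableD d4 d2) d3)); congr (_ - _).
apply: (etrans (pdD d4 d2)); congr (_ + _).
exact: (pdB (d1 j l) (d1 l j)).
Qed.

(** The component (nabla_k F)(e_j, e_l). *)
Definition cov_curv_comp P k j l x := pd k (curv_comp P j l) x + bracket (P x [set k]%SET) (curv_comp P j l x).

Lemma bianchi U P k j l x : open U -> U x -> smooth_form U P ->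
  cov_curv_comp P k j l x + cov_curv_comp P j l k x + cov_curv_comp P l k j x = 0.
Proof.
move=> oU Ux sP; rewrite /cov_curv_comp !(pd_curv_comp _ _ _ oU Ux sP) /=.
have C i i' j' := smooth_on_pdC i i' oU (sP [set j']%SET) Ux.
rewrite (C j k l) (C l k j) (C l j k).
exact: bianchi_identity.
Qed.

(** Written without inverses of g, so that only products are differentiated. *)
Lemma gauge_curv_comp U (g : pt R -> 'M[R]_m) P P' j l x : open U -> U x ->
  smooth_form U P -> smooth_form U P' -> smooth_on U g ->
  (forall y, U y -> g y \in unitmx) ->
  (forall y, U y -> P' y = gauge g P y) ->
  g x *m curv_comp P' j l x = curv_comp P j l x *m g x.
Proof.
move=> oU Ux sP sP' sg gu gP.
have G k y : U y -> g y *m P' y [set k]%SET = P y [set k]%SET *m g y + pd k g y.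
  move=> Uy; rewrite gP // /gauge ffunE mulmxDr !mulmxA mulmxV ?gu // !mul1mx; congr (_ + _).
  rewrite ffunE big_set1 finset.setDv esign0r scale1r; congr (pd k _ y).
  by apply/funext => z; rewrite ffunE eqxx.
have D k i : pd k g x *m P' x [set i]%SET + g x *m pd k (fun y => P' y [set i]%SET) x =
    pd k (fun y => P y [set i]%SET) x *m g x + P x [set i]%SET *m pd k g x + pd k (pd i g) x.
  have dg := derivable_smooth (k := k) sg Ux.
  have dP' := derivable_smooth (k := k) (sP' [set i]%SET) Ux.
  have dP := derivable_smooth (k := k) (sP [set i]%SET) Ux.
  have [d1 e1] := is_derive_mulmx dg dP'; have [d2 e2] := is_derive_mulmx dP dg.
  rewrite -e1 -e2; apply: (etrans (pd_ext k oU Ux (G i))).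
  exact: (pdD d2 (derivable_smooth (k := k) (smooth_on_pd i sg) Ux)).
apply: (gauge_identity (G j x Ux) (G l x Ux) (D j l)).
by rewrite (smooth_on_pdC j l oU sg Ux); exact: D.
Qed.

End LocalPotential.

(** * Conical connections *)

Section Cone.
Variables (R : realType) (m : nat).
Implicit Types (x y r : pt R) (k j l : 'I_8) (U : set (pt R)).
Local Notation e_ k := (delta_mx k 0 : pt R).

Lemma enormZ (t : R) y : 0 < t -> enorm (t *: y) = t * enorm y.
Proof.
move=> t0; rewrite /enorm (eq_bigr (fun k => t ^+ 2 * y k 0 ^+ 2)); last first.
  by move=> k _; rewrite mxE exprMn.
by rewrite -mulr_sumr sqrtrM ?sqr_ge0 // sqrtr_sqr gtr0_norm.
Qed.

Lemma enorm_gt0 y : y != 0 -> 0 < enorm y.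
Proof. by rewrite -sqnorm_gt0 => y0; rewrite /enorm sqrtr_gt0. Qed.

Lemma sqnorm_enorm y : sqnorm y = enorm y ^+ 2.
Proof. by rewrite sqr_sqrtr // sumr_ge0 // => k _; exact: sqr_ge0. Qed.

Lemma radialZ (t : R) y : 0 < t -> radial (t *: y) = radial y.
Proof.
move=> t0; rewrite /radial enormZ // scalerA invfM mulrAC mulVf ?mul1r //.
by rewrite gt_eqF.
Qed.

Lemma enorm_radial y : y != 0 -> y = enorm y *: radial y.
Proof. by move=> /enorm_gt0 y0; rewrite /radial scalerA divff ?scale1r // gt_eqF. Qed.

Lemma sqnorm_radial y : y != 0 -> sqnorm (radial y) = 1.
Proof.
move=> /enorm_gt0 y0; have E : enorm (radial y) = 1.
  by rewrite /radial enormZ ?invr_gt0 // mulVf // gt_eqF.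
by rewrite sqnorm_enorm E expr1n.
Qed.

Lemma S7_sqnorm r : S7 R r <-> sqnorm r = 1.
Proof.
split=> [r1|r1]; first by rewrite sqnorm_enorm (r1 : enorm r = 1) expr1n.
by rewrite /S7 /= /enorm -/(sqnorm r) r1 sqrtr1.
Qed.

Lemma sqnorm1_neq0 r : sqnorm r = 1 -> r != 0.
Proof. by move=> r1; rewrite -sqnorm_gt0 r1. Qed.

Lemma pd_scale p q U (f : pt R -> 'M[R]_(p, q)) (t : R) k y : open U -> U (t *: y) ->
  smooth_on U f -> pd k (fun z => f (t *: z)) y = t *: pd k f (t *: y) /\
  derivable (fun z => f (t *: z)) y (e_ k).
Proof.
move=> oU Uty sf.
have D a b : is_derive y (e_ k) (fun z => f (t *: z) a b : R^o) (t * pd k f (t *: y) a b).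
  have sab : smooth_on U (fun y => f y a b : R^o) by move: a b; apply/smooth_on_mxP.
  have [d g] := smooth_upto_differentiable oU Uty ((smooth_onP _ _).1 sab 1%N).
  have dj j : is_derive y (e_ k) (fun z => (t *: z) j 0 : R^o) (t * (j == k)%:R).
    have -> : (fun z : pt R => (t *: z) j 0 : R^o) = t \*: (fun z : pt R => z j 0 : R^o).
      by apply/funext => z; rewrite mxE.
    have [d0 e0] := pd_coord k j y.
    by split; [exact: derivableZ|rewrite deriveZ // e0].
  have ddj j : differentiable (fun z : pt R => (t *: z) j 0 : R^o) y.
    have s : smooth_on setT (fun z : pt R => (t *: z) j 0 : R^o).
      apply: (smooth_on_ext (f := fun z : pt R => (cst t z : R^o) * z j 0 : R^o) openT).
        by move=> z _; rewrite mxE.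
      apply: (smooth_onM openT); [exact: smooth_on_cst|exact: (smooth_on_coord j openT)].
    by have [ds _] := smooth_upto_differentiable openT (I : setT y) ((smooth_onP _ _).1 s 1%N).
  have [dc pc] := @pd_comp R (fun y => f y a b : R^o) (fun z : pt R => t *: z) y k d g ddj.
  split; first exact: diff_derivable.
  apply: (etrans pc); rewrite (bigD1 k) //= big1 ?addr0.
    have -> : pd k (fun z => (t *: z) k 0 : R^o) y = t.
      by have [_] := dj k; rewrite eqxx mulr1.
    rewrite pd_mx //; exact: (derivable_smooth sf Uty).
  move=> j /negPf jk; have -> : pd k (fun z => (t *: z) j 0 : R^o) y = 0.
    by have [_] := dj j; rewrite jk mulr0.
  by rewrite mul0r.
have d : derivable (fun z => f (t *: z)) y (e_ k).
  by apply/derivable_mxP => a b; have [] := D a b.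
split=> //; apply/matrixP => a b.
by rewrite mxE; have [_ <-] := D a b; rewrite pd_mx.
Qed.

Lemma scale_solve (V : lmodType R) (t : R) (u v : V) :
  t != 0 -> t *: u = t^-1 *: v -> u = t^-1 ^+ 2 *: v.
Proof.
by move=> t0 /(congr1 (fun v => t^-1 *: v)); rewrite !scalerA mulVf // scale1r.
Qed.

Lemma pd_homogeneous p q U (f : pt R -> 'M[R]_(p, q)) (t : R) k y :
  open U -> (forall z, U z -> U (t *: z)) -> 0 < t -> U y -> smooth_on U f ->
  (forall z, U z -> f (t *: z) = t^-1 *: f z) ->
  pd k f (t *: y) = t^-1 ^+ 2 *: pd k f y.
Proof.
move=> oU Ut t0 Uy sf hf.
have [e _] := pd_scale k oU (Ut _ Uy) sf.
have := pd_ext k oU Uy hf; rewrite e pdZ; last exact: (derivable_smooth sf Uy).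
by apply: scale_solve; rewrite gt_eqF.
Qed.

Lemma contract_contract0 (V : lmodType R) v (c : ext V) :
  Defs.contract v (Defs.contract v c) finset.set0 = 0.
Proof.
have E : Defs.contract v (Defs.contract v c) finset.set0 =
    \sum_k \sum_j (v k 0 * v j 0) *: ctr j c [set k]%SET.
  rewrite contractE sum_ffunE; apply: eq_bigr => k _.
  rewrite ffunE ctr_set0 contract1 scaler_sumr; apply: eq_bigr => j _.
  by rewrite scalerA.
have : Defs.contract v (Defs.contract v c) finset.set0 =
    - Defs.contract v (Defs.contract v c) finset.set0.
  rewrite {1}E exchange_big E -sumrN; apply: eq_bigr => k _ /=.
  rewrite -sumrN; apply: eq_bigr => j _.
  by rewrite ctr_ctr scalerN mulrC.
set x := Defs.contract _ _ _ => /eqP; rewrite -addr_eq0 -mulr2n -scaler_nat.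
by rewrite scaler_eq0 pnatr_eq0 => /eqP.
Qed.

Lemma contract_set0 (V : lmodType R) v (c : ext V) :
  Defs.contract v c finset.set0 = \sum_k v k 0 *: c [set k]%SET.
Proof.
rewrite contractE sum_ffunE; apply: eq_bigr => k _.
by rewrite ffunE ctr_set0.
Qed.

Section RadialPotential.
Variables (U : set (pt R)) (P : pt R -> ext 'M[R]_m).
Hypotheses (oU : open U) (U0 : forall y, U y -> y != 0)
  (Uc : forall y (t : R), U y -> 0 < t -> U (t *: y))
  (h1 : forall y, U y -> homogeneous 1 (P y)) (sP : smooth_form U P)
  (PE : forall y, U y -> P y = radial_pullback P y).

(** A potential pulled back from the sphere has no radial component. *)
Lemma radial_potential y : U y -> \sum_k y k 0 *: P y [set k]%SET = 0.
Proof.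
move=> Uy; have -> : \sum_k y k 0 *: P y [set k]%SET =
    \sum_k radial y k 0 *: restrictS (radial y) (P (radial y)) [set k]%SET.
  apply: eq_bigr => k _; rewrite {1}PE // ffunE cards1 expr1 scalerA.
  by rewrite mulrC radialE.
by rewrite -contract_set0 /restrictS contract_contract0.
Qed.

Lemma potential_scale y (t : R) l : U y -> 0 < t ->
  P (t *: y) [set l]%SET = t^-1 *: P y [set l]%SET.
Proof.
move=> Uy t0; rewrite (PE Uy) (PE (Uc Uy t0)) !ffunE cards1 !expr1.
by rewrite radialZ // enormZ // invfM scalerA.
Qed.

Lemma curv_comp_scale y (t : R) j l : U y -> 0 < t ->
  curv_comp P j l (t *: y) = t^-1 ^+ 2 *: curv_comp P j l y.
Proof.
move=> Uy t0; rewrite /curv_comp.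
have H a b : pd a (fun z => P z [set b]%SET) (t *: y) =
    t^-1 ^+ 2 *: pd a (fun z => P z [set b]%SET) y.
  apply: (pd_homogeneous a oU (fun z Uz => Uc Uz t0) t0 Uy (sP _)) => z Uz.
  exact: potential_scale.
rewrite !H !potential_scale // -!scalemxAl -!scalemxAr !scalerA -expr2.
by rewrite !scalerDr !scalerN.
Qed.

(** On the sphere, Euler's identity and the derivative of radial_potential show
    that the derivative terms of r _| F cancel; the quadratic terms contain the
    radial component of P. Homogeneity extends this to the cone. *)
Lemma curv_comp_radial y l : U y -> \sum_j y j 0 *: curv_comp P j l y = 0.
Proof.
move=> Uy.
suff S7 r : U r -> sqnorm r = 1 -> \sum_j r j 0 *: curv_comp P j l r = 0.
  have y0 := U0 Uy; have n0 := enorm_gt0 y0.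
  have Ur : U (radial y) by apply: Uc => //; rewrite invr_gt0.
  have FE j : curv_comp P j l y = (enorm y)^-1 ^+ 2 *: curv_comp P j l (radial y).
    by rewrite {1}(enorm_radial y0) curv_comp_scale.
  have yE j : y j 0 = enorm y * radial y j 0 by rewrite {1}(enorm_radial y0) mxE.
  rewrite (eq_bigr (fun j => (enorm y * (enorm y)^-1 ^+ 2) *:
      (radial y j 0 *: curv_comp P j l (radial y)))).
    by rewrite -scaler_sumr (S7 _ Ur (sqnorm_radial y0)) scaler0.
  by move=> j _; rewrite FE {1}yE !scalerA mulrAC.
move=> {y Uy} Ur r1.
pose f y := P y [set l]%SET.
have dP j k : derivable (fun y => P y [set j]%SET) r (e_ k) by exact: (derivable_smooth (sP _) Ur).
(* Euler's identity: the components of P are homogeneous of degree -1. *)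
have euler : \sum_j r j 0 *: pd j f r = - f r.
  have E k : r k 0 *: (\sum_j r j 0 *: pd j f r + f r) = 0.
    have [_ e] := pd_radial_extension k 1 oU (sP [set l]%SET) Ur r1.
    have ext y : U y -> (enorm y)^-1 ^+ 1 *: f (radial y) = f y.
      move=> Uy; have y0 := U0 Uy; rewrite [in RHS](enorm_radial y0).
      by rewrite /f potential_scale ?expr1 ?enorm_gt0 //; apply: Uc => //; rewrite invr_gt0 enorm_gt0.
    have := pd_ext k oU Ur ext; rewrite {1}/pd e scale1r -/f.
    by move=> /eqP; rewrite subr_eq addrC -subr_eq subrr eq_sym => /eqP.
  apply/eqP; rewrite -addr_eq0; set s := _ + _ in E *.
  have : \sum_k (r k 0 ^+ 2) *: s = 0.
    by rewrite big1 // => k _; rewrite expr2 -scalerA E scaler0.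
  by rewrite -scaler_suml -/(sqnorm r) r1 scale1r => ->.
have tang : \sum_j r j 0 *: pd l (fun y => P y [set j]%SET) r = - f r.
  have := pd_ext (g := fun _ => 0) l oU Ur radial_potential.
  have dj j := @is_derive_coordZ R _ _ (fun y => P y [set j]%SET) r l j (dP j l).
  have [_ ->] := pd_sum (index_enum _) (fun j => @ex_derive _ _ _ _ _ _ _ (dj j)).
  rewrite {2}/pd derive_cst.
  rewrite (eq_bigr _ (fun j _ => @derive_val _ _ _ _ _ _ _ (dj j))) big_split /=.
  rewrite (bigD1 l) //= eqxx scale1r big1 ?addr0; last first.
    by move=> j /negPf ->; rewrite scale0r.
  by move=> /eqP; rewrite addrC addr_eq0 => /eqP.
rewrite /curv_comp (eq_bigr (fun j => (r j 0 *: pd j f r - r j 0 *: pd l (fun y => P y [set j]%SET) r)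
   + ((r j 0 *: P r [set j]%SET) *m f r - f r *m (r j 0 *: P r [set j]%SET)))); last first.
  move=> j _; rewrite -scalemxAl -scalemxAr -!scalerN -!scalerDr addrA //.
rewrite big_split !sumrB /= euler tang subrr add0r.
by rewrite -mulmx_suml -mulmx_sumr radial_potential // mul0mx mulmx0 subrr.
Qed.
End RadialPotential.
End Cone.

Section Conical.
Variables (R : realType) (m : nat) (G : lie_group R m) (A : connection G).
Implicit Types (x y r : pt R) (k j l : 'I_8).

Lemma chart_neq0 (B : connection G) (b : idx B) y : chart b y -> y != 0.
Proof. by move=> by_; apply/(@chart_cover _ _ _ B); exists b. Qed.

Lemma curvatureE (i : idx A) x : curvature i x = curv (pot i) x.
Proof. by []. Qed.

Lemma pot_h1 (B : connection G) (i : idx B) y : chart i y -> homogeneous 1 (pot i y).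
Proof. exact: pot_1form. Qed.

(** A connection isomorphic to one pulled back from the sphere has, near each
    point, a gauge in which the potential is radial and the domain is a cone; the
    two curvatures are conjugate. *)
Lemma conical_model (A_conical : conical A) (i : idx A) x : chart i x ->
  exists (B : connection G) (b : idx B) (h : idx A -> idx B -> pt R -> 'M[R]_m),
  [/\ chart b x,
      forall y (t : R), chart b y -> 0 < t -> chart b (t *: y),
      forall y, chart b y -> pot b y = radial_pullback (pot b) y &
      forall i' y, chart i' y -> chart b y -> h i' b y \in unitmx /\
        forall j l, h i' b y *m curv_comp (pot b) j l y = curv_comp (pot i') j l y *m h i' b y].
Proof.
move=> ix; have x0 := chart_neq0 ix.
have [B [[h [h1 h2 _ _ h5]] [r1 _ r3]]] := A_conical.
have [b bx] := (@chart_cover _ _ _ B x).2 x0.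
exists B, b, h; split=> // [y t by_ t0|y by_|i' y iy by_].
- have y0 := chart_neq0 by_.
  have ty0 : t *: y != 0 by rewrite scaler_eq0 negb_or y0 gt_eqF.
  by apply/(r1 b _ ty0); rewrite radialZ //; apply/(r1 b _ y0).
- exact: r3.
- split; first exact: (grp_unit (h1 _ _ _ iy by_)).
  move=> j l; have oU : open (chart i' `&` chart b) by apply: openI; exact: chart_open.
  have Uy : (chart i' `&` chart b) y by [].
  apply: (gauge_curv_comp j l oU Uy).
  + by move=> I; exact: (smooth_on_sub (@subIsetl _ (chart i') (chart b)) (@pot_smooth _ _ _ A i' I)).
  + by move=> I; exact: (smooth_on_sub (@subIsetr _ (chart i') (chart b)) (@pot_smooth _ _ _ B b I)).
  + exact: h2.
  + by move=> z [iz bz]; exact: (grp_unit (h1 _ _ _ iz bz)).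
  + by move=> z [iz bz]; exact: h5.
Qed.

Lemma mulmx_unit_eq0 (F g : 'M[R]_m) : g \in unitmx -> F *m g = 0 -> F = 0.
Proof. by move=> gu /(congr1 (mulmx^~ (invmx g))); rewrite mulmxK // mul0mx. Qed.

(** The equation r _| F = 0 is invariant under conjugation, so it may be checked
    in the radial gauge. *)
Lemma conical_curv_comp_radial (A_conical : conical A) (i : idx A) x l : chart i x ->
  \sum_j x j 0 *: curv_comp (pot i) j l x = 0.
Proof.
move=> ix; have [B [b [h [bx bc bp hF]]]] := conical_model A_conical ix.
have [gu gF] := hF i x ix bx.
apply: (mulmx_unit_eq0 gu); rewrite mulmx_suml.
under eq_bigr do rewrite -scalemxAl -gF scalemxAr.
have b0 y : chart b y -> y != 0 by exact: chart_neq0.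
have F0 := @curv_comp_radial R m (chart b) (pot b) (@chart_open _ _ _ _ b) b0 bc
  (@pot_smooth _ _ _ _ b) bp x l bx.
by rewrite -mulmx_sumr F0 mulmx0.
Qed.

(** In a radial gauge the curvature is homogeneous along rays. *)
Lemma conical_curvature_eq0 (A_conical : conical A) :
  (forall (i : idx A) r, chart i r -> sqnorm r = 1 -> forall j l, curv_comp (pot i) j l r = 0) ->
  forall (i : idx A) x, chart i x -> forall j l, curv_comp (pot i) j l x = 0.
Proof.
move=> F0 i x ix j l.
have [B [b [h [bx bc bp hF]]]] := conical_model A_conical ix.
have [gu gF] := hF i x ix bx; have x0 := chart_neq0 ix.
apply: (mulmx_unit_eq0 gu); rewrite -gF.
have n0 := enorm_gt0 x0; have r1 := sqnorm_radial x0.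
have br : chart b (radial x) by apply: bc => //; rewrite invr_gt0.
have [i' ir] := (@chart_cover _ _ _ A (radial x)).2 (sqnorm1_neq0 r1).
have [gu' gF'] := hF i' _ ir br.
have Fb : curv_comp (pot b) j l (radial x) = 0.
  have := gF' j l; rewrite (F0 i' _ ir r1) mul0mx => /(congr1 (mulmx (invmx (h i' b (radial x))))).
  by rewrite mulKmx // mulmx0.
rewrite [in X in h i b x *m X](enorm_radial x0).
have -> := @curv_comp_scale R m (chart b) (pot b) (@chart_open _ _ _ _ b) bc
  (@pot_smooth _ _ _ _ b) bp (radial x) (enorm x) j l br n0.
by rewrite Fb scaler0 mulmx0.
Qed.

(** The matrix entry (p, q) of the values of a 2-form, as an endomorphism of R^8:
    a 2-form has values in Lie(Sp(2)) (x) g exactly in the sense that all these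
    endomorphisms are in Lie(Sp(2)). *)
Definition entry_mx (F : 'I_8 -> 'I_8 -> 'M[R]_m) (p q : 'I_m) : 'M[R]_8 :=
  \matrix_(j, l) F j l p q.

Lemma entry_mxE F p q j l : entry_mx F p q j l = F j l p q.
Proof. by rewrite mxE. Qed.

Lemma lieSp2_lin (s : R) B C : lieSp2 R B -> lieSp2 R C -> lieSp2 R (s *: B + C).
Proof.
move=> [b0 b1 b2 b3] [c0 c1 c2 c3]; split.
- by rewrite linearP /= b0 c0 scalerN opprD.
- by rewrite mulmxDl mulmxDr -scalemxAl -scalemxAr b1 c1.
- by rewrite mulmxDl mulmxDr -scalemxAl -scalemxAr b2 c2.
- by rewrite mulmxDl mulmxDr -scalemxAl -scalemxAr b3 c3.
Qed.

Lemma lieSp20 : lieSp2 R 0.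
Proof. by split; rewrite ?mul0mx ?mulmx0 // trmx0 oppr0. Qed.

Lemma lieSp2_sum (I : Type) (s : seq I) (f : I -> 'M[R]_8) :
  (forall t, lieSp2 R (f t)) -> lieSp2 R (\sum_(t <- s) f t).
Proof.
move=> hf; elim/big_ind: _ => [|B C hB hC|t _]; [exact: lieSp20| |exact: hf].
by rewrite -[B]scale1r; exact: lieSp2_lin.
Qed.

Lemma lieSp2Z (s : R) B : lieSp2 R B -> lieSp2 R (s *: B).
Proof. by move=> hB; rewrite -[_ *: _]addr0; exact: lieSp2_lin lieSp20. Qed.

Hypothesis F_in_sp2 : curvature_in A (lieSp2 R).

Lemma curv_comp_lieSp2 (i : idx A) x p q : chart i x ->
  lieSp2 R (entry_mx (fun j l => curv_comp (pot i) j l x) p q).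
Proof.
move=> ix; have [n [B [X [hB _ E]]]] := F_in_sp2 ix.
have -> : entry_mx (fun j l => curv_comp (pot i) j l x) p q = \sum_t X t p q *: B t.
  apply/matrixP => j l; rewrite mxE summxE -(curv_curv_compE _ _ (pot_h1 ix)) -eval2_delta.
  by rewrite E summxE; apply: eq_bigr => t _; rewrite !mxE mulrC.
by apply: lieSp2_sum => t; exact: lieSp2Z.
Qed.

Lemma curv_comp_lie (i : idx A) x j l : chart i x -> curv_comp (pot i) j l x \in lie G.
Proof.
move=> ix; have [n [B [X [_ hX E]]]] := F_in_sp2 ix.
rewrite -(curv_curv_compE _ _ (pot_h1 ix)) -eval2_delta E.
by apply: memv_suml => t _; rewrite memvZ.
Qed.

Lemma pd_lieSp2 U (B : pt R -> 'M[R]_8) x k : open U -> U x -> smooth_on U B ->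
  (forall y, U y -> lieSp2 R (B y)) -> lieSp2 R (pd k B x).
Proof.
move=> oU Ux sB hB; have dB := derivable_smooth (k := k) sB Ux.
have comm (I : 'M[R]_8) : (forall y, U y -> B y *m I = I *m B y) ->
    pd k B x *m I = I *m pd k B x.
  move=> hI; have dI : derivable (cst I : pt R -> 'M[R]_8) x (delta_mx k 0).
    exact: derivable_cst.
  have := pd_ext k oU Ux hI.
  rewrite (pd_mulmx dB dI) (pd_mulmx dI dB) /pd !derive_cst.
  by rewrite mulmx0 addr0 mul0mx add0r.
split; try by apply: comm => y /hB[].
apply/matrixP => j l; rewrite !mxE !pd_mx //.
have dN : derivable (fun y => B y j l : R^o) x (delta_mx k 0) by move/derivable_mxP: dB.
have h y : U y -> (B y l j : R^o) = - B y j l.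
  by move=> /hB[h _ _ _]; move/matrixP/(_ j l): h; rewrite !mxE.
exact: (etrans (pd_ext (V := R^o) k oU Ux h) (deriveN dN)).
Qed.

(** Lie(Sp(2)) is a constant linear subspace: derivatives of sections with values
    in it stay in it, and the bracket only acts on the factor g. *)
Lemma cov_curv_comp_lieSp2 (i : idx A) x k p q : chart i x ->
  lieSp2 R (entry_mx (fun j l => cov_curv_comp (pot i) k j l x) p q).
Proof.
move=> ix; set a := pot i x [set k]%SET.
have sF j l := smooth_curv_comp j l (@chart_open _ _ _ _ i) (@pot_smooth _ _ _ _ i).
pose B y := entry_mx (fun j l => curv_comp (pot i) j l y) p q.
have sB : smooth_on (chart i) B.
  apply: ((smooth_on_mxP _ (@chart_open _ _ _ _ i)).2) => j l.
  apply: (smooth_on_ext (@chart_open _ _ _ _ i) _ ((smooth_on_mxP _ (@chart_open _ _ _ _ i)).1 (sF j l) p q)) => y _.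
  by rewrite /B [RHS]mxE.
have -> : entry_mx (fun j l => cov_curv_comp (pot i) k j l x) p q = pd k B x +
   (\sum_s a p s *: entry_mx (fun j l => curv_comp (pot i) j l x) s q
   + \sum_s (- a s q) *: entry_mx (fun j l => curv_comp (pot i) j l x) p s).
  apply/matrixP => j l; rewrite mxE /cov_curv_comp mx_addE [RHS]mx_addE; congr (_ + _).
    rewrite pd_mx; last exact: (derivable_smooth (sF j l) ix).
    rewrite pd_mx; last exact: (derivable_smooth sB ix).
    by apply: (pd_ext k (@chart_open _ _ _ _ i) ix) => y _; rewrite /B [RHS]mxE.
  rewrite /bracket mx_addE mx_oppE -/a [RHS]mx_addE !summxE !mxE -sumrN.
  congr (_ + _); apply: eq_bigr => s _; rewrite !mxE //.
  by rewrite mulNr mulrC.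
rewrite -[pd k B x]scale1r; apply: lieSp2_lin.
  apply: (pd_lieSp2 _ (@chart_open _ _ _ _ i) ix sB) => y iy; exact: curv_comp_lieSp2.
rewrite -[X in lieSp2 R (X + _)]scale1r; apply: lieSp2_lin.
  by apply: lieSp2_sum => s; apply: lieSp2Z; exact: curv_comp_lieSp2.
by apply: lieSp2_sum => s; apply: lieSp2Z; exact: curv_comp_lieSp2.
Qed.

End Conical.

(** * Differential operators on the sphere *)

Section CovariantStar.
Variables (R : realType) (m : nat).
Implicit Types (x y r : pt R) (k j l : 'I_8) (U : set (pt R)) (P b : pt R -> ext 'M[R]_m).
Local Notation e_ k := (delta_mx k 0 : pt R).

Lemma is_derive_dxw b k j x K : (forall I, derivable (fun y => b y I) x (e_ k)) ->
  is_derive x (e_ k) (fun y => dxw j (b y) K) (dxw j (pdext k b x) K).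
Proof.
move=> db.
have E : (fun y => dxw j (b y) K) = (fun y => if j \in K then
    esign R [set j]%SET K *: b y (K :\ j)%SET else 0).
  by apply/funext => y; rewrite ffunE.
rewrite E ffunE; case: ifP => _; last exact: is_derive_cst.
rewrite ffunE; split; first exact: derivableZ.
exact: (pdZ _ (db _)).
Qed.

Lemma is_derive_flat_wedge b k x K : (forall I, derivable (fun y => b y I) x (e_ k)) ->
  is_derive x (e_ k) (fun y => swedge (flat y) (b y) K)
    ((dxw k (b x) + swedge (flat x) (pdext k b x)) K).
Proof.
move=> db.
have E : (fun y => swedge (flat y) (b y) K) = (fun y => \sum_j y j 0 *: dxw j (b y) K).
  apply/funext => y; rewrite swedge_flat sum_ffunE; apply: eq_bigr => j _.
  by rewrite ffunE.
have dj j := is_derive_coordZ j (@ex_derive _ _ _ _ _ _ _ (is_derive_dxw j K db)).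
have [d e] := pd_sum (index_enum _) (fun j => @ex_derive _ _ _ _ _ _ _ (dj j)).
rewrite E; split; first exact: d.
apply: (etrans e).
rewrite (eq_bigr _ (fun j _ => @derive_val _ _ _ _ _ _ _ (dj j))) big_split /=.
rewrite (bigD1 k) //= eqxx scale1r big1 ?addr0; last first.
  by move=> j /negPf ->; rewrite scale0r.
rewrite [RHS]ffunE; congr (_ + _); rewrite swedge_flat sum_ffunE; apply: eq_bigr => j _.
by rewrite [RHS]ffunE; congr (_ *: _); have [_] := is_derive_dxw j K db.
Qed.

Lemma pdext_star_flat b k x : (forall I, derivable (fun y => b y I) x (e_ k)) ->
  pdext k (fun y => star (swedge (flat y) (b y))) x =
  star (dxw k (b x) + swedge (flat x) (pdext k b x)).
Proof.
move=> db; apply/ffunP => K; rewrite ffunE [RHS]ffunE.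
have E : (fun y => star (swedge (flat y) (b y)) K) =
    (fun y => esign R (~: K)%SET K *: swedge (flat y) (b y) (~: K)%SET).
  by apply/funext => y; rewrite ffunE.
have [d e] := is_derive_flat_wedge (~: K)%SET db.
by rewrite E (pdZ _ d) -e.
Qed.

Lemma bracketZ (a c : 'M[R]_m) (s : R) : bracket a (s *: c) = s *: bracket a c.
Proof. by rewrite /bracket -scalemxAr -scalemxAl scalerBr. Qed.

Lemma bracket_sum (a : 'M[R]_m) (I : Type) (s : seq I) (c : I -> 'M[R]_m) :
  bracket a (\sum_(t <- s) c t) = \sum_(t <- s) bracket a (c t).
Proof. by rewrite /bracket mulmx_sumr mulmx_suml -sumrB. Qed.

Lemma brext_star k P x (c : ext 'M[R]_m) : brext k P x (star c) = star (brext k P x c).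
Proof. by apply/ffunP => K; rewrite !ffunE bracketZ. Qed.

Lemma brext_flat k P x v (c : ext 'M[R]_m) :
  brext k P x (swedge (flat v) c) = swedge (flat v) (brext k P x c).
Proof.
rewrite !swedge_flat; apply/ffunP => K; rewrite ffunE !sum_ffunE bracket_sum.
apply: eq_bigr => j _; rewrite !ffunE bracketZ; congr (_ *: _).
by case: ifP => _; rewrite ?bracketZ ?ffunE // /bracket mulmx0 mul0mx subrr.
Qed.

(** The Leibniz rule for the 7-dimensional star, written as the star of
    r^flat /\ b: the derivative of r^flat in the direction e_k is dx^k. *)
Lemma cov_star_flat b k P x : (forall I, derivable (fun y => b y I) x (e_ k)) ->
  cov k P (fun y => star (swedge (flat y) (b y))) x =
  star (dxw k (b x) + swedge (flat x) (cov k P b x)).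
Proof.
move=> db; rewrite /cov pdext_star_flat // brext_star brext_flat -linearD /=.
by rewrite -addrA -linearD.
Qed.

Lemma smooth_star_flat U b : open U -> smooth_form U b ->
  smooth_form U (fun y => star (swedge (flat y) (b y))).
Proof.
move=> oU sb K.
have h j : smooth_on U (fun y : pt R => y j 0 *: dxw j (b y) (~: K)%SET).
  apply: (smooth_onZ oU); first exact: smooth_on_coord.
  have E : (fun y => dxw j (b y) (~: K)%SET) = (fun y => if j \in (~: K)%SET then
      esign R [set j]%SET (~: K)%SET *: b y (~: K :\ j)%SET else 0).
    by apply/funext => y; rewrite ffunE.
  rewrite E; case: (j \in (~: K)%SET); last exact: smooth_on_cst.
  by apply: (smooth_onZ oU (@smooth_on_cst R R^o U _)); exact: sb.
have H := smooth_onZ oU (@smooth_on_cst R R^o U (esign R (~: K)%SET K))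
   (smooth_on_sum (index_enum _) oU h).
apply: (smooth_on_ext oU _ H) => y _; rewrite [RHS]ffunE swedge_flat sum_ffunE.
by congr (_ *: _); apply: eq_bigr => j _; rewrite [RHS]ffunE.
Qed.

Lemma cone_open U : open U -> open [set y : pt R | y != 0 /\ U (radial y)].
Proof.
move=> oU; rewrite openE => y [y0 Uy].
have cr : {for y, continuous (@radial R)}.
  apply: ((continuous_mxP _ _).2) => j i; rewrite ord1.
  have [d _] := smooth_upto_differentiable (@open_neq0 R) y0 (@smooth_upto_radial R 1%N j).
  exact: differentiable_continuous.
have n1 : \forall z \near y, z != 0 by exact: (near_open (@open_neq0 R) y0).
have n2 : \forall z \near y, U (radial z) by apply: cr; exact: near_open.
by apply: (@filterS2 _ _ (nbhs_filter y) _ _ _ _ n1 n2) => z.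
Qed.
End CovariantStar.

Section OnSphere.
Variables (R : realType) (m : nat) (G : lie_group R m) (A : connection G).
Implicit Types (x y r s : pt R) (k j l : 'I_8) (i : idx A).

Lemma sumsq r : \sum_k r k 0 * r k 0 = sqnorm r.
Proof. by apply: eq_bigr => k _; rewrite expr2. Qed.

Lemma radial_pullbackE (b f : pt R -> ext 'M[R]_m) i y :
  (forall s, chartS i s -> b s = f s) ->
  (forall s, chartS i s -> Defs.contract s (f s) = 0) ->
  y != 0 -> chart i (radial y) ->
  forall K, radial_pullback b y K = (enorm y)^-1 ^+ #|K| *: f (radial y) K.
Proof.
move=> bf tf y0 iy K; rewrite ffunE.
have iS : chartS i (radial y) by split=> //; apply/S7_sqnorm; exact: sqnorm_radial.
by rewrite bf // restrictS_id // ?tf // sumsq sqnorm_radial.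
Qed.

(** A tangential form f defined near the sphere may replace the radial pullback:
    their covariant derivatives differ by a multiple of r^flat, by
    pd_radial_extension, and restriction kills it. *)
Lemma extDS_radial (b f : pt R -> ext 'M[R]_m) i r : chartS i r ->
  smooth_form (chart i) f ->
  (forall s, chartS i s -> b s = f s) ->
  (forall s, chartS i s -> Defs.contract s (f s) = 0) ->
  extDS i b r = restrictS r (extD i f r).
Proof.
move=> [ir /S7_sqnorm r1] sf bf tf.
have oC := @chart_open _ _ _ A i.
pose C := [set y : pt R | y != 0 /\ chart i (radial y)].
have oCone : open C by exact: cone_open.
have rr := radial_id r1.
have Cr : C r by split; [exact: sqnorm1_neq0|rewrite rr].
have rpE y K : C y -> radial_pullback b y K = (enorm y)^-1 ^+ #|K| *: f (radial y) K.
  by move=> [y0 iy]; exact: (radial_pullbackE bf tf).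
have rpr : radial_pullback b r = f r.
  apply/ffunP => K; rewrite rpE // rr.
  have -> : enorm r = 1 by rewrite /enorm -/(sqnorm r) r1 sqrtr1.
  by rewrite invr1 expr1n scale1r.
(* The common radial correction of all the partial derivatives. *)
pose Gf : ext 'M[R]_m := [ffun K : {set 'I_8} =>
  \sum_j r j 0 *: pd j (fun y => f y K) r + #|K|%:R *: f r K].
have pdE k : pdext k (radial_pullback b) r = pdext k f r - r k 0 *: Gf.
  apply/ffunP => K; rewrite !ffunE.
  have [_ e] := pd_radial_extension k #|K| oC (sf K) ir r1.
  by apply: (etrans (pd_ext k oCone Cr (fun y => @rpE y K))); exact: e.
have E : extD i (radial_pullback b) r = extD i f r - swedge (flat r) Gf.
  rewrite /extD rpr !extdE addrAC; congr (_ + _).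
  rewrite (eq_bigr _ (fun k _ => congr1 (dxw k) (pdE k))) swedge_flat -sumrB.
  by apply: eq_bigr => k _; rewrite linearB /= linearZ.
rewrite /extDS E /restrictS linearB /= linearB /=.
by rewrite flat_wedgeK linear0 subr0.
Qed.
End OnSphere.

Lemma lambda21_ext (R : realType) (T T' : nat -> nat -> R) :
  (forall a b, T' a b = T a b) -> lambda21 T -> lambda21 T'.
Proof. by move=> E; rewrite /lambda21 !E. Qed.

Section Entries.
Variables (R : realType) (m : nat).
Implicit Types (a : ext 'M[R]_m) (p q : 'I_m).

Definition entry_ext p q a : ext R^o := [ffun K : {set 'I_8} => a K p q].

Lemma entry_extP a b : (forall p q, entry_ext p q a = entry_ext p q b) -> a = b.
Proof.
move=> h; apply/ffunP => K; apply/matrixP => p q.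
by have /ffunP/(_ K) := h p q; rewrite !ffunE.
Qed.

Lemma entry_star p q a : entry_ext p q (star a) = star (entry_ext p q a).
Proof. by apply/ffunP => K; rewrite !ffunE mxE. Qed.

Lemma entry_swedge p q (c : ext R) a :
  entry_ext p q (swedge c a) = swedge c (entry_ext p q a).
Proof.
apply/ffunP => K; rewrite !ffunE summxE; apply: eq_bigr => I _.
by rewrite !mxE !ffunE.
Qed.

(** Psi0 acts on each matrix entry separately. *)
Lemma psi_wedge_mx a : homogeneous 2 a ->
  (forall p q, lambda21 (fun i j => ctr (inord i) a [set inord j]%SET p q)) ->
  swedge (Psi0 R) a = - star a.
Proof.
move=> ha h21; apply: entry_extP => p q.
have -> : entry_ext p q (- star a) = - star (entry_ext p q a).
  by rewrite -entry_star; apply/ffunP => K; rewrite !ffunE mxE.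
rewrite entry_swedge; apply: psi_wedge.
  by move=> K K2; rewrite ffunE ha // mxE.
have E (i j : nat) : (i < j)%N -> (j < 8)%N ->
    entry_ext p q a (setof [:: i; j]) = ctr (inord i) a [set inord j]%SET p q.
  move=> ij j8; have i8 := ltn_trans ij j8.
  rewrite ffunE -setof2 /= ?inordK //.
by have := h21 p q; rewrite /lambda21 /= !E.
Qed.
End Entries.

(** * The forms alpha_M satisfy the deformation equations *)

Section Kernel.
Variables (R : realType) (m : nat) (G : lie_group R m) (A : connection G).
Implicit Types (x y r s : pt R) (k j l : 'I_8) (i : idx A) (M : 'M[R]_8).
Hypotheses (A_conical : conical A) (F_in_sp2 : curvature_in A (lieSp2 R)).
Local Notation e_ k := (delta_mx k 0 : pt R).

(** The same contraction on the whole chart, where the flat calculus of R^8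
    applies. *)
Definition alpha_field M i x : ext 'M[R]_m := Defs.contract (M *m x) (curvature i x).

Lemma alpha_field_homogeneous M i x : chart i x -> homogeneous 1 (alpha_field M i x).
Proof.
move=> ix; apply: homogeneous_contract.
by apply: (homogeneous_curv (@chart_open _ _ _ A i) ix) => y; exact: pot_h1.
Qed.

Lemma alpha_fieldE M i x l : chart i x ->
  alpha_field M i x [set l]%SET = \sum_j (M *m x) j 0 *: curv_comp (pot i) j l x.
Proof.
move=> ix; rewrite /alpha_field contract1; apply: eq_bigr => j _.
by rewrite curvatureE curv_curv_compE //; exact: pot_h1.
Qed.

Lemma curv_comp_skew i x j l : curv_comp (pot i) j l x = - curv_comp (pot i) l j x.
Proof. by rewrite /curv_comp; apply/matrixP => p q; rewrite !(mx_addE, mx_oppE); ring. Qed.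

(** Contraction of F with r twice: r _| F = 0. *)
Lemma alpha_field_radial M i x : chart i x -> Defs.contract x (alpha_field M i x) = 0.
Proof.
move=> ix; apply/ffunP => K; rewrite [RHS]ffunE.
have [/eqP|K0] := eqVneq #|K| 0%N; last first.
  by rewrite (homogeneous_contract x (alpha_field_homogeneous M ix)).
rewrite cards_eq0 => /eqP ->; rewrite contract_set0.
rewrite (eq_bigr (fun l => \sum_j (M *m x) j 0 *: - (x l 0 *: curv_comp (pot i) l j x))).
  rewrite exchange_big big1 // => j _; rewrite -scaler_sumr sumrN.
  by rewrite conical_curv_comp_radial // oppr0 scaler0.
move=> l _; rewrite alpha_fieldE // scaler_sumr; apply: eq_bigr => j _.
by rewrite curv_comp_skew !scalerN scalerA mulrC -scalerA.
Qed.

Lemma alphaE M i r : chartS i r -> alpha A M i r = alpha_field M i r.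
Proof.
move=> ir; rewrite /alpha asboolT //; apply: restrictS_id.
  by rewrite sumsq; apply/S7_sqnorm; exact: ir.2.
by apply: alpha_field_radial; exact: ir.1.
Qed.

Lemma alpha_field_smooth M i : smooth_form (chart i) (alpha_field M i).
Proof.
move=> K; have oC := @chart_open _ _ _ A i.
have [/eqP/cards1P[l ->]|K1] := eqVneq #|K| 1%N; last first.
  apply: (smooth_on_ext oC _ (@smooth_on_cst R _ _ 0)) => y iy.
  by rewrite (alpha_field_homogeneous M iy).
have s j : smooth_on (chart i) (fun x => ((M *m x) j 0 : R^o) *: curv_comp (pot i) j l x).
  apply: (smooth_onZ oC); last exact: (smooth_curv_comp j l oC (@pot_smooth _ _ _ A i)).
  have h k := smooth_onM oC (@smooth_on_cst R R^o (chart i) (M j k)) (smooth_on_coord k oC).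
  apply: (smooth_on_ext oC _ (smooth_on_sum (index_enum _) oC h)) => y _.
  by rewrite mxE.
apply: (smooth_on_ext oC _ (smooth_on_sum (index_enum _) oC s)) => y iy.
by rewrite alpha_fieldE.
Qed.

Lemma alpha_derivable M i x k K : chart i x ->
  derivable (fun y => alpha_field M i y K) x (e_ k).
Proof. by move=> ix; exact: (derivable_smooth (@alpha_field_smooth M i K) ix). Qed.

Lemma cov_alpha M i x k l : chart i x ->
  cov k (pot i) (alpha_field M i) x [set l]%SET =
  \sum_j M j k *: curv_comp (pot i) j l x + \sum_j (M *m x) j 0 *: cov_curv_comp (pot i) k j l x.
Proof.
move=> ix; have oC := @chart_open _ _ _ A i.
have dF j := derivable_smooth (k := k) (smooth_curv_comp j l oC (@pot_smooth _ _ _ A i)) ix.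
have D j : is_derive x (e_ k) (fun y => (M *m y) j 0 *: curv_comp (pot i) j l y)
    (M j k *: curv_comp (pot i) j l x + (M *m x) j 0 *: pd k (curv_comp (pot i) j l) x).
  have E : (fun y : pt R => (M *m y) j 0 *: curv_comp (pot i) j l y) =
     (fun y => \sum_t M j t *: (y t 0 *: curv_comp (pot i) j l y)).
    apply/funext => y; rewrite mxE scaler_suml; apply: eq_bigr => t _.
    by rewrite scalerA.
  have dt t := is_derive_coordZ t (dF j).
  have dt' t : derivable (fun y : pt R => M j t *: (y t 0 *: curv_comp (pot i) j l y)) x (e_ k).
    by apply: derivableZ; exact: ex_derive.
  have [d e] := pd_sum (index_enum _) dt'.
  rewrite E; split; first exact: d.
  apply: (etrans e).
  rewrite (eq_bigr (fun t => M j t *: ((t == k)%:R *: curv_comp (pot i) j l x)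
      + M j t *: (x t 0 *: pd k (curv_comp (pot i) j l) x))); last first.
    move=> t _; have [d1 e1] := dt t.
    by rewrite (pdZ _ d1) {1}/pd e1 scalerDr.
  rewrite big_split /=; congr (_ + _).
    rewrite (bigD1 k) //= eqxx scale1r big1 ?addr0 // => t /negPf ->.
    by rewrite scale0r scaler0.
  by rewrite mxE scaler_suml; apply: eq_bigr => t _; rewrite scalerA.
have [dS eS] := pd_sum (index_enum _) (fun j => @ex_derive _ _ _ _ _ _ _ (D j)).
rewrite /cov ffunE [X in X + _]ffunE [X in _ + X]ffunE.
rewrite (pd_ext k oC ix (fun y iy => alpha_fieldE M l iy)) eS.
rewrite (eq_bigr _ (fun j _ => @derive_val _ _ _ _ _ _ _ (D j))) big_split /= -addrA.
congr (_ + _); rewrite alpha_fieldE // bracket_sum -big_split; apply: eq_bigr => j _ /=.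
by rewrite bracketZ -scalerDr.
Qed.

(** Derivative of the equation r _| F = 0. *)
Lemma sum_radial_cov_curv_comp i x k l : chart i x ->
  \sum_j x j 0 *: cov_curv_comp (pot i) k j l x = - curv_comp (pot i) k l x.
Proof.
move=> ix; have oC := @chart_open _ _ _ A i.
have dF j := derivable_smooth (k := k) (smooth_curv_comp j l oC (@pot_smooth _ _ _ A i)) ix.
have dj j := is_derive_coordZ j (dF j).
have [d e] := pd_sum (index_enum _) (fun j => @ex_derive _ _ _ _ _ _ _ (dj j)).
have := pd_ext (g := fun _ => 0) k oC ix (fun y iy => conical_curv_comp_radial A_conical l iy).
rewrite {2}/pd derive_cst e (eq_bigr _ (fun j _ => @derive_val _ _ _ _ _ _ _ (dj j))) big_split /=.
rewrite (bigD1 k) //= eqxx scale1r big1 ?addr0; last first.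
  by move=> j /negPf ->; rewrite scale0r.
move=> /eqP; rewrite addrC addr_eq0 => /eqP <-.
rewrite /cov_curv_comp (eq_bigr (fun j => x j 0 *: pd k (curv_comp (pot i) j l) x +
   bracket (pot i x [set k]%SET) (x j 0 *: curv_comp (pot i) j l x))); last first.
  by move=> j _; rewrite bracketZ -scalerDr.
rewrite big_split /= -bracket_sum conical_curv_comp_radial //.
by rewrite /bracket mulmx0 mul0mx subrr addr0.
Qed.

(** Derivative of the equation r _| alpha = 0. *)
Lemma radial_cov_alpha M i x k : chart i x ->
  \sum_l x l 0 *: cov k (pot i) (alpha_field M i) x [set l]%SET =
  - alpha_field M i x [set k]%SET.
Proof.
move=> ix; have oC := @chart_open _ _ _ A i.
have dF l := @alpha_derivable M i x k [set l]%SET ix.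
have dj l := is_derive_coordZ l (dF l).
have [d e] := pd_sum (index_enum _) (fun l => @ex_derive _ _ _ _ _ _ _ (dj l)).
have rad y : chart i y -> \sum_l y l 0 *: alpha_field M i y [set l]%SET = 0.
  by move=> iy; rewrite -contract_set0 alpha_field_radial // ffunE.
have := pd_ext (g := fun _ => 0) k oC ix rad.
rewrite {2}/pd derive_cst e (eq_bigr _ (fun l _ => @derive_val _ _ _ _ _ _ _ (dj l))) big_split /=.
rewrite (bigD1 k) //= eqxx scale1r big1 ?addr0; last first.
  by move=> l /negPf ->; rewrite scale0r.
move=> /eqP; rewrite addrC addr_eq0 => /eqP <-.
rewrite (eq_bigr (fun l => x l 0 *: pd k (fun y => alpha_field M i y [set l]%SET) x +
   bracket (pot i x [set k]%SET) (x l 0 *: alpha_field M i x [set l]%SET))); last first.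
  by move=> l _; rewrite bracketZ -scalerDr /cov ffunE /pdext /brext [X in X + _]ffunE [X in _ + X]ffunE.
rewrite big_split /= -bracket_sum rad //.
by rewrite /bracket mulmx0 mul0mx subrr addr0.
Qed.

(** Entry by entry, this is contraction_field_algebra. *)
Lemma alpha_field_equations M i x (c := fun k => cov k (pot i) (alpha_field M i) x) :
  W012 R M -> chart i x ->
  [/\ forall p q, lambda21 (fun a b => (c (inord a) [set inord b]%SET
                     - c (inord b) [set inord a]%SET) p q),
      forall l, \sum_k x k 0 *: (c k [set l]%SET - c l [set k]%SET) = 0 &
      \sum_k c k [set k]%SET = 0].
Proof.
move=> MW ix; have oC := @chart_open _ _ _ A i.
pose F p q := entry_mx (fun j l => curv_comp (pot i) j l x) p q.
pose N p q k := entry_mx (fun j l => cov_curv_comp (pot i) k j l x) p q.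
have cE k l p q : c k [set l]%SET p q =
    \sum_j M j k * F p q j l + \sum_j (M *m x) j 0 * N p q k j l.
  rewrite /c cov_alpha // mx_addE !summxE; congr (_ + _); apply: eq_bigr => j _.
    by rewrite /F entry_mxE mx_scaleE.
  by rewrite /N entry_mxE mx_scaleE.
have H p q := @contraction_field_algebra R x M (F p q) (N p q) MW
  (curv_comp_lieSp2 F_in_sp2 p q ix) (fun k => cov_curv_comp_lieSp2 F_in_sp2 k p q ix).
have zE p q : (0 : 'M[R]_m) p q = 0 by rewrite mxE.
have bi p q a b k : N p q k a b + N p q a b k + N p q b k a = 0.
  have := bianchi k a b oC ix (@pot_smooth _ _ _ A i).
  by move=> /matrixP/(_ p q); rewrite mx_add3E zE /N !entry_mxE.
have sF p q l : \sum_a x a 0 * F p q a l = 0.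
  have /matrixP/(_ p q) := conical_curv_comp_radial A_conical l ix.
  rewrite summxE zE => h; rewrite -[RHS]h; apply: eq_bigr => a _.
  by rewrite /F entry_mxE mx_scaleE.
have sN p q k l : \sum_a x a 0 * N p q k a l = - F p q k l.
  have /matrixP/(_ p q) := sum_radial_cov_curv_comp k l ix.
  rewrite summxE mx_oppE => h; rewrite /F entry_mxE -h; apply: eq_bigr => a _.
  by rewrite /N entry_mxE mx_scaleE.
have {}H p q := H p q (bi p q) (sF p q) (sN p q).
have subE k l p q : (c k [set l]%SET - c l [set k]%SET) p q =
    c k [set l]%SET p q - c l [set k]%SET p q by rewrite mx_addE mx_oppE.
split=> [p q|l|].
- have [h _ _] := H p q; apply: (lambda21_ext _ h) => a b.
  by rewrite subE !cE.
- apply/matrixP => p q; rewrite zE summxE; have [_ h _] := H p q.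
  rewrite -[RHS](h l); apply: eq_bigr => k _.
  by rewrite mx_scaleE subE !cE.
- apply/matrixP => p q; rewrite zE summxE; have [_ _ h] := H p q.
  by rewrite -[RHS]h; apply: eq_bigr => k _; rewrite cE.
Qed.

(** For the second component, r _| D_A alpha = 0 by the radial equations, so
    D_A alpha is its own restriction; then * (Psi0 /\ D_A alpha) = - D_A alpha turns
    r^flat /\ psi /\ D_A alpha into a star of r _| D_A alpha. For the first one,
    the Clifford relations reduce D_A of the star of alpha to the star of a 1-form d, computed
    from alpha, its radial derivative and its divergence, and only r _| d matters. *)
Lemma alpha_LA M i r : W012 R M -> chartS i r -> LA (alpha A M) i r = 0.
Proof.
move=> MW irS; have [ir /S7_sqnorm r1] := irS; have oC := @chart_open _ _ _ A i.
have [h21 hrad hdiv] := alpha_field_equations MW ir.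
set c := fun k => cov k (pot i) (alpha_field M i) r in h21 hrad hdiv.
have h1 y : chart i y -> homogeneous 1 (alpha_field M i y).
  exact: alpha_field_homogeneous.
have hc k : homogeneous 1 (c k).
  exact: (@homogeneous_cov R m 1 (chart i) (pot i) (alpha_field M i) k r oC ir h1).
have vr : \sum_k r k 0 * r k 0 = 1 by rewrite sumsq.
have sb := @alpha_field_smooth M i.
have db I k : derivable (fun y => alpha_field M i y I) r (e_ k).
  exact: alpha_derivable.
have bE s : chartS i s -> alpha A M i s = alpha_field M i s by exact: alphaE.
have bt s : chartS i s -> Defs.contract s (alpha_field M i s) = 0.
  by move=> [is_ _]; exact: alpha_field_radial.
pose beta := \sum_k dxw k (c k).
have hbeta : homogeneous 2 beta by apply: homogeneous_sum => k; exact: homogeneous_dxw.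
have betaE a b : ctr a beta [set b]%SET = c a [set b]%SET - c b [set a]%SET.
  exact: ctr_sum_dxw.
have betaD : extD i (alpha_field M i) r = beta by exact: (extD_cov _ (pot_h1 ir)).
have beta_rad : Defs.contract r beta = 0.
  apply: ext1P; [exact: homogeneous_contract|by move=> K _; rewrite ffunE|].
  move=> l; rewrite contract1 [RHS]ffunE -[RHS](hrad l); apply: eq_bigr => k _.
  by rewrite betaE.
have hpsi : swedge (Psi0 R) beta = - star beta.
  apply: psi_wedge_mx => // p q; apply: (lambda21_ext _ (h21 p q)) => a b.
  by rewrite betaE.
rewrite /LA; congr pair; last first.
  rewrite (extDS_radial irS sb bE bt) betaD (restrictS_id vr beta_rad).
  rewrite /starS -flat_wedge_assoc /psi (flat_wedge_restrictS _ vr) flat_wedge_assoc hpsi.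
  rewrite linearN /= (flat_wedge_star _ (isT : (1 < 8)%N) hbeta) beta_rad.
  by rewrite linear0 scaler0 oppr0 linear0.
pose h y := star (swedge (flat y) (alpha_field M i y)).
have hE s : chartS i s -> starS s (alpha A M i s) = h s.
  by move=> iS; rewrite bE.
have ht s : chartS i s -> Defs.contract s (h s) = 0.
  move=> [is_ _]; rewrite /h.
  have h2 := homogeneous_flat_wedge s (h1 s is_).
  by rewrite (contract_star _ (isT : (2 < 8)%N) h2) flat_wedgeK linear0 scaler0.
have hh1 : homogeneous 1 (pot i r) by exact: pot_h1.
rewrite /coDS (extDS_radial irS (smooth_star_flat oC sb) hE ht).
rewrite /starS (flat_wedge_restrictS _ vr).
have -> : extD i h r = \sum_k dxw k (cov k (pot i) h r) by exact: extD_cov.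
pose d := \sum_k ctr k (dxw k (alpha_field M i r) + swedge (flat r) (c k)).
have hk k : homogeneous 2 (dxw k (alpha_field M i r) + swedge (flat r) (c k)).
  apply: homogeneousD; first exact/homogeneous_dxw/h1.
  exact: homogeneous_flat_wedge.
have -> : \sum_k dxw k (cov k (pot i) h r) = - star d.
  rewrite /d linear_sum -sumrN; apply: eq_bigr => k _.
  rewrite (cov_star_flat _ (fun I => db I k)) -/(c k).
  by rewrite (dxw_star_homogeneous k (isT : (1 < 8)%N) (hk k)) expr1 scaleN1r.
have hd : homogeneous 1 d.
  by apply: homogeneous_sum => k; exact: homogeneous_ctr.
rewrite linearN /= (flat_wedge_star _ (isT : (0 < 8)%N) hd).
suff -> : Defs.contract r d = 0 by rewrite linear0 scaler0 oppr0 linear0 oppr0.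
have alpha_rad : Defs.contract r (alpha_field M i r) = 0 by exact: alpha_field_radial.
(* In full d = 7 alpha + nabla_r alpha - (div alpha) r^flat, and div alpha = 0;
   the coefficient 7 is 8 - 1 from tracing the Clifford relation. *)
have dE : d = 7 *: alpha_field M i r + \sum_k r k 0 *: c k.
  have E k : ctr k (dxw k (alpha_field M i r) + swedge (flat r) (c k)) =
      (alpha_field M i r - dxw k (ctr k (alpha_field M i r))) +
      (r k 0 *: c k - swedge (flat r) (ctr k (c k))).
    rewrite linearD /=; congr (_ + _).
      apply/eqP; rewrite eq_sym subr_eq eq_sym; apply/eqP.
      by rewrite clifford eqxx scale1r.
    apply/eqP; rewrite eq_sym subr_eq eq_sym; apply/eqP.
    rewrite -!contract_delta contract_flat_wedge; congr (_ *: _).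
    rewrite (bigD1 k) //= big1 ?addr0 ?mxE ?eqxx ?mul1r // => j /negPf jk.
    by rewrite mxE jk mul0r.
  rewrite /d (eq_bigr _ (fun k _ => E k)) big_split !sumrB /=.
  have -> : \sum_k swedge (flat r) (ctr k (c k)) = 0.
    rewrite -linear_sum /=.
    have -> : \sum_k ctr k (c k) = 0; last by rewrite linear0.
    apply/ffunP => K; rewrite sum_ffunE [RHS]ffunE.
    have [/eqP|K0] := eqVneq #|K| 0%N; last first.
      by rewrite big1 // => k _; rewrite (homogeneous_ctr k (hc k)).
    rewrite cards_eq0 => /eqP ->; rewrite -[RHS]hdiv; apply: eq_bigr => k _.
    by rewrite ctr_set0.
  have -> : \sum_k dxw k (ctr k (alpha_field M i r)) = alpha_field M i r.
    apply: ext1P; [|exact: h1|].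
      by apply: homogeneous_sum => k; exact/homogeneous_dxw/homogeneous_ctr/h1.
    move=> l; rewrite sum_ffunE (bigD1 l) //= big1 ?addr0.
      rewrite ffunE inE eqxx esign_self1 scale1r finset.setDv ctr_set0 //.
    by move=> k /negPf kl; rewrite ffunE inE kl.
  rewrite sumr_const card_ord subr0 -scaler_nat; congr (_ + _).
  by rewrite -{2}[alpha_field M i r]scale1r -scalerBl; congr (_ *: _); ring.
rewrite dE linearD linearZ /= alpha_rad scaler0 add0r linear_sum /=.
rewrite (eq_bigr (fun k => - (r k 0 *: ctr k (alpha_field M i r)))).
  by rewrite sumrN -contractE alpha_rad oppr0.
(* 0 = nabla_k (r _| alpha) = e_k _| alpha + r _| nabla_k alpha. *)
move=> k _; rewrite linearZ /= -scalerN; congr (_ *: _).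
apply/ffunP => K; rewrite [RHS]ffunE.
have [/eqP|K0] := eqVneq #|K| 0%N; last first.
  rewrite (homogeneous_contract r (hc k)) //.
  by rewrite (homogeneous_ctr k (h1 r ir)) // oppr0.
rewrite cards_eq0 => /eqP ->; rewrite contract_set0 ctr_set0.
exact: radial_cov_alpha.
Qed.
End Kernel.

Section Sections.
Variables (R : realType) (m : nat) (G : lie_group R m) (A : connection G).
Implicit Types (x y r s : pt R) (k j l : 'I_8) (i : idx A) (M : 'M[R]_8).
Hypotheses (A_conical : conical A) (F_in_sp2 : curvature_in A (lieSp2 R)).

Lemma alpha_field_lie M i x K : chart i x -> alpha_field M i x K \in lie G.
Proof.
move=> ix.
have [/eqP/cards1P[l ->]|K1] := eqVneq #|K| 1%N; last first.
  by rewrite (alpha_field_homogeneous M ix) // mem0v.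
rewrite alpha_fieldE //; apply: memv_suml => j _.
by rewrite memvZ // (curv_comp_lie F_in_sp2).
Qed.

Lemma curv_comp_trans i i' x j l : chart i x -> chart i' x ->
  curv_comp (pot i') j l x = invmx (trans i i' x) *m curv_comp (pot i) j l x *m trans i i' x.
Proof.
move=> ix ix'; have oU : open (chart i `&` chart i') by apply: openI; exact: chart_open.
have gu y : (chart i `&` chart i') y -> trans i i' y \in unitmx.
  by move=> [iy iy']; exact: (grp_unit (trans_grp iy iy')).
have Ux : (chart i `&` chart i') x by [].
have E : trans i i' x *m curv_comp (pot i') j l x = curv_comp (pot i) j l x *m trans i i' x.
  apply: (gauge_curv_comp j l oU Ux).
  + by move=> I; exact: (smooth_on_sub (@subIsetl _ (chart i) (chart i')) (@pot_smooth _ _ _ A i I)).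
  + by move=> I; exact: (smooth_on_sub (@subIsetr _ (chart i) (chart i')) (@pot_smooth _ _ _ A i' I)).
  + exact: trans_smooth.
  + exact: gu.
  + by move=> z [iz iz']; exact: pot_trans.
by rewrite -mulmxA -E mulKmx // gu.
Qed.

Lemma alpha_field_trans M i i' x K : chart i x -> chart i' x ->
  alpha_field M i' x K = invmx (trans i i' x) *m alpha_field M i x K *m trans i i' x.
Proof.
move=> ix ix'.
have [/eqP/cards1P[l ->]|K1] := eqVneq #|K| 1%N; last first.
  rewrite (alpha_field_homogeneous M ix) // (alpha_field_homogeneous M ix') //.
  by rewrite mulmx0 mul0mx.
rewrite !alpha_fieldE // mulmx_sumr mulmx_suml; apply: eq_bigr => j _.
by rewrite -scalemxAr -scalemxAl (curv_comp_trans j l ix ix').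
Qed.

(** The radial pullback of alpha is, since alpha is tangential, a power of the inverse norm
    times the composition of the contraction with the radial projection, hence
    smooth. *)
Lemma alpha_Omega M : Omega A 1 (alpha A M).
Proof.
split.
- by move=> i r ir; rewrite /alpha asboolF.
- move=> i r ir; rewrite alphaE //; split.
  + exact: (alpha_field_homogeneous M ir.1).
  + exact: (alpha_field_radial A_conical M ir.1).
  + by move=> I; exact: (alpha_field_lie M I ir.1).
- move=> i j r ir jr I; rewrite !alphaE //.
  exact: (alpha_field_trans M I ir.1 jr.1).
- move=> i K; have oC := @chart_open _ _ _ A i.
  have E : [set x : pt R | x != 0 /\ chartS i (radial x)] =
      [set x | x != 0 /\ chart i (radial x)].
    apply/seteqP; split=> x [x0 ix]; split=> //; first exact: ix.1.
    by split=> //; apply/S7_sqnorm; exact: sqnorm_radial.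
  rewrite E; have oU := cone_open oC.
  have sf : smooth_on [set x | x != 0 /\ chart i (radial x)]
      (fun y => (enorm y)^-1 ^+ #|K| *: alpha_field M i (radial y) K).
    apply: (smooth_on_radial_extension (V := chart i) (f := fun y => alpha_field M i y K) #|K| oU oC).
    - by move=> x [].
    - by move=> x [].
    - exact: (@alpha_field_smooth _ _ _ A M i K).
  apply: (smooth_on_ext oU _ sf) => y [y0 iy].
  apply/esym; apply: (@radial_pullbackE _ _ _ A (alpha A M i) (alpha_field M i) i) => //.
    by move=> s iS; exact: alphaE.
  by move=> s iS; exact: (alpha_field_radial A_conical M iS.1).
Qed.

Lemma VA_kerL : VA A `<=` kerL A.
Proof.
move=> _ [M MW <-]; split; first exact: alpha_Omega.
by move=> i r ir; exact: alpha_LA.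
Qed.

End Sections.

(** * Injectivity and the dimension *)

Section Dimension.
Variables (R : realType) (m : nat) (G : lie_group R m) (A : connection G).
Implicit Types (x y r s v : pt R) (k j l : 'I_8) (i : idx A) (M : 'M[R]_8).
Hypotheses (A_conical : conical A) (F_in_sp2 : curvature_in A (lieSp2 R)).

Lemma open_line (U : set (pt R)) r v : open U -> U r ->
  exists2 e : R, 0 < e & forall t : R, `|t| < e -> U (r + t *: v).
Proof.
move=> oU Ur.
have c : {for (0 : R), continuous (fun t : R => r + t *: v)}.
  apply: continuousD; first exact: cst_continuous.
  by apply: continuousZl; exact: cvg_id.
have : nbhs (r + (0 : R) *: v) U by rewrite scale0r addr0; exact: open_nbhs_nbhs.
move=> /c /nbhs_ballP[e e0 he]; exists e => // t te; apply: he.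
by rewrite /ball /= sub0r normrN.
Qed.

Lemma alpha_linear (s : R) M M' :
  alpha A (s *: M + M') = s *: alpha A M + alpha A M'.
Proof.
apply/funext => i; apply/funext => r; apply/ffunP => K.
have -> : (s *: alpha A M + alpha A M') i r K = s *: alpha A M i r K + alpha A M' i r K.
  change ((s *: alpha A M i r + alpha A M' i r) K = s *: alpha A M i r K + alpha A M' i r K).
  by rewrite [LHS]ffunE; congr (_ + _); rewrite ffunE.
have [ir|ir] := pselect (chartS i r); last first.
  by rewrite /alpha !asboolF // !ffunE scaler0 addr0.
rewrite !alphaE //.
have [/eqP/cards1P[l ->]|K1] := eqVneq #|K| 1%N; last first.
  by rewrite !(alpha_field_homogeneous _ ir.1) // scaler0 addr0.
rewrite !(alpha_fieldE _ _ ir.1) scaler_sumr -big_split; apply: eq_bigr => j _ /=.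
by rewrite mulmxDl -scalemxAl [X in X *: _]mxE [X in (X + _) *: _]mxE scalerDl scalerA.
Qed.

(** The endomorphism F attached to an entry of the curvature kills s because the
    connection is conical, and M s because alpha vanishes. If M s had a component
    orthogonal to the quaternionic line of s, F would vanish by qlin_kernel. *)
Lemma alpha_eq0_tri M i s p q : chart i s -> sqnorm s = 1 ->
  alpha_field M i s = 0 -> entry_mx (fun j l => curv_comp (pot i) j l s) p q != 0 ->
  tri M s s s = 0.
Proof.
move=> is_ s1 a0; set F := entry_mx _ p q => F0.
have [Fskew qF] := (lieSp2P F).1 (curv_comp_lieSp2 F_in_sp2 p q is_).
have FE v k : (F *m v) k 0 = - (\sum_j v j 0 *: curv_comp (pot i) j k s) p q.
  rewrite mxE summxE -sumrN; apply: eq_bigr => j _.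
  by rewrite entry_mxE curv_comp_skew mx_oppE mx_scaleE mulNr mulrC.
have z0 : (0 : 'M[R]_m) p q = 0 by rewrite mxE.
have Fs : F *m s = 0.
  by apply/matrixP => k o; rewrite ord1 FE conical_curv_comp_radial // z0 oppr0 mxE.
have FM : F *m (M *m s) = 0.
  apply/matrixP => k o; rewrite ord1 FE -alpha_fieldE // a0 ffunE z0 oppr0.
  by rewrite mxE.
have Ft : F *m tri M s s s = 0.
  rewrite /tri mulmxDr -scalemxAr FM scaler0 mulmxN mulmx_sumr big1 ?subr0 //.
  by move=> a _; rewrite -scalemxAr qlin_qunit // Fs qunit0 scaler0.
have [//|t0] := eqVneq (tri M s s s) 0.
have := qlin_kernel qF (sqnorm1_neq0 s1) t0 Fs Ft (fun a => @tri_orth R M s a).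
by move=> E; rewrite E eqxx in F0.
Qed.

(** The curvature is nonzero on a neighbourhood of r, where M therefore preserves
    the quaternionic lines through the points of the sphere, hence of the cone over
    it. This cubic condition on an open set propagates to all of R^8 along lines. *)
Lemma alpha_injective c i r j l : chart i r -> sqnorm r = 1 ->
  curv_comp (pot i) j l r != 0 -> alpha A (W012_mx c) = 0 ->
  forall k : nat, (k < 15)%N -> c k = 0.
Proof.
move=> ir r1 F0 a0; apply: tri_eq0_W012 => v.
have oC := @chart_open _ _ _ A i.
have [p [q F0pq]] : exists p q, curv_comp (pot i) j l r p q != 0.
  apply: contrapT => h; move/eqP: F0; apply; apply/matrixP => p q; rewrite [RHS]mxE.
  by apply/eqP; apply: contrapT => /negP n0; apply: h; exists p, q.
have sf := (smooth_on_mxP _ oC).1 (smooth_curv_comp j l oC (@pot_smooth _ _ _ A i)) p q.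
have [cf _] := sf [::] r ir.
pose P := [set y : pt R | chart i y /\ curv_comp (pot i) j l y p q != 0].
have nP : nbhs r P.
  have n1 : \forall y \near r, chart i y by exact: open_nbhs_nbhs.
  have n2 : \forall y \near r, curv_comp (pot i) j l y p q != 0.
    by apply: (cf [set z | z != 0]); apply: open_nbhs_nbhs; split=> //; exact: open_neq.
  by apply: (@filterS2 _ _ (nbhs_filter r) _ _ _ _ n1 n2) => z.
have oU := cone_open (@open_interior _ P).
have Ur : [set y : pt R | y != 0 /\ P^° (radial y)] r.
  by split; [exact: sqnorm1_neq0|rewrite radial_id].
have [e e0 he] := open_line v oU Ur.
apply: (tri_eq0_near (r := r) e0) => t te.
have [y0 Py] := he t te; have [iy Fy] := interior_subset Py.
rewrite (enorm_radial y0) triZ; apply/eqP; rewrite scaler_eq0; apply/orP; right; apply/eqP.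
have s1 := sqnorm_radial y0.
apply: (@alpha_eq0_tri _ i _ p q) => //.
  by rewrite -alphaE ?a0 //; split=> //; apply/S7_sqnorm.
apply/eqP => E; move/eqP: Fy; apply; have := congr1 (fun B : 'M[R]_8 => B j l) E.
by rewrite entry_mxE [X in _ = X -> _]mxE.
Qed.

End Dimension.

(** The infinitesimal real rotation that exchanges the two quaternionic factors. *)
Lemma lieSp2_nontrivial (R : realType) : exists2 B, lieSp2 R B & B != 0.
Proof.
pose B : 'M[R]_8 := \matrix_(k, l) ((k == l + 4 :> nat)%N%:R - (l == k + 4 :> nat)%N%:R).
have BE i j : (i < 8)%N -> (j < 8)%N ->
    B (inord i) (inord j) = (i == j + 4)%N%:R - (j == i + 4)%N%:R.
  by move=> i8 j8; rewrite mxE !inordK.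
exists B; last first.
  apply/eqP => /matrixP/(_ (inord 4) (inord 0)); rewrite BE // [RHS]mxE /= subr0.
  by move/eqP; rewrite oner_eq0.
apply/lieSp2P; split; last split; apply/matrixP => k l; move: k l;
    apply: forall_ord8 => k k8; apply: forall_ord8 => l l8.
- by rewrite mxE BE // [RHS]mxE BE // opprB.
- rewrite mul_I1 // I1_mul //.
  by cases8 k k8; cases8 l l8; rewrite !BE // /I1_sign /=; ring.
- rewrite mul_I2 // I2_mul //.
  by cases8 k k8; cases8 l l8; rewrite !BE // /I2_sign /=; ring.
Qed.

Section Basis.
Variables (R : realType) (m : nat) (G : lie_group R m) (A : connection G).
Implicit Types (x y r s v : pt R) (k j l : 'I_8) (i : idx A) (M : 'M[R]_8).
Hypotheses (A_conical : conical A) (F_in_sp2 : curvature_in A (lieSp2 R)).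

(** If the curvature vanished, the zero subspace would contain its values, and
    would have to be Lie(Sp(2)). Only the values on the sphere matter by
    conical_curvature_eq0. *)
Lemma spanning_curvature_neq0 : curvature_spans_lieSp2 A ->
  exists (i : idx A) r j l, [/\ chart i r, sqnorm r = 1 & curv_comp (pot i) j l r != 0].
Proof.
move=> span; apply: contrapT => none.
have F0 := conical_curvature_eq0 A_conical.
have [B B_sp2 /eqP] := lieSp2_nontrivial R; apply.
have E : [set` (0%VS : {vspace 'M[R]_8})] = lieSp2 R.
  apply: span => [C /=|i x ix]; first by rewrite memv0 => /eqP ->; exact: lieSp20.
  exists 0%N, (fun=> 0), (fun=> 0); split=> [[]//|[]//|j l].
  rewrite big_ord0 eval2_delta curvatureE (curv_curv_compE _ _ (pot_h1 ix)).
  apply: F0 => // i' r ir r1 j' l'; apply: contrapT => /eqP n0; apply: none.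
  by exists i', r, j', l'.
have : [set` (0%VS : {vspace 'M[R]_8})] B by rewrite E.
by rewrite /= memv0 => /eqP.
Qed.

Lemma alpha0 : alpha A 0 = 0.
Proof.
have := alpha_linear A_conical (-1) 0 0.
by rewrite scaler0 addr0 scaleN1r addNr.
Qed.

Definition VA_basis (n : nat) : sform A := alpha A (W012_mx (fun t => (t == n)%:R : R)).

Lemma alpha_W012_mx (c : nat -> R) (d : 'I_15 -> R) : (forall u : 'I_15, c u = d u) ->
  \sum_(u < 15) d u *: VA_basis u = alpha A (W012_mx c).
Proof.
move=> cd.
have S (s : seq 'I_15) : \sum_(k <- s) d k *: VA_basis k =
    alpha A (W012_mx (fun t => \sum_(k <- s) d k * (t == k :> nat)%:R)).
  elim: s => [|k s IH].
    rewrite big_nil -alpha0; congr (alpha A _).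
    have := W012_mx_linear (-1 : R) (fun=> 0) (fun=> 0); rewrite scaleN1r addNr => <-.
    by congr W012_mx; apply/funext => t; rewrite big_nil mulr0 addr0.
  rewrite big_cons IH; apply: (etrans (esym (alpha_linear A_conical _ _ _))).
  congr (alpha A _); apply: (etrans (esym (W012_mx_linear _ _ _))).
  by congr W012_mx; apply/funext => t; rewrite big_cons.
rewrite S; congr (alpha A _).
have h (t : nat) : (t < 15)%N -> \sum_(k < 15) d k * (t == k :> nat)%:R = c t.
  move=> t15; rewrite (bigD1 (Ordinal t15)) //= eqxx mulr1 big1 ?addr0 ?(cd (Ordinal t15)) //.
  move=> k; rewrite -val_eqE eq_sym /= => /negPf ->; exact: mulr0.
by rewrite /W012_mx !h.
Qed.

Lemma VA_has_dim : curvature_spans_lieSp2 A -> has_dim (VA A) 15.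
Proof.
move=> span; exists (fun k : 'I_15 => VA_basis k); split.
  move=> d d0 k; pose c t := if insub t is Some u then d u else 0.
  have cd u : c (val u) = d u by rewrite /c valK.
  have [i [r [j [l [ir r1 F0]]]]] := spanning_curvature_neq0 span.
  rewrite (alpha_W012_mx cd) in d0.
  have c0 := alpha_injective A_conical F_in_sp2 ir r1 F0 d0.
  by rewrite -cd (c0 _ (ltn_ord k)).
apply/seteqP; split=> [_ [M /W012P[c ->] <-]|_ [d ->]].
  by exists (fun k : 'I_15 => c k); rewrite (@alpha_W012_mx c).
pose c t := if insub t is Some u then d u else 0.
have cd u : c (val u) = d u by rewrite /c valK.
by rewrite (alpha_W012_mx cd); exists (W012_mx c) => //; apply/W012P; exists c.
Qed.
End Basis.

Unset Implicit Arguments.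

Theorem proposition4p4 (R : realType) (m : nat) (G : lie_group R m)
    (A : connection G)
    (A_instanton : instanton A)
    (A_conical : conical A)
    (F_in_sp2 : curvature_in A (lieSp2 R)) :
  VA A `<=` kerL A
  /\ (curvature_spans_lieSp2 A -> has_dim (VA A) 15).
Proof.
split; first exact: VA_kerL.
exact: VA_has_dim.
Qed.
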